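(* Let $A \in \mathbb{R}^{m \times n}$ with $r = \operatorname{rank}(A) \ge 1$, and $b \in \mathbb{R}^m$. Fix $\gamma > 1$, set $s = \lceil \gamma n \rceil$, let $G \in \mathbb{R}^{s \times m}$ have independent standard normal entries, let $\tilde A = GA$ with economy-sized SVD $\tilde A = \tilde U \tilde\Sigma \tilde V^{T}$ ($\tilde\Sigma$ square diagonal with positive entries), and let $N = \tilde V \tilde\Sigma^{-1}$. Let $\varepsilon > 0$ and $\alpha \in (0, 1 - \sqrt{r/s})$. Apply, in exact arithmetic, a CG-like method to $\min_y \|ANy - b\|_2$ starting from $y^{(0)} = 0$, and let $\hat y_{\mathrm{CG}}$ be its iterate after $\lceil (\log\varepsilon - \log 2)/\log(\alpha + \sqrt{r/s}) \rceil$ iterations. Let $y^* = (AN)^\dagger b$, $\hat x_{\mathrm{CG}} = N \hat y_{\mathrm{CG}}$, $x^* = A^\dagger b$, $\hat r_{\mathrm{CG}} = b - A\hat x_{\mathrm{CG}}$ and $r^* = b - A x^*$. Then with probability at least $1 - 2e^{-\alpha^2 s/2}$, \[ \|\hat y_{\mathrm{CG}} - y^*\|_{(AN)^{T}(AN)} \le \varepsilon \|y^*\|_{(AN)^{T}(AN)}, \] and this inequality is equivalent to $\|\hat x_{\mathrm{CG}} - x^*\|_{A^{T}A} \le \varepsilon \|x^*\|_{A^{T}A}$, and also to $\|\hat r_{\mathrm{CG}} - r^*\|_2 \le \varepsilon \|b - r^*\|_2$.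
   Context: For a positive semidefinite matrix $B$, $\|z\|_B$ denotes the seminorm $(z^{T} B z)^{1/2}$, so $\|z\|_{A^TA} = \|Az\|_2$. A ''CG-like method'' for $\min_y \|Cy - b\|_2$ is a Krylov subspace method mathematically equivalent in exact arithmetic to the conjugate gradient method applied to the normal equations $C^{T} C y = C^{T} b$ (e.g. CGLS or LSQR); started at $y^{(0)}=0$ its iterates satisfy the classical bound $\|y^{(k)} - y^*\|_{C^TC} \le 2\left(\frac{\sqrt{\kappa(C^TC)}-1}{\sqrt{\kappa(C^TC)}+1}\right)^k \|y^{(0)} - y^*\|_{C^TC}$, where $\kappa$ is the ratio of extreme nonzero singular values. $B^\dagger$ denotes the Moore–Penrose pseudoinverse. *)

(* Defs.v *)
From HB Require Import structures.
From mathcomp Require Import all_boot all_order all_algebra.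
From mathcomp Require Import all_classical all_reals all_analysis.

Set Implicit Arguments.
Unset Strict Implicit.
Unset Printing Implicit Defensive.

Import Order.TTheory GRing.Theory Num.Theory.

Local Open Scope classical_set_scope.
Local Open Scope ring_scope.

Definition dotcv (R : realType) (n : nat) (u v : 'cV[R]_n) : R :=
  (u^T *m v) 0 0.

(* The norm [`|v|] that MathComp-Analysis puts on matrices is the sup norm. *)
Definition norm2 (R : realType) (n : nat) (v : 'cV[R]_n) : R :=
  Num.sqrt (\sum_i v i 0 ^+ 2).

Definition seminorm_mx (R : realType) (n : nat) (B : 'M[R]_n) (z : 'cV[R]_n) :
  R := Num.sqrt ((z^T *m B *m z) 0 0).

Definition penrose (R : realType) (m n : nat) (A : 'M[R]_(m, n))
    (X : 'M[R]_(n, m)) : Prop :=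
  [/\ A *m X *m A = A,
      X *m A *m X = X,
      (A *m X)^T = A *m X
    & (X *m A)^T = X *m A].

(* Not MathComp's [pinvmx], which is only a one-sided generalized inverse. *)
Definition mpinv (R : realType) (m n : nat) (A : 'M[R]_(m, n)) : 'M[R]_(n, m) :=
  xget 0 [set X | penrose A X].

Lemma row_free_gram_unit (R : realType) (m n : nat) (B : 'M[R]_(m, n)) :
  row_free B -> B *m B^T \in unitmx.
Proof.
move=> Bfree; rewrite -row_free_unit; apply/inj_row_free => u uBB.
have uB0 : u *m B = 0.
  have h : (u *m B) *m (u *m B)^T = 0 by rewrite trmx_mul !mulmxA -mulmxA mulmxA
    -(mulmxA u B) uBB mul0mx.
  have /matrixP/(_ 0 0) := h; rewrite !mxE => /eqP.
  rewrite psumr_eq0 => [/allP h0|i _]; last by rewrite !mxE -expr2 sqr_ge0.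
  apply/matrixP => i j; rewrite (ord1 i) [RHS]mxE; apply/eqP.
  have := h0 j (mem_index_enum j).
  by rewrite [X in _ * X == 0]mxE -expr2 sqrf_eq0.
by apply: (row_free_inj Bfree); rewrite uB0 mul0mx.
Qed.

Lemma penrose_exists (R : realType) (m n : nat) (A : 'M[R]_(m, n)) :
  exists X, penrose A X.
Proof.
suff [k [C [Q [AE freeQ fullC]]]] : exists (k : nat) (C : 'M[R]_(m, k))
    (Q : 'M[R]_(k, n)), [/\ A = C *m Q, row_free Q & row_full C]; last first.
  exists (\rank A), (col_base A), (row_base A).
  by rewrite mulmx_base row_base_free col_base_full.
have uQ : Q *m Q^T \in unitmx by apply: row_free_gram_unit.
have uC : C^T *m C \in unitmx.
  rewrite -[X in _ *m X]trmxK; apply: row_free_gram_unit.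
  by rewrite /row_free mxrank_tr.
set IQ := invmx (Q *m Q^T); set IC := invmx (C^T *m C).
have sQ : IQ^T = IQ by rewrite /IQ trmx_inv trmx_mul trmxK.
have sC : IC^T = IC by rewrite /IC trmx_inv trmx_mul trmxK.
pose X := Q^T *m IQ *m (IC *m C^T).
have AX : A *m X = C *m IC *m C^T.
  rewrite /X AE !mulmxA -(mulmxA C Q) -(mulmxA C (Q *m Q^T)) mulmxV //.
  by rewrite mulmx1.
have XA : X *m A = Q^T *m IQ *m Q.
  rewrite /X AE !mulmxA -(mulmxA _ C^T C) -(mulmxA _ IC) mulVmx //.
  by rewrite mulmx1.
exists X; split.
- rewrite AX {1}AE !mulmxA -(mulmxA _ C^T C) -(mulmxA _ IC) mulVmx //.
  by rewrite mulmx1 -AE.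
- rewrite XA /X !mulmxA -(mulmxA _ Q Q^T) -(mulmxA _ (Q *m Q^T) IQ).
  by rewrite mulmxV // mulmx1.
- by rewrite AX !trmx_mul trmxK sC mulmxA.
- by rewrite XA !trmx_mul trmxK sQ mulmxA.
Qed.

Lemma penrose_unique (R : realType) (m n : nat) (A : 'M[R]_(m, n))
    (X Y : 'M[R]_(n, m)) :
  penrose A X -> penrose A Y -> X = Y.
Proof.
move=> [AXA XAX sAX sXA] [AYA YAY sAY sYA].
have AXY : A *m X = A *m Y.
  by rewrite -sAX -{1}AYA -(mulmxA (A *m Y)) trmx_mul sAX sAY mulmxA AXA.
have XYA : X *m A = Y *m A.
  by rewrite -sXA -{1}AYA -mulmxA mulmxA trmx_mul sXA sYA -!mulmxA
    (mulmxA A X) AXA.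
by rewrite -XAX XYA -mulmxA AXY mulmxA YAY.
Qed.

Lemma mpinvP (R : realType) (m n : nat) (A : 'M[R]_(m, n)) :
  penrose A (mpinv A).
Proof. by have [X AX] := penrose_exists A; apply: (xgetI _ AX). Qed.

Record econ_svd (R : realType) (m n : nat) (M : 'M[R]_(m, n)) := EconSVD {
  svd_size : nat;
  svd_U : 'M[R]_(m, svd_size);
  svd_sigma : 'rV[R]_svd_size;
  svd_V : 'M[R]_(n, svd_size);
  svd_U_orth : svd_U^T *m svd_U = 1%:M;
  svd_V_orth : svd_V^T *m svd_V = 1%:M;
  svd_sigma_gt0 : forall i, 0 < svd_sigma 0 i;
  svd_eq : M = svd_U *m diag_mx svd_sigma *m svd_V^T }.

Definition svd_precond (R : realType) (m n : nat) (M : 'M[R]_(m, n))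
    (D : econ_svd M) : 'M[R]_(n, svd_size D) :=
  svd_V D *m invmx (diag_mx (svd_sigma D)).

(* One step of the Hestenes-Stiefel recursion for M y = c on the triple
   (iterate, residual, search direction). Since x / 0 = 0, the iterate stays
   where it is once the residual vanishes. *)
Definition cg_step (R : realType) (n : nat) (M : 'M[R]_n)
    (st : 'cV[R]_n * 'cV[R]_n * 'cV[R]_n) : 'cV[R]_n * 'cV[R]_n * 'cV[R]_n :=
  let: (y, res, p) := st in
  let a := dotcv res res / dotcv p (M *m p) in
  let res' := res - a *: (M *m p) in
  let beta := dotcv res' res' / dotcv res res in
  (y + a *: p, res', res' + beta *: p).

Definition cg_iter (R : realType) (n : nat) (M : 'M[R]_n) (c y0 : 'cV[R]_n)
    (k : nat) : 'cV[R]_n :=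
  let res0 := c - M *m y0 in
  (iter k (cg_step M) (y0, res0, res0)).1.1.

(* Exact-arithmetic iterative methods for min_y ||C y - b||_2: matrix C,
   right-hand side b, starting vector, iteration count. *)
Definition ls_method (R : realType) : Type :=
  forall m n : nat, 'M[R]_(m, n) -> 'cV[R]_m -> 'cV[R]_n -> nat -> 'cV[R]_n.

Definition cg_like (R : realType) (meth : ls_method R) : Prop :=
  forall (m n : nat) (C : 'M[R]_(m, n)) (b : 'cV[R]_m) (y0 : 'cV[R]_n)
         (k : nat),
    meth m n C b y0 k = cg_iter (C^T *m C) (C^T *m b) y0 k.

Section probability.
Context (R : realType) (d : measure_display) (T : measurableType d).
Variable P : probability T R.

Definition mutually_independent (I : finType) (X : I -> {RV P >-> R}) : Prop :=
  forall (J : {set I}) (B : I -> set R),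
    (forall i, i \in J -> measurable (B i)) ->
    P (\bigcap_(i in [set` J]) (X i @^-1` B i)) =
    (\prod_(i in J) P (X i @^-1` B i))%E.

Definition std_normal (X : {RV P >-> R}) : Prop :=
  forall B : set R, measurable B ->
    distribution P X B = normal_prob 0 1 B.

Definition gaussian_matrix (s m : nat) (G : 'I_s -> 'I_m -> {RV P >-> R}) :
    Prop :=
  (forall i j, std_normal (G i j)) /\
  mutually_independent (fun ij : 'I_s * 'I_m => G ij.1 ij.2).

Definition sample_mx (s m : nat) (G : 'I_s -> 'I_m -> {RV P >-> R}) (w : T) :
    'M[R]_(s, m) := \matrix_(i, j) G i j w.

(* Stated through a measurable sub-event because P has no meaning on
   non-measurable sets. *)
Definition with_prob_at_least (p : R) (Q : T -> Prop) : Prop :=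
  exists E : set T,
    [/\ measurable E, (forall w, E w -> Q w) & (p%:E <= P E)%E].

End probability.

(* Main.v *)
Require Import Defs.
From HB Require Import structures.
From mathcomp Require Import all_boot all_order all_algebra.
From mathcomp Require Import all_classical all_reals all_analysis measurable_realfun.
From mathcomp Require Import ring lra zify.

(* Let r = rank A, let Q have orthonormal rows spanning the column space of A,
   and let t = alpha sqrt s. With probability at least 1 - 2 exp (- t^2 / 2), all
   singular values of the Gaussian matrix G Q^T lie between sqrt s - sqrt r - t
   and sqrt s + sqrt r + t. On that event G A N has orthonormal columns, so the
   singular values of A N lie between the inverses of these numbers, whose ratio
   is (1 + th) / (1 - th) for th = alpha + sqrt (r / s); the Chebyshev bound for
   conjugate gradients then reads 2 th^k.

   The singular value bound is obtained without concentration of measure. Add one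
   normal variable to the field (u, v) |-> <v, G Q^T u>; Gordon's comparison
   inequality then bounds exp (- lam min_u max_v), and exp (lam max_u max_v), in
   mean by the same functional of <g, v> + <h, u>, so only the Laplace transforms
   of |g| and |h| are needed. The one of - |g| is
   at most exp (- lam sqrt s + lam^2 / 2), which follows from Stein's identity
   once lam is not too small, and lam = t is small only if the claimed
   probability is not positive. Markov's inequality and nets of mesh tending to
   zero finish the proof.

   The equivalence holds whenever G is injective on the column space of A, because
   then A N and A have the same range and A N y* = A x*; a determinant that is a
   nonzero polynomial in the entries of G vanishes with probability zero. *)

Set Implicit Arguments.
Unset Strict Implicit.
Unset Printing Implicit Defensive.

Import Order.TTheory GRing.Theory Num.Theory.
Import numFieldNormedType.Exports.

Local Open Scope classical_set_scope.
Local Open Scope ring_scope.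

(** * Conjugate gradients *)

(** Gordon's inequality is usually obtained by differentiating along a path of covariances, but a
    min-max is not smooth. Here the covariance difference is cut into small pieces. Each piece
    trades independent noises at two coordinates for a common one, and an inequality between four
    values ([submodular]) controls the trade. The trade consumes diagonal noise, so a little is
    added to both fields and removed at the end, because the functional is log-Lipschitz. The only
    fact about Gaussian laws behind this is that [gauss_ex] depends on its list of vectors through
    the covariance.

    For the transform M of - |g|, the differential inequality M' <= - (sqrt (n - 1) - lam / 2) M is
    likewise replaced by finite steps. It yields the term lam^2 / 4 where lam^2 / 2 is allowed; the
    spare part pays for sqrt n - sqrt (n - 1) as soon as lam >= 23/20. This constant lies just below
    sqrt (2 ln 2), where 1 - 2 exp (- t^2 / 2) changes sign.

    The conjugate gradient bound uses no eigenvalues: Chebyshev polynomials are bounded through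
    Pell's identity and the positivity of a linear form on polynomials. *)

Section dotcv_theory.
Context {R : realType}.
Implicit Types (m n : nat).

Lemma dotcvE n (u v : 'cV[R]_n) : dotcv u v = \sum_i u i 0 * v i 0.
Proof. by rewrite /dotcv mxE; apply: eq_bigr => i _; rewrite mxE. Qed.

Lemma dotcvC n (u v : 'cV[R]_n) : dotcv u v = dotcv v u.
Proof. by rewrite !dotcvE; apply: eq_bigr => i _; rewrite mulrC. Qed.

Lemma dotcvDr n (u v w : 'cV[R]_n) : dotcv u (v + w) = dotcv u v + dotcv u w.
Proof. by rewrite /dotcv mulmxDr mxE. Qed.

Lemma dotcvZr n a (u v : 'cV[R]_n) : dotcv u (a *: v) = a * dotcv u v.
Proof. by rewrite /dotcv -scalemxAr mxE. Qed.

Lemma dotcvNr n (u v : 'cV[R]_n) : dotcv u (- v) = - dotcv u v.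
Proof. by rewrite /dotcv mulmxN mxE. Qed.

Lemma dotcvBr n (u v w : 'cV[R]_n) : dotcv u (v - w) = dotcv u v - dotcv u w.
Proof. by rewrite dotcvDr dotcvNr. Qed.

Lemma dotcvDl n (u v w : 'cV[R]_n) : dotcv (v + w) u = dotcv v u + dotcv w u.
Proof. by rewrite dotcvC dotcvDr !(dotcvC u). Qed.

Lemma dotcvZl n a (u v : 'cV[R]_n) : dotcv (a *: u) v = a * dotcv u v.
Proof. by rewrite dotcvC dotcvZr dotcvC. Qed.

Lemma dotcvNl n (u v : 'cV[R]_n) : dotcv (- u) v = - dotcv u v.
Proof. by rewrite dotcvC dotcvNr dotcvC. Qed.

Lemma dotcvBl n (u v w : 'cV[R]_n) : dotcv (v - w) u = dotcv v u - dotcv w u.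
Proof. by rewrite dotcvDl dotcvNl. Qed.

Lemma dotcv0r n (u : 'cV[R]_n) : dotcv u 0 = 0.
Proof. by rewrite /dotcv mulmx0 mxE. Qed.

Lemma dotcv_mull m n (B : 'M[R]_(m, n)) (u : 'cV_n) (v : 'cV_m) :
  dotcv (B *m u) v = dotcv u (B^T *m v).
Proof. by rewrite /dotcv trmx_mul mulmxA. Qed.

Lemma dotcv_ge0 n (u : 'cV[R]_n) : 0 <= dotcv u u.
Proof. by rewrite dotcvE sumr_ge0// => i _; rewrite -expr2 sqr_ge0. Qed.

Lemma dotcv_eq0 n (u : 'cV[R]_n) : (dotcv u u == 0) = (u == 0).
Proof.
apply/eqP/eqP => [|->]; last exact: dotcv0r.
rewrite dotcvE => /eqP; rewrite psumr_eq0 => [/allP u0|i _]; last first.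
  by rewrite -expr2 sqr_ge0.
apply/colP => i; have := u0 i (mem_index_enum i).
by rewrite -expr2 sqrf_eq0 mxE => /eqP.
Qed.

Lemma dotcv_gt0 n (u : 'cV[R]_n) : (0 < dotcv u u) = (u != 0).
Proof. by rewrite lt_neqAle dotcv_ge0 andbT eq_sym dotcv_eq0. Qed.

End dotcv_theory.

(** * Chebyshev polynomials *)

Section chebyshev.
Context {R : realType}.
Implicit Types (B : {poly R}).

(* The Chebyshev pair (T_k(B), U_{k-1}(B)), i.e. the k-th power of the unit
   B + sqrt(B^2 - 1) in the basis (1, sqrt(B^2 - 1)). *)
Fixpoint chebTU B k : {poly R} * {poly R} :=
  if k is j.+1 then
    let tu := chebTU B j in
    (B * tu.1 + (B ^+ 2 - 1) * tu.2, B * tu.2 + tu.1)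
  else (1, 0).

Lemma chebTU_pell B k :
  (chebTU B k).1 ^+ 2 + (1 - B ^+ 2) * (chebTU B k).2 ^+ 2 = 1.
Proof.
elim: k => [|k IH] /=; first by ring.
rewrite -[RHS]IH; ring.
Qed.

Lemma size_polyM_leq (p q : {poly R}) i j k : (size p <= i)%N ->
  (size q <= j)%N -> (i + j <= k.+1)%N -> (size (p * q)%R <= k)%N.
Proof.
move=> pi qj ijk; apply: (leq_trans (size_polyMleq _ _)).
move: pi qj; set x := size p; set y := size q; lia.
Qed.

Lemma size_polyD_leq (p q : {poly R}) k : (size p <= k)%N ->
  (size q <= k)%N -> (size (p + q)%R <= k)%N.
Proof.
by move=> pk qk; apply: (leq_trans (size_polyD _ _)); rewrite geq_max pk.
Qed.

Lemma size_chebTU B k : (size B <= 2)%N ->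
  (size (chebTU B k).1 <= k.+1)%N /\ (size (chebTU B k).2 <= k)%N.
Proof.
move=> sB; elim: k => [|k [IHt IHu]] /=; first by rewrite size_poly1 size_poly0.
have sB2 : (size (B ^+ 2 - 1)%R <= 3)%N.
  apply: size_polyD_leq; first exact: (size_polyM_leq sB sB).
  by rewrite size_polyN size_poly1.
split; apply: size_polyD_leq => //.
- by apply: (size_polyM_leq sB IHt).
- by apply: (size_polyM_leq sB2 IHu).
- by apply: (size_polyM_leq sB IHu).
Qed.

(* T_k((z + 1/z)/2) = (z^k + z^-k)/2 *)
Lemma chebTU_joukowski B k (x z : R) : z != 0 ->
  B.[x] = (z + z^-1) / 2 ->
  (chebTU B k).1.[x] = (z ^+ k + z^-1 ^+ k) / 2 /\
  (z^-1 - z) * (chebTU B k).2.[x] = z^-1 ^+ k - z ^+ k.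
Proof.
move=> z0 Bx; elim: k => [|k [IHt IHu]] /=.
  by rewrite !hornerE !expr0 subrr; split => //; field.
rewrite !hornerE Bx IHt; set u := (chebTU B k).2.[x] in IHu *.
split.
  transitivity ((z + z^-1) / 2 * ((z ^+ k + z^-1 ^+ k) / 2) +
     (z^-1 - z) / 4 * ((z^-1 - z) * u)); first by field.
  rewrite IHu !exprS; by field.
rewrite mulrDr mulrCA IHu !exprS; by field.
Qed.

End chebyshev.

(** * Conjugate gradient iterates as polynomials in the matrix *)

Section cg.
Context {R : realType} (n : nat) (M : 'M[R]_n.+1).
Hypothesis MT : M^T = M.
Variables (a b : R).
Hypotheses (a0 : 0 < a) (ab : a < b).
Hypothesis Mge : forall x : 'cV_n.+1, a * dotcv x x <= dotcv x (M *m x).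
Hypothesis Mle : forall x : 'cV_n.+1, dotcv x (M *m x) <= b * dotcv x x.

Local Notation h := (horner_mx M).

Implicit Types (p q : {poly R}) (x y : 'cV[R]_n.+1).

Lemma horner_mx_sym p : (h p)^T = h p.
Proof.
elim/poly_ind: p => [|p c IH]; first by rewrite rmorph0 trmx0.
rewrite rmorphD rmorphM /= horner_mx_X horner_mx_C linearD /= trmx_mul.
rewrite tr_scalar_mx MT IH; congr (_ + _).
by rewrite mulmxE -{1 4}(horner_mx_X M) -!rmorphM mulrC.
Qed.

Lemma horner_mxXM p x : h ('X * p) *m x = M *m (h p *m x).
Proof. by rewrite rmorphM /= horner_mx_X -mulmxE mulmxA. Qed.

Lemma horner_mxZM c p x : h (c *: p) *m x = c *: (h p *m x).
Proof.
by rewrite -mul_polyC rmorphM /= horner_mx_C -mulmxE -mulmxA mul_scalar_mx.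
Qed.

Lemma horner_mxBM p q x : h (p - q) *m x = h p *m x - h q *m x.
Proof. by rewrite rmorphB mulmxBl. Qed.

Lemma horner_mxDM p q x : h (p + q) *m x = h p *m x + h q *m x.
Proof. by rewrite rmorphD mulmxDl. Qed.

Lemma dotcv_horner x y p q : dotcv (h p *m x) (h q *m y) =
  dotcv x (h (p * q) *m y).
Proof. by rewrite dotcv_mull horner_mx_sym mulmxA mulmxE -rmorphM. Qed.

Lemma dotcvM_ge0 x : 0 <= dotcv x (M *m x).
Proof. by rewrite (le_trans _ (Mge x))// mulr_ge0 ?dotcv_ge0// ltW. Qed.

Lemma mulmx_pd_eq0 x : M *m x = 0 -> x = 0.
Proof.
move=> Mx; apply/eqP; rewrite -dotcv_eq0 eq_le dotcv_ge0 andbT.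
by have := Mge x; rewrite Mx dotcv0r pmulr_rle0.
Qed.

Variable e0 : 'cV[R]_n.+1.

(** [L (q * q)] is the energy of [h q *m e0]. Positivity of [L] on squares weighted by X - a, b - X
    and their product replaces integration against a spectral measure on [a, b]. *)
Let L p := dotcv e0 (h ('X * p) *m e0).

Let LD p q : L (p + q) = L p + L q.
Proof. by rewrite /L mulrDr rmorphD mulmxDl dotcvDr. Qed.

Let LZ c p : L (c%:P * p) = c * L p.
Proof.
by rewrite /L mulrCA rmorphM /= horner_mx_C -mulmxE mul_scalar_mx -scalemxAl
  dotcvZr.
Qed.

Let LE p q : L (p * q) = dotcv (h p *m e0) (M *m (h q *m e0)).
Proof.
rewrite mulmxA -[X in X *m h q]horner_mx_X mulmxE -rmorphM /= dotcv_horner /L.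
by rewrite mulrCA.
Qed.

Let L_sqr_ge0 q : 0 <= L (q * q).
Proof. by rewrite LE dotcvM_ge0. Qed.

Let L_suba_ge0 q : 0 <= L (('X - a%:P) * (q * q)).
Proof.
rewrite mulrA LE rmorphM rmorphB /= horner_mx_X horner_mx_C -mulmxE.
rewrite -mulmxA; set v := h q *m e0.
have -> : M *m v = (M - a%:M) *m v + a *: v.
  by rewrite mulmxBl mul_scalar_mx subrK.
rewrite dotcvDr addr_ge0 ?dotcv_ge0// dotcvZr mulr_ge0 ?(ltW a0)//.
rewrite mulmxBl mul_scalar_mx dotcvBl dotcvZl dotcvC subr_ge0; exact: Mge.
Qed.

Let L_bsub_ge0 q : 0 <= L ((b%:P - 'X) * (q * q)).
Proof.
have b0 : 0 < b by exact: lt_trans ab.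
rewrite -(pmulr_rge0 _ b0) -LZ.
(* The bound by [b] is available only as a quadratic form. Multiplying by b leaves a square and a
   term that is this form at M v. *)
have -> : b%:P * ((b%:P - 'X) * (q * q)) =
  ((b%:P - 'X) * q) * ((b%:P - 'X) * q) + ('X * q) * ((b%:P - 'X) * q).
  by ring.
rewrite LD addr_ge0// LE.
have -> : h ('X * q) *m e0 = M *m (h q *m e0).
  by rewrite rmorphM /= horner_mx_X -mulmxE mulmxA.
have -> : h ((b%:P - 'X) * q) *m e0 = b *: (h q *m e0) - M *m (h q *m e0).
  rewrite rmorphM rmorphB /= horner_mx_X horner_mx_C -mulmxE -mulmxA mulmxBl.
  by rewrite mul_scalar_mx.
set v := h q *m e0; set w := M *m v.
rewrite mulmxBr -scalemxAr -/w dotcvBr dotcvZr subr_ge0; exact: Mle.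
Qed.

Let L_ab_ge0 q : 0 <= L (('X - a%:P) * (b%:P - 'X) * (q * q)).
Proof.
have ba0 : 0 < b - a by rewrite subr_gt0.
rewrite -(pmulr_rge0 _ ba0) -LZ.
(* Writing b - a = (b - X) + (X - a) reduces the product weight to the two linear weights. *)
have -> : (b - a)%:P * (('X - a%:P) * (b%:P - 'X) * (q * q)) =
  (b%:P - 'X) * ((('X - a%:P) * q) * (('X - a%:P) * q)) +
  ('X - a%:P) * (((b%:P - 'X) * q) * ((b%:P - 'X) * q)).
  by rewrite polyCB; ring.
rewrite LD; apply: addr_ge0; [exact: L_bsub_ge0|exact: L_suba_ge0].
Qed.

(** Pell's identity gives 1 - T^2 = (1 - B^2) U^2, and 1 - B^2 is a positive multiple of (X - a)(b -
    X). This is |T| <= 1 on [a, b] without a spectral decomposition. *)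
Lemma cheb_energy_le k (B := ((b - a)^-1)%:P * ((b + a)%:P - 2%:P * 'X)) :
  L ((chebTU B k).1 * (chebTU B k).1) <= L 1.
Proof.
have ba0 : 0 < b - a by rewrite subr_gt0.
rewrite -subr_ge0 -mulN1r -(LZ (-1)) -LD.
set t := (chebTU B k).1; set u := (chebTU B k).2.
have -> : 1 + (-1)%:P * (t * t) =
   (4 / (b - a) ^+ 2)%:P * (('X - a%:P) * (b%:P - 'X) * (u * u)).
  have := chebTU_pell B k; rewrite -/t -/u => /(congr1 (fun p => p - t ^+ 2)).
  rewrite addrAC subrr add0r => Hu.
  rewrite polyCN polyC1 mulN1r -expr2 -Hu -[u * u]expr2.
  move: (u ^+ 2) => w; rewrite mulrA; congr (_ * w).
  rewrite /B; set c := ((b - a)^-1)%:P.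
  have E1 : c * (b%:P - a%:P) = 1.
    by rewrite -polyCB -polyCM mulVf// gt_eqF.
  have -> : (4 / (b - a) ^+ 2)%:P = c * c * 4.
    rewrite -[4 in RHS]polyC_natr -!polyCM; congr (_%:P).
    by field; rewrite gt_eqF.
  rewrite polyCD polyC_natr.
  transitivity ((c * (b%:P - a%:P)) ^+ 2 - (c * (b%:P + a%:P - 2 * 'X)) ^+ 2).
    by rewrite E1 expr1n.
  by ring.
by rewrite LZ mulr_ge0// divr_ge0// sqr_ge0.
Qed.

Let r0 := M *m e0.
Let Psi p := dotcv r0 (h p *m r0).

Let PsiD p q : Psi (p + q) = Psi p + Psi q.
Proof. by rewrite /Psi rmorphD mulmxDl dotcvDr. Qed.

Let PsiZ c p : Psi (c *: p) = c * Psi p.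
Proof. by rewrite /Psi horner_mxZM dotcvZr. Qed.

Let PsiB p q : Psi (p - q) = Psi p - Psi q.
Proof. by rewrite -scaleN1r PsiD PsiZ mulN1r. Qed.

Let PsiE p q : dotcv (h p *m r0) (h q *m r0) = Psi (p * q).
Proof. by rewrite dotcv_horner. Qed.

Let PsiXE p q : dotcv (h p *m r0) (M *m (h q *m r0)) = Psi ('X * (p * q)).
Proof.
by rewrite -horner_mxXM dotcv_horner mulrCA.
Qed.

Let LPsi p : L ('X * p) = Psi p.
Proof.
rewrite /L /Psi dotcv_mull MT -!horner_mxXM /r0 -[M in h _ *m (M *m _)]horner_mx_X.
by rewrite mulmxA mulmxE -rmorphM /= -mulrA [p * 'X]mulrC.
Qed.

(** Orthogonality to one more Krylov dimension splits into a test against the current direction [pi]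
    and a test in the previous space. *)
Lemma size_split_top (pi q : {poly R}) k : size pi = k.+1 ->
  (size q <= k.+1)%N ->
  exists c q', q = c *: pi + q' /\ (size q' <= k)%N.
Proof.
move=> spi sq.
have lpi : pi`_k != 0.
  by have := lead_coef_eq0 pi; rewrite lead_coefE spi /= => ->; rewrite -size_poly_eq0 spi.
exists (q`_k / pi`_k), (q - (q`_k / pi`_k) *: pi); split.
  by rewrite addrC subrK.
apply/leq_sizeP => j; rewrite leq_eqVlt => /orP[/eqP <-|kj].
  by rewrite coefB coefZ divfK// subrr.
have pj : pi`_j = 0 by apply: nth_default; rewrite spi.
have qj : q`_j = 0 by apply: nth_default; exact: leq_trans kj.
by rewrite coefB coefZ pj qj mulr0 subr0.
Qed.

(* The last three clauses say that the residual is orthogonal, and the search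
   direction conjugate, to the k-th Krylov space. *)
Let cg_spec k (st : 'cV[R]_n.+1 * 'cV[R]_n.+1 * 'cV[R]_n.+1) :=
  exists rh pi : {poly R},
  [/\ e0 - st.1.1 = h rh *m e0, st.1.2 = h rh *m r0, st.2 = h pi *m r0 &
      (st.1.2 = 0 -> st.2 = 0)] /\
  [/\ rh.[0] = 1, (size rh <= k.+1)%N, size pi = k.+1,
      (size (pi - rh)%R <= k)%N &
      (forall q, (size q <= k)%N -> Psi (rh * q) = 0) /\
      (forall q, (size q <= k)%N -> Psi ('X * (pi * q)) = 0)].

Let cg_step_spec k st : cg_spec k st -> st.1.2 != 0 -> cg_spec k.+1 (cg_step M st).
Proof.
case: st => [[y res] p] [rh [pi /= [[Ey Er Ep Z] [rh0 srh spi spr [orth conj]]]]] res0.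
have Prr : Psi (rh * rh) != 0 by rewrite -PsiE -Er dotcv_eq0.
have Prp : Psi (rh * pi) = Psi (rh * rh).
  have -> : rh * pi = rh * rh + rh * (pi - rh) by ring.
  by rewrite PsiD (orth _ spr) addr0.
have p0 : p != 0.
  apply: contraNneq Prr => p0; rewrite -Prp mulrC -PsiE -Ep p0.
  by rewrite dotcvC dotcv0r.
have Ppp : Psi ('X * (pi * pi)) != 0.
  rewrite -PsiXE -Ep gt_eqF//.
  by rewrite (lt_le_trans _ (Mge p))// mulr_gt0// dotcv_gt0.
set al := Psi (rh * rh) / Psi ('X * (pi * pi)).
have al0 : al != 0 by rewrite mulf_neq0// invr_eq0.
pose rh' := rh - al *: ('X * pi).
pose be := Psi (rh' * rh') / Psi (rh * rh).
have Er' : res - (dotcv res res / dotcv p (M *m p)) *: (M *m p) = h rh' *m r0.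
  by rewrite Ep Er PsiE PsiXE -/al horner_mxBM horner_mxZM horner_mxXM.
have sX q j : (size q <= j)%N -> (size ('X * q)%R <= j.+1)%N.
  by move=> sq; apply: (@size_polyM_leq _ _ _ 2 j); rewrite ?size_polyX// addSn.
(* The step length [al] is the one that cancels the component along [pi]; the remainder vanishes by
   the invariants of the previous step. *)
have orth' q : (size q <= k.+1)%N -> Psi (rh' * q) = 0.
  move=> /(size_split_top spi)[c [q' [-> sq']]].
  have -> : rh' * (c *: pi + q') = c *: (rh * pi - al *: ('X * (pi * pi))) +
      (rh * q' - al *: ('X * (pi * q'))).
    by rewrite /rh' -!mul_polyC; ring.
  rewrite PsiD PsiZ !PsiB !PsiZ (orth _ sq') (conj _ sq') Prp.
  by rewrite divfK// subrr !mulr0 subr0 addr0.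
have srh' : (size rh' <= k.+2)%N.
  apply: size_polyD_leq; first exact: leqW.
  by rewrite size_polyN (leq_trans (size_scale_leq _ _))// sX// spi.
exists rh', (rh' + be *: pi); split; [split|split] => /=.
- rewrite opprD addrA Ey Er Ep PsiE PsiXE -/al /rh' horner_mxBM horner_mxZM.
  by rewrite [in RHS]mulrC rmorphM /= horner_mx_X -mulmxE -mulmxA.
- exact: Er'.
- by rewrite Er' Er !PsiE -/be Ep horner_mxDM horner_mxZM.
- by move=> ->; rewrite dotcv0r mul0r scale0r addr0.
- by rewrite /rh' hornerD hornerN hornerZ hornerM hornerX rh0 mul0r mulr0 subr0.
- exact: srh'.
- have sXpi : size (- (al *: ('X * pi))) = k.+2.
    by rewrite size_polyN size_scale// mulrC size_mulX ?spi// -size_poly_eq0 spi.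
  have srh'E : size rh' = k.+2 by rewrite /rh' addrC size_polyDl sXpi.
  by rewrite size_polyDl srh'E// (leq_ltn_trans (size_scale_leq _ _))// spi.
- by rewrite addrAC subrr add0r (leq_trans (size_scale_leq _ _))// spi.
- split => // q /(size_split_top spi)[c [q' [-> sq']]].
  have -> : 'X * ((rh' + be *: pi) * (c *: pi + q')) =
     c *: (rh' * ('X * pi) + be *: ('X * (pi * pi))) +
     (rh' * ('X * q') + be *: ('X * (pi * q'))).
    by rewrite -!mul_polyC; ring.
  rewrite PsiD PsiZ !PsiD !PsiZ (orth' ('X * q')) ?sX// (conj _ sq').
  (* Solving the residual update for ['X * pi] expresses conjugacy through residuals alone; the
     choice of [be] then cancels what is left. *)
  have -> : rh' * ('X * pi) = al^-1 *: (rh' * rh - rh' * rh').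
    have E : rh - rh' = al *: ('X * pi) by rewrite /rh' opprB addrC subrK.
    by rewrite -mulrBr E -scalerAr scalerA mulVf// scale1r.
  rewrite PsiZ PsiB (orth' _ srh) sub0r /be /al.
  set x := Psi (rh * rh) in Prr *; set z := Psi ('X * (pi * pi)) in Ppp *.
  by field; rewrite Prr Ppp.
Qed.

Lemma cg_step_res0 y : cg_step M (y, 0, 0) = (y, 0, 0).
Proof.
rewrite /cg_step dotcv0r mul0r !scale0r subr0 dotcv0r mul0r scale0r.
by rewrite !addr0.
Qed.

(** The degree of [pi] grows only while the residual is nonzero. Once the residual vanishes the
    error does too, and the convention x / 0 = 0 freezes the state; hence the alternative. *)
Let cg_iter_spec k (st := iter k (cg_step M) (0, r0, r0)) :
  st = (e0, 0, 0) \/ cg_spec k st.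
Proof.
rewrite {}/st; elim: k => [|k IH].
  right; exists 1, 1; rewrite /= subr0 rmorph1 !mul1mx; split; split => //.
  - by rewrite hornerE.
  - by rewrite size_poly1.
  - by rewrite size_poly1.
  - by rewrite subrr size_poly0.
  - by split => q; rewrite leqn0 size_poly_eq0 => /eqP ->;
      rewrite !mulr0 /Psi rmorph0 mul0mx dotcv0r.
rewrite iterS; case: IH => [->|]; first by left; rewrite cg_step_res0.
set st := iter k _ _ => H; have [res0|] := eqVneq st.1.2 0; last first.
  by move=> res0; right; exact: cg_step_spec.
case: st H res0 => [[y res] p] [rh [pi /= [[Ey Er Ep Z] [rh0 srh spi spr [orth conj]]]]] res0.
have Ye : y = e0.
  apply/eqP; rewrite eq_sym -subr_eq0 Ey; apply/eqP; apply: mulmx_pd_eq0.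
  by rewrite -horner_mxXM mulrC rmorphM /= horner_mx_X -mulmxE -mulmxA -/r0 -Er.
by left; rewrite Ye (Z res0) res0; exact: (cg_step_res0 e0).
Qed.

(** A competitor with q(0) = 1 differs from the residual polynomial by a multiple of X, so the cross
    term is an orthogonality relation and the excess is a square. *)
Let cg_optimal k q : q.[0] = 1 -> (size q <= k.+1)%N ->
  let e := e0 - cg_iter M r0 0 k in dotcv e (M *m e) <= L (q * q).
Proof.
move=> q0 sq; rewrite /cg_iter mulmx0 subr0; case: (cg_iter_spec k) => [->|].
  by rewrite /= subrr mulmx0 dotcv0r L_sqr_ge0.
case: (iter _ _ _) => [[y res] p] [rh [pi /= [[-> Er Ep Z] [rh0 srh spi spr [orth _]]]]].
rewrite -LE.
have /factor_theorem[w Ew] : root (q - rh) 0 by rewrite /root !hornerE q0 rh0 subrr.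
rewrite subr0 in Ew.
have sw : (size w <= k)%N.
  have [->|w0] := eqVneq w 0; first by rewrite size_poly0.
  by rewrite -ltnS -(size_mulX w0) -Ew size_polyD_leq// size_polyN.
have -> : q * q = rh * rh + ((2 : R)%:P * ('X * (rh * w)) + (w * 'X) * (w * 'X)).
  have -> : q = rh + w * 'X by rewrite -Ew addrC subrK.
  by rewrite polyC_natr; ring.
by rewrite LD LD LZ LPsi orth// mulr0 add0r lerDl L_sqr_ge0.
Qed.

Lemma cg_error_bound k (th : R) : 0 < th < 1 -> b = a * ((1 + th) / (1 - th)) ^+ 2 ->
  dotcv (cg_iter M r0 0 k - e0) (M *m (cg_iter M r0 0 k - e0)) <=
  (2 * th ^+ k) ^+ 2 * dotcv e0 (M *m e0).
Proof.
move=> /andP[th0 th1] bE.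
set e := cg_iter M r0 0 k - e0.
(* [B] maps [a, b] onto [-1, 1], reversed. The ratio b / a makes B(0) the Joukowski image of [th],
   so T_k(B) at 0 is at least th^-k / 2; dividing by this value normalizes the competitor. *)
pose B := ((b - a)^-1)%:P * ((b + a)%:P - 2%:P * 'X).
have ba0 : b - a != 0 by rewrite gt_eqF// subr_gt0.
have th1' : 1 - th != 0 by rewrite gt_eqF// subr_gt0.
have B0 : B.[0] = (th + th^-1) / 2.
  rewrite /B !hornerE ?mulr0 subr0.
  have -> : b + a = a * (2 * (1 + th ^+ 2)) / (1 - th) ^+ 2.
    by rewrite bE; field.
  have -> : b - a = a * (4 * th) / (1 - th) ^+ 2.
    by rewrite bE; field.
  by field; rewrite ?(gt_eqF a0) ?(gt_eqF th0) ?th1'.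
have [T0 _] := chebTU_joukowski k (lt0r_neq0 th0) B0.
have [sT _] : (size (chebTU B k).1 <= k.+1)%N /\ (size (chebTU B k).2 <= k)%N.
  apply: size_chebTU; apply: (@size_polyM_leq _ _ _ 1 2); rewrite ?size_polyC_leq1//.
  apply: size_polyD_leq; first by rewrite (leq_trans (size_polyC_leq1 _)).
  rewrite size_polyN; apply: (@size_polyM_leq _ _ _ 1 2); rewrite ?size_polyC_leq1//.
  by rewrite size_polyX.
set t := (chebTU B k).1 in T0 sT *.
have thk : 0 < th ^+ k by rewrite exprn_gt0.
have t0 : 0 < t.[0] by rewrite T0 divr_gt0// addr_gt0// exprn_gt0// invr_gt0.
have := @cg_optimal k ((t.[0])^-1 *: t).
rewrite hornerZ mulVf ?gt_eqF// => /(_ erefl).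
rewrite (leq_trans (size_scale_leq _ _) sT) => /(_ isT).
set e' := e0 - _; have -> : e = - e' by rewrite /e' opprB.
rewrite mulmxN dotcvNl dotcvNr opprK /= => /le_trans; apply.
rewrite -scalerAl -scalerAr -!mul_polyC !LZ mulrA.
have -> : dotcv e0 (M *m e0) = L 1 by rewrite /L mulr1 horner_mx_X.
apply: (@le_trans _ _ ((t.[0])^-1 * (t.[0])^-1 * L 1)).
  rewrite ler_wpM2l ?mulr_ge0 ?invr_ge0 ?(ltW t0)//; exact: cheb_energy_le.
have L1 : 0 <= L 1 by have := L_sqr_ge0 1; rewrite mulr1.
rewrite ler_wpM2r// -expr2 ler_pXn2r ?nnegrE ?invr_ge0 ?(ltW t0)//; last first.
  by rewrite mulr_ge0// ltW.
rewrite invf_ple ?posrE ?mulr_gt0// T0 invfM [X in X <= _]mulrC exprVn ler_pM2r ?invr_gt0//.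
by rewrite lerDr ltW.
Qed.
End cg.

(** * Gaussian expectations *)

Section gaussian_measure.
Context {R : realType}.
Local Notation mu := (@lebesgue_measure R).
Local Notation gauss := (normal_prob (0 : R) 1).
Local Open Scope ereal_scope.

Lemma ge0_integral_shift (f : R -> \bar R) (c : R) :
  measurable_fun setT f -> (forall x, 0 <= f x) ->
  \int[mu]_x f (x + c)%R = \int[mu]_x f x.
Proof.
move=> mf f0.
have mc : measurable_fun setT (fun x : measurableTypeR R => (x + c)%R : measurableTypeR R).
  exact: measurable_funD.
rewrite -[LHS](@ge0_integral_pushforward _ _ _ _ R _ mc mu setT f)//.
apply: eq_measure_integral => /= A mA _.
pose H := isMeasurableFun.Build _ _ _ _ _ mc.
pose ph : {mfun _ >-> _} := HB.pack (fun x : measurableTypeR R => (x + c)%R : measurableTypeR R) H.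
rewrite -[LHS]/(pushforward mu ph A).
apply/esym; apply: lebesgue_measure_unique => // X [[a b] /= _ <-].
rewrite /pushforward.
have -> : ph @^-1` `]a, b]%classic = `](a - c)%R, (b - c)%R]%classic.
  by apply/seteqP; split => x /=; rewrite !in_itv/= ltrBlDr lerBrDr.
rewrite !lebesgue_measure_itv/= !lte_fin ltrD2r; case: ifP => // _.
by rewrite -!EFinB; congr (_%:E); ring.
Qed.

Lemma integral_normal_prob (f : R -> \bar R) :
  measurable_fun setT f -> (forall x, 0 <= f x) ->
  \int[gauss]_x f x = \int[mu]_x (f x * (normal_pdf 0 1 x)%:E).
Proof.
move=> mf f0.
rewrite -(Radon_Nikodym_SigmaFinite.change_of_variables (normal_prob_dominates 0 1))//.
have dom := normal_prob_dominates (0 : R) 1.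
have mpdf : measurable_fun setT (fun x : R => (normal_pdf 0 1 x)%:E).
  by apply/measurable_EFinP; exact: measurable_normal_pdf.
apply: ae_eq_integral => //.
- apply: emeasurable_funM => //; apply: (measurable_int mu).
  exact: Radon_Nikodym_SigmaFinite.f_integrable.
- exact: emeasurable_funM.
- apply: ae_eqe_mul2l => /=; apply: integral_ae_eq => //=.
  + exact: Radon_Nikodym_SigmaFinite.f_integrable.
  + by move=> E _ mE; rewrite -Radon_Nikodym_SigmaFinite.f_integral.
Qed.

Lemma normal_pdf01E (x : R) :
  normal_pdf 0 1 x = (normal_peak 1 * expR (- x ^+ 2 / 2))%R.
Proof.
rewrite normal_pdfE ?oner_neq0// /normal_fun subr0 expr1n -mulr_natr.
by rewrite mul1r.
Qed.

Lemma normal_pdf_rot (x y c s : R) : (c ^+ 2 + s ^+ 2 = 1 ->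
  normal_pdf 0 1 (c * x - s * y) * normal_pdf 0 1 (s * x + c * y) =
  normal_pdf 0 1 x * normal_pdf 0 1 y)%R.
Proof.
move=> cs; rewrite !normal_pdf01E mulrACA [RHS]mulrACA -!expRD; congr (_ * expR _)%R.
rewrite -!mulrDl; congr (_ / _)%R.
transitivity (- ((c ^+ 2 + s ^+ 2) * (x ^+ 2 + y ^+ 2)))%R; first by ring.
by rewrite cs; ring.
Qed.

Lemma ge0_integral2_shearl (F : R * R -> \bar R) (t : R) :
  measurable_fun setT F -> (forall z, 0 <= F z) ->
  \int[mu]_x \int[mu]_y F (x + t * y, y)%R = \int[mu]_x \int[mu]_y F (x, y).
Proof.
move=> mF F0.
have mF' : measurable_fun setT (fun z : R * R => F (z.1 + t * z.2, z.2)%R).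
  apply: measurableT_comp => //; apply: measurable_fun_pair => //=.
  by apply: measurable_funD => //; exact: measurable_funM.
rewrite (@fubini_tonelli _ _ _ _ _ mu mu (fun z : R * R => F (z.1 + t * z.2, z.2)%R) mF' (fun z => F0 _)).
rewrite (@fubini_tonelli _ _ _ _ _ mu mu F mF F0) /=.
apply: eq_integral => y _.
apply: (@ge0_integral_shift (fun x => F (x, y)) (t * y)%R) => //.
exact: (measurableT_comp mF).
Qed.

Lemma ge0_integral2_shearr (F : R * R -> \bar R) (t : R) :
  measurable_fun setT F -> (forall z, 0 <= F z) ->
  \int[mu]_x \int[mu]_y F (x, y + t * x)%R = \int[mu]_x \int[mu]_y F (x, y).
Proof.
move=> mF F0; apply: eq_integral => x _.
rewrite (@ge0_integral_shift (fun y => F (x, y)) (t * x)%R)//.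
exact: measurableT_comp.
Qed.

(* A rotation by an angle other than pi is a product of three shears. *)
Lemma ge0_integral2_rot (F : R * R -> \bar R) (c s : R) :
  (c ^+ 2 + s ^+ 2 = 1)%R -> c != (- 1)%R ->
  measurable_fun setT F -> (forall z, 0 <= F z) ->
  \int[mu]_x \int[mu]_y F (c * x - s * y, s * x + c * y)%R =
  \int[mu]_x \int[mu]_y F (x, y).
Proof.
move=> cs c1 mF F0; set t := (- s / (1 + c))%R.
have c10 : (1 + c != 0)%R by rewrite addrC addr_eq0.
have st : (s * t = c - 1)%R.
  have -> : (s * t = - s ^+ 2 / (1 + c))%R by rewrite /t; ring.
  have -> : (- s ^+ 2 = (c - 1) * (1 + c))%R; last by rewrite mulfK.
  transitivity (c ^+ 2 - (c ^+ 2 + s ^+ 2))%R; first by ring.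
  by rewrite cs; ring.
have tt : (t + (1 + s * t) * t = - s)%R.
  by rewrite st /t; field.
pose G1 (z : R * R) := F (z.1 + t * z.2, z.2)%R.
have mG1 : measurable_fun setT G1.
  apply: measurableT_comp => //; apply: measurable_fun_pair => //=.
  by apply: measurable_funD => //; exact: measurable_funM.
pose G2 (z : R * R) := G1 (z.1, z.2 + s * z.1)%R.
have mG2 : measurable_fun setT G2.
  apply: measurableT_comp => //; apply: measurable_fun_pair => //=.
  by apply: measurable_funD => //; exact: measurable_funM.
have pw (x y : R) : F (c * x - s * y, s * x + c * y)%R = G2 (x + t * y, y)%R.
  rewrite /G2 /G1 /=; congr (F (_, _)).
    transitivity ((1 + s * t) * x + (t + (1 + s * t) * t) * y)%R; last by ring.
    by rewrite tt st; ring.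
  transitivity (s * x + (1 + s * t) * y)%R; last by ring.
  by rewrite st; ring.
rewrite -[RHS](ge0_integral2_shearl t mF F0).
rewrite -[RHS](ge0_integral2_shearr s mG1 (fun z => F0 _)).
rewrite -[RHS](ge0_integral2_shearl t mG2 (fun z => F0 _)).
by apply: eq_integral => x _; apply: eq_integral => y _; exact: pw.
Qed.

Lemma gauss2_rot (F : R * R -> \bar R) (c s : R) :
  (c ^+ 2 + s ^+ 2 = 1)%R -> c != (- 1)%R ->
  measurable_fun setT F -> (forall z, 0 <= F z) ->
  \int[gauss]_x \int[gauss]_y F (c * x - s * y, s * x + c * y)%R =
  \int[gauss]_x \int[gauss]_y F (x, y).
Proof.
move=> cs c1 mF F0.
have mpdf : measurable_fun setT (fun x : R => (normal_pdf 0 1 x)%:E).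
  by apply/measurable_EFinP; exact: measurable_normal_pdf.
have pdf0 (x : R) : 0 <= (normal_pdf 0 1 x)%:E by rewrite lee_fin normal_pdf_ge0.
pose W (F : R * R -> \bar R) z := F z * (normal_pdf 0 1 z.1 * normal_pdf 0 1 z.2)%:E.
have mW H : measurable_fun setT H -> measurable_fun setT (W H).
  move=> mH; apply: emeasurable_funM => //; apply/measurable_EFinP.
  by apply: measurable_funM; apply: measurableT_comp => //;
    exact: measurable_normal_pdf.
have key H : measurable_fun setT H -> (forall z, 0 <= H z) ->
    \int[gauss]_x \int[gauss]_y H (x, y) = \int[mu]_x \int[mu]_y W H (x, y).
  move=> mH H0; rewrite integral_normal_prob; last 2 first.
  - exact: (measurable_fun_fubini_tonelli_F (m2 := gauss)).
  - by move=> x; apply: integral_ge0.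
  apply: eq_integral => x _; rewrite integral_normal_prob//; last first.
    exact: measurableT_comp.
  rewrite muleC -ge0_integralZl//; first last.
  - by move=> y _; rewrite mule_ge0.
  - by apply: emeasurable_funM => //; exact: measurableT_comp.
  by apply: eq_integral => y _; rewrite /W /= muleCA EFinM.
rewrite [RHS]key// -(ge0_integral2_rot cs c1)//; last 2 first.
- exact: mW.
- by move=> z; rewrite /W mule_ge0// lee_fin mulr_ge0// normal_pdf_ge0.
have mrot : measurable_fun setT (fun z : R * R => F (c * z.1 - s * z.2, s * z.1 + c * z.2)%R).
  apply: measurableT_comp => //; apply: measurable_fun_pair => //=.
    by apply: measurable_funB; exact: measurable_funM.
  by apply: measurable_funD; exact: measurable_funM.
have pw (x y : R) : W (fun z => F (c * z.1 - s * z.2, s * z.1 + c * z.2)%R) (x, y) =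
    W F (c * x - s * y, s * x + c * y)%R.
  by rewrite /W; congr (_ * _%:E); exact/esym/normal_pdf_rot.
etransitivity; first exact: (key _ mrot (fun z => F0 _)).
by apply: eq_integral => x _; apply: eq_integral => y _; exact: pw.
Qed.

Lemma normal_pdf_mgf (t x : R) :
  (expR (t * x) * normal_pdf 0 1 x = expR (t ^+ 2 / 2) * normal_pdf 0 1 (x - t))%R.
Proof.
rewrite !normal_pdf01E mulrCA [RHS]mulrCA -!expRD; congr (_ * expR _)%R; by field.
Qed.

Lemma gauss_mgf (t : R) :
  \int[gauss]_x (expR (t * x))%:E = (expR (t ^+ 2 / 2))%:E.
Proof.
have mpdf : measurable_fun setT (fun x : R => (normal_pdf 0 1 x)%:E).
  by apply/measurable_EFinP; exact: measurable_normal_pdf.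
rewrite integral_normal_prob; last 2 first.
- apply/measurable_EFinP; apply: measurableT_comp => //; exact: measurable_funM.
- by move=> x; rewrite lee_fin expR_ge0.
under eq_integral do rewrite -EFinM normal_pdf_mgf EFinM.
have mshift : measurable_fun setT (fun x : R => (normal_pdf 0 1 (x - t))%:E).
  apply: (measurableT_comp (f := fun x : R => (normal_pdf 0 1 x)%:E)) => //.
  exact: measurable_funB.
have pdf0 (x : R) : [set: R] x -> 0 <= (normal_pdf 0 1 (x - t))%:E.
  by rewrite lee_fin normal_pdf_ge0.
rewrite ge0_integralZl// ?lee_fin ?expR_ge0//.
rewrite (ge0_integral_shift (f := fun x => (normal_pdf 0 1 x)%:E) (- t))//; last first.
  by move=> x; rewrite lee_fin normal_pdf_ge0.
by rewrite integral_normal_pdf mule1.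
Qed.

Lemma gauss_mgf_sqr (th : R) : (0 <= th < 1 / 2)%R ->
  \int[gauss]_x (expR (th * x ^+ 2))%:E = ((Num.sqrt (1 - 2 * th))^-1)%:E.
Proof.
move=> /andP[th0 th1].
have u0 : (0 < 1 - 2 * th)%R by lra.
have s0 : (Num.sqrt (1 - 2 * th) != 0)%R by rewrite gt_eqF// sqrtr_gt0.
rewrite integral_normal_prob; last 2 first.
- apply/measurable_EFinP; apply: measurableT_comp => //.
  by apply: measurable_funM => //; exact: exprn_measurable.
- by move=> x; rewrite lee_fin expR_ge0.
pose sg : R := ((Num.sqrt (1 - 2 * th))^-1)%R.
have sg0 : (0 < sg)%R by rewrite invr_gt0 sqrtr_gt0.
have sg2 : (sg ^+ 2 = (1 - 2 * th)^-1)%R by rewrite /sg exprVn sqr_sqrtr// ltW.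
have pk : (normal_peak 1 = sg * normal_peak sg)%R.
  rewrite /normal_peak expr1n mul1r -mulrnAr sqrtrM ?sqr_ge0// sqrtr_sqr.
  by rewrite (gtr0_norm sg0) invfM mulrA divff ?gt_eqF// mul1r.
have pw (x : R) : (expR (th * x ^+ 2))%:E * (normal_pdf 0 1 x)%:E =
    sg%:E * (normal_pdf 0 sg x)%:E.
  rewrite -!EFinM; congr (_%:E).
  rewrite normal_pdf01E normal_pdfE ?gt_eqF// /normal_fun subr0 mulrCA -expRD.
  rewrite [RHS]mulrA -pk; congr (_ * expR _)%R.
  by rewrite -mulr_natr sg2; field; rewrite gt_eqF.
transitivity (\int[mu]_x (sg%:E * (normal_pdf 0 sg x)%:E)).
  by apply: eq_integral => x _; exact: pw.
rewrite ge0_integralZl//.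
- by rewrite integral_normal_pdf mule1.
- by apply/measurable_EFinP; exact: measurable_normal_pdf.
- by move=> x _; rewrite lee_fin normal_pdf_ge0.
- by rewrite lee_fin ltW.
Qed.

End gaussian_measure.

(** * Iterated Gaussian integrals and their dependence on the covariance *)

Section gauss_ex.
Context {R : realType}.
Local Notation gauss := (normal_prob (0 : R) 1).
Local Open Scope ereal_scope.

(* Measurability with respect to the product sigma-algebra, phrased so that it
   can be used for an index set that is an arbitrary type. *)
Definition coord_meas (I : Type) (f : (I -> R) -> \bar R) : Prop :=
  (forall z, 0 <= f z) /\
  forall (d : measure_display) (T : measurableType d) (c : T -> I -> R),
    (forall i, measurable_fun setT (fun t => c t i)) ->
    measurable_fun setT (fun t => f (c t)).

Definition vshift (I : Type) (z a : I -> R) (x : R) : I -> R :=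
  fun i => (z i + x * a i)%R.

(* [gauss_ex s f z] is the expectation of f (z + \sum_k xi_k a_k), where the
   xi_k are independent standard normal variables and s lists the vectors a_k. *)
Fixpoint gauss_ex (I : Type) (s : seq (I -> R)) (f : (I -> R) -> \bar R)
    (z : I -> R) : \bar R :=
  if s is a :: s' then \int[gauss]_x gauss_ex s' f (vshift z a x) else f z.

Definition gcov (I : Type) (s : seq (I -> R)) (i j : I) : R :=
  (\sum_(a <- s) a i * a j)%R.

Section basics.
Context {I : Type}.
Implicit Types (f g : (I -> R) -> \bar R) (z a b : I -> R) (s : seq (I -> R)).

Lemma coord_meas_vshift f z a : coord_meas f ->
  measurable_fun setT (fun x : measurableTypeR R => f (vshift z a x)).
Proof.
move=> [_ mf]; apply: mf => i.
by apply: measurable_funD => //; exact: measurable_funM.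
Qed.

Lemma coord_meas_gauss_int f a : coord_meas f ->
  coord_meas (fun z => \int[gauss]_x f (vshift z a x)).
Proof.
move=> [f0 mf]; split => [z|d T c mc]; first exact: integral_ge0.
pose g (u : T * measurableTypeR R) := f (vshift (c u.1) a u.2).
have mg : measurable_fun setT g.
  apply: (mf _ _ (fun u : T * measurableTypeR R => vshift (c u.1) a u.2)) => i.
  apply: measurable_funD; first by apply: (measurableT_comp (mc i)).
  exact: measurable_funM.
exact: (@measurable_fun_fubini_tonelli_F _ _ _ _ _ gauss g mg (fun u => f0 _)).
Qed.

Lemma coord_meas_gauss_ex f s : coord_meas f -> coord_meas (gauss_ex s f).
Proof.
by move=> mf; elim: s => [//|a s IH] /=; exact: coord_meas_gauss_int.
Qed.

Lemma gauss_ex_ge0 f s z : coord_meas f -> 0 <= gauss_ex s f z.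
Proof. by move=> /(coord_meas_gauss_ex s)[]. Qed.

Lemma measurable_gauss_ex f s z a : coord_meas f ->
  measurable_fun setT (fun x : measurableTypeR R => gauss_ex s f (vshift z a x)).
Proof. by move=> mf; apply: coord_meas_vshift; exact: coord_meas_gauss_ex. Qed.

Lemma le_gauss_int (f g : measurableTypeR R -> \bar R) :
  (forall x, 0 <= f x) -> measurable_fun setT f -> measurable_fun setT g ->
  (forall x, f x <= g x) -> \int[gauss]_x f x <= \int[gauss]_x g x.
Proof. by move=> f0 mf mg fg; apply: ge0_le_integral => // x _; exact: le_trans (fg x). Qed.

Lemma le_gauss_ex f g s z : coord_meas f -> coord_meas g ->
  (forall y, f y <= g y) -> gauss_ex s f z <= gauss_ex s g z.
Proof.
move=> mf mg fg; elim: s z => [//|a s IH] z /=.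
apply: le_gauss_int => [x|||x]; [exact: gauss_ex_ge0| | |exact: IH];
  exact: measurable_gauss_ex.
Qed.

Lemma gauss_ex_cat s1 s2 f z :
  gauss_ex (s1 ++ s2) f z = gauss_ex s1 (gauss_ex s2 f) z.
Proof. by elim: s1 z => [//|a s1 IH] z /=; apply: eq_integral => x _. Qed.

Lemma eq_gauss_ex f g s z : (forall y, f y = g y) ->
  gauss_ex s f z = gauss_ex s g z.
Proof.
by move=> fg; elim: s z => [//|a s IH] z /=; apply: eq_integral => x _.
Qed.

Lemma gauss_exZ (k : R) f s z : (0 <= k)%R -> coord_meas f ->
  gauss_ex s (fun y => k%:E * f y) z = k%:E * gauss_ex s f z.
Proof.
move=> k0 mf; elim: s z => [//|a s IH] z /=.
under eq_integral do rewrite IH.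
rewrite ge0_integralZl// ?lee_fin//; last by move=> x _; exact: gauss_ex_ge0.
exact: measurable_gauss_ex.
Qed.

Lemma gauss_exD f g s z : coord_meas f -> coord_meas g ->
  gauss_ex s (fun y => f y + g y) z = gauss_ex s f z + gauss_ex s g z.
Proof.
move=> mf mg; elim: s z => [//|a s IH] z /=.
under eq_integral do rewrite IH.
rewrite ge0_integralD//; try by move=> x _; exact: gauss_ex_ge0.
  exact: measurable_gauss_ex.
exact: measurable_gauss_ex.
Qed.

Lemma gauss_int_cst (r : \bar R) : \int[gauss]_x r = r.
Proof. by rewrite integral_cst//= (@probability_setT _ _ _ gauss) mule1. Qed.

Lemma gauss_ex_cst s (r : \bar R) z : gauss_ex s (fun=> r) z = r.
Proof.
elim: s z => [//|a s IH] z /=.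
by under eq_integral do rewrite IH; exact: gauss_int_cst.
Qed.

Lemma coord_measD f g : coord_meas f -> coord_meas g ->
  coord_meas (fun y => f y + g y).
Proof.
move=> [f0 mf] [g0 mg]; split => [z|d T c mc]; first exact: adde_ge0.
by apply: emeasurable_funD; [exact: mf|exact: mg].
Qed.

Lemma coord_measM f g : coord_meas f -> coord_meas g ->
  coord_meas (fun y => f y * g y).
Proof.
move=> [f0 mf] [g0 mg]; split => [z|d T c mc]; first exact: mule_ge0.
by apply: emeasurable_funM; [exact: mf|exact: mg].
Qed.

Lemma coord_meas_EFin (f : (I -> R) -> R) : (forall z, (0 <= f z)%R) ->
  (forall (d : measure_display) (T : measurableType d) (c : T -> I -> R),
    (forall i, measurable_fun setT (fun t => c t i)) ->
    measurable_fun setT (fun t => f (c t))) ->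
  coord_meas (fun z => (f z)%:E).
Proof.
move=> f0 mf; split => [z|d T c mc]; first by rewrite lee_fin.
by apply/measurable_EFinP; exact: mf.
Qed.

Lemma coord_meas_cst (r : R) : (0 <= r)%R -> coord_meas (fun _ : I -> R => r%:E).
Proof. by move=> r0; split => [z|d T c mc]; rewrite ?lee_fin. Qed.

End basics.

Lemma gauss_ex_map (I J : Type) (L L' : (J -> R) -> (I -> R)) s f y :
  (forall z a x, L (vshift z a x) = vshift (L z) (L' a) x) ->
  gauss_ex [seq L' a | a <- s] f (L y) = gauss_ex s (fun z => f (L z)) y.
Proof.
move=> LE; elim: s y => [//|a s IH] y /=.
by apply: eq_integral => x _; rewrite -LE IH.
Qed.

Section covariance.
Context {I : Type}.
Implicit Types (f g : (I -> R) -> \bar R) (z a b : I -> R) (s : seq (I -> R)).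

Definition rot1 (c s : R) a b : I -> R := fun i => (c * a i + s * b i)%R.
Definition rot2 (c s : R) a b : I -> R := fun i => (- s * a i + c * b i)%R.

Let gauss_ex_rot_neqN1 (c s : R) a b l f z : coord_meas f ->
  (c ^+ 2 + s ^+ 2 = 1)%R -> c != (- 1)%R ->
  gauss_ex [:: a, b & l] f z = gauss_ex [:: rot1 c s a b, rot2 c s a b & l] f z.
Proof.
move=> mf cs c1 /=.
pose F (u : R * R) := gauss_ex l f (vshift (vshift z a u.1) b u.2).
have mF : measurable_fun setT F.
  apply: (coord_meas_gauss_ex l mf).2 => i.
  by apply: measurable_funD; [apply: measurable_funD|]; rewrite //=;
    apply: measurable_funM.
rewrite -[LHS](gauss2_rot cs c1 mF (fun u => gauss_ex_ge0 _ _ mf)).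
apply: eq_integral => x _; apply: eq_integral => y _.
rewrite /F; congr (gauss_ex l f _); apply/funext => i.
by rewrite /vshift /rot1 /rot2 /=; ring.
Qed.

Lemma gauss_ex_rot (c s : R) a b l f z : coord_meas f ->
  (c ^+ 2 + s ^+ 2 = 1)%R ->
  gauss_ex [:: a, b & l] f z = gauss_ex [:: rot1 c s a b, rot2 c s a b & l] f z.
Proof.
(* The three shears do not reach the half turn; it is done as two quarter turns. *)
move=> mf cs; have [cN1|c1] := eqVneq c (- 1)%R; last exact: gauss_ex_rot_neqN1.
have s0 : s = 0%R.
  by apply/eqP; rewrite -sqrf_eq0; apply/eqP; move: cs; rewrite cN1 sqrrN expr1n; lra.
have q1 : (0 ^+ 2 + 1 ^+ 2 = 1 :> R)%R by ring.
have q2 : 0%R != (- 1 : R)%R by rewrite eq_sym oppr_eq0 oner_eq0.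
rewrite (gauss_ex_rot_neqN1 _ _ _ _ mf q1 q2) (gauss_ex_rot_neqN1 _ _ _ _ mf q1 q2).
have -> : rot1 0 1 (rot1 0 1 a b) (rot2 0 1 a b) = rot1 c s a b.
  by apply/funext => i; rewrite /rot1 /rot2 s0 cN1; ring.
suff -> : rot2 0 1 (rot1 0 1 a b) (rot2 0 1 a b) = rot2 c s a b by [].
by apply/funext => i; rewrite /rot1 /rot2 s0 cN1; ring.
Qed.

Lemma gcov_cons a s i j : (gcov (a :: s) i j = a i * a j + gcov s i j)%R.
Proof. by rewrite /gcov big_cons. Qed.

Lemma gcov_cat s1 s2 i j : (gcov (s1 ++ s2) i j = gcov s1 i j + gcov s2 i j)%R.
Proof. by rewrite /gcov big_cat. Qed.

Lemma gcov_diag_ge0 s i : (0 <= gcov s i i)%R.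
Proof. by apply: sumr_ge0 => a _; rewrite -expr2 sqr_ge0. Qed.

Lemma gcov_diag0 s i j : gcov s i i = 0%R -> gcov s j i = 0%R.
Proof.
elim: s => [|a s IH]; first by rewrite /gcov !big_nil.
rewrite !gcov_cons => /eqP; rewrite paddr_eq0 ?gcov_diag_ge0 -?expr2 ?sqr_ge0//.
by rewrite sqrf_eq0 => /andP[/eqP -> /eqP/IH ->]; rewrite mulr0 addr0.
Qed.

Lemma gauss_ex_cov0 s f z : (forall i, gcov s i i = 0%R) -> gauss_ex s f z = f z.
Proof.
elim: s z => [//|a s IH] z s0 /=.
have [a0 s0'] : (forall i, a i = 0%R) /\ (forall i, gcov s i i = 0%R).
  by split => i; have := s0 i; rewrite gcov_cons => /eqP;
    rewrite paddr_eq0 ?gcov_diag_ge0 -?expr2 ?sqr_ge0// sqrf_eq0 => /andP[/eqP ? /eqP].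
have -> : (fun x => gauss_ex s f (vshift z a x)) = (fun=> f z).
  apply/funext => x; rewrite IH//; congr f; apply/funext => i.
  by rewrite /vshift a0 mulr0 addr0.
exact: gauss_int_cst.
Qed.

(* Givens rotations collect the i-th coordinate in a single vector. *)
Lemma gauss_ex_givens s i : exists a0 s',
  [/\ forall f z, coord_meas f -> gauss_ex s f z = gauss_ex (a0 :: s') f z,
      forall j k, gcov s j k = gcov (a0 :: s') j k,
      gcov s' i i = 0%R & (0 <= a0 i)%R].
Proof.
elim: s => [|a s [a0 [s' [IHe IHc IH0 IHp]]]].
  exists (fun=> 0%R), [::]; split => //.
  - move=> f z mf; rewrite [RHS]gauss_ex_cov0//.
    by move=> j; rewrite gcov_cons /gcov big_nil mul0r addr0.
  - by move=> j k; rewrite gcov_cons /gcov big_nil mul0r addr0.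
  - by rewrite /gcov big_nil.
pose r := Num.sqrt (a i ^+ 2 + a0 i ^+ 2)%R.
have r2 : (r ^+ 2 = a i ^+ 2 + a0 i ^+ 2)%R.
  by rewrite sqr_sqrtr// addr_ge0// sqr_ge0.
have [c [t [ct rc rt]]] : exists c t : R,
    [/\ c ^+ 2 + t ^+ 2 = 1, c * a i + t * a0 i = r & - t * a i + c * a0 i = 0]%R.
  have [r0|r0] := eqVneq r 0%R.
    have /andP[/eqP ai /eqP a0i] : ((a i == 0) && (a0 i == 0))%R.
      by rewrite -(sqrf_eq0 (a i)) -(sqrf_eq0 (a0 i)) -paddr_eq0 ?sqr_ge0// -r2 r0 expr0n.
    by exists 1%R, 0%R; rewrite ai a0i r0; split; ring.
  exists (a i / r)%R, (a0 i / r)%R; split.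
  - have -> : ((a i / r) ^+ 2 + (a0 i / r) ^+ 2 = (a i ^+ 2 + a0 i ^+ 2) / r ^+ 2)%R.
      by field.
    by rewrite -r2 divff// sqrf_eq0.
  - have -> : (a i / r * a i + a0 i / r * a0 i = (a i ^+ 2 + a0 i ^+ 2) / r)%R.
      by field.
    by rewrite -r2 expr2 mulfK.
  - by field.
exists (rot1 c t a a0), (rot2 c t a a0 :: s'); split.
- move=> f z mf; rewrite -(gauss_ex_rot _ _ _ _ mf ct) /=.
  by apply: eq_integral => x _; exact: IHe.
- move=> j k; rewrite !gcov_cons (IHc j k) gcov_cons /rot1 /rot2.
  transitivity ((c ^+ 2 + t ^+ 2) * (a j * a k + a0 j * a0 k) + gcov s' j k)%R.
    by rewrite ct; ring.
  by ring.
- by rewrite gcov_cons IH0 /rot2 rt mul0r addr0.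
- by rewrite /rot1 rc sqrtr_ge0.
Qed.
End covariance.

(** Induction on the coordinates that may still have nonzero variance. After Givens rotations one
    vector [a0] carries coordinate i, so the covariances with i are a0 j * a0 i. With a0 i >= 0 they
    determine [a0] unless a0 i = 0, and then coordinate i has no variance left. *)
Lemma gauss_ex_cov (I : finType) (s1 s2 : seq (I -> R)) f z : coord_meas f ->
  (forall i j, gcov s1 i j = gcov s2 i j) ->
  gauss_ex s1 f z = gauss_ex s2 f z.
Proof.
move=> mf.
suff H (cs : seq I) : forall s1 s2 z, (forall i j, gcov s1 i j = gcov s2 i j) ->
    (forall i, i \notin cs -> gcov s1 i i = 0%R) ->
    gauss_ex s1 f z = gauss_ex s2 f z.
  by move=> s12; apply: (H (enum I)) => // i; rewrite mem_enum.
elim: cs => [|i cs IH] {}s1 {}s2 {}z s12 s10.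
  by rewrite !gauss_ex_cov0// => i; rewrite -?s12 s10.
have [a0 [s1' [e1 c1 z1 p1]]] := gauss_ex_givens s1 i.
have [b0 [s2' [e2 c2 z2 p2]]] := gauss_ex_givens s2 i.
rewrite e1// e2//.
have ab j : (a0 j * a0 i = b0 j * b0 i)%R.
  have := s12 j i; rewrite c1 c2 !gcov_cons (gcov_diag0 j z1) (gcov_diag0 j z2).
  by rewrite !addr0.
have abi : a0 i = b0 i.
  by have := ab i; rewrite -!expr2 => /eqP; rewrite eqrXn2// => /eqP.
have [a00|a00] := eqVneq (a0 i) 0%R.
  apply: IH => [j k|j jcs]; first by rewrite -c1 -c2.
  have [->|ji] := eqVneq j i; first by rewrite gcov_cons z1 a00 mul0r addr0.
  by rewrite -c1 s10// inE negb_or ji.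
have -> : b0 = a0.
  by apply/funext => j; have := ab j; rewrite -abi => /(mulIf a00).
move=> /=; apply: eq_integral => x _; apply: IH => [j k|j jcs].
  have := s12 j k; rewrite c1 c2 !gcov_cons.
  have -> : b0 = a0.
    by apply/funext => l; have := ab l; rewrite -abi => /(mulIf a00).
  by move=> /addrI.
have [->//|ji] := eqVneq j i.
have : gcov s1 j j = 0%R by rewrite s10// inE negb_or ji.
rewrite c1 gcov_cons => /eqP; rewrite paddr_eq0 ?gcov_diag_ge0 -?expr2 ?sqr_ge0//.
by move=> /andP[_ /eqP].
Qed.

End gauss_ex.

(** * Gordon's comparison inequality *)

Section ebase.
Context {R : realType} {I : finType}.

Definition ebase (i : I) : I -> R := fun j => (j == i)%:R.

Lemma sum_ebase (k : I) (h : I -> R) : \sum_i h i * ebase i k = h k.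
Proof.
rewrite (bigD1 k)//= big1 ?addr0 /ebase ?eqxx ?mulr1// => j jk.
by rewrite eq_sym (negbTE jk) mulr0.
Qed.

Variable E : I -> I -> R.
Hypothesis Esym : forall i j, E i j = E j i.

(** Covariance of independent noises put on both ends of every ordered pair; the half is there
    because each unordered pair occurs twice. The next lemma gives the extra covariance when the two
    ends share their noise. *)
Lemma sum2_ebase_diag k l :
  \sum_i \sum_j E i j / 2 * (ebase i k * ebase i l + ebase j k * ebase j l) =
  (k == l)%:R * \sum_j E k j.
Proof.
have e1 : \sum_i \sum_j E i j / 2 * (ebase i k * ebase i l) =
    (k == l)%:R * (\sum_j E k j) / 2.
  transitivity (\sum_i ((\sum_j E i j) / 2 * ebase i l) * ebase i k).
    apply: eq_bigr => i _; rewrite !mulr_suml; apply: eq_bigr => j _; ring.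
  by rewrite sum_ebase /ebase eq_sym; ring.
have e2 : \sum_i \sum_j E i j / 2 * (ebase j k * ebase j l) =
    (k == l)%:R * (\sum_j E k j) / 2.
  rewrite exchange_big -e1 /=; apply: eq_bigr => i _; apply: eq_bigr => j _.
  by rewrite Esym.
transitivity (\sum_i \sum_j E i j / 2 * (ebase i k * ebase i l) +
  \sum_i \sum_j E i j / 2 * (ebase j k * ebase j l)); last by rewrite e1 e2; field.
rewrite -big_split /=; apply: eq_bigr => i _; rewrite -big_split /=.
by apply: eq_bigr => j _; rewrite mulrDr.
Qed.

Lemma sum2_ebase_off k l :
  \sum_i \sum_j E i j / 2 * (ebase i k * ebase j l + ebase j k * ebase i l) =
  E k l.
Proof.
have e k' l' : \sum_i \sum_j E i j / 2 * (ebase i k' * ebase j l') = E k' l' / 2.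
  transitivity (\sum_i (E i l' / 2) * ebase i k'); last by rewrite sum_ebase.
  apply: eq_bigr => i _.
  rewrite -(sum_ebase l' (fun j => E i j / 2 * ebase i k')) .
  by apply: eq_bigr => j _; ring.
transitivity (\sum_i \sum_j E i j / 2 * (ebase i k * ebase j l) +
  \sum_i \sum_j E i j / 2 * (ebase i l * ebase j k)); last first.
  by rewrite !e (Esym l k); field.
rewrite -big_split /=; apply: eq_bigr => i _; rewrite -big_split /=.
by apply: eq_bigr => j _; ring.
Qed.

End ebase.

Lemma bernoulli_ineq (R : realType) (K : R) n : 0 <= K <= 1 ->
  1 - n%:R * K <= (1 - K) ^+ n.
Proof.
move=> /andP[K0 K1]; elim: n => [|n IH]; first by rewrite mul0r subr0 expr0.
rewrite exprS; apply: (@le_trans _ _ ((1 - K) * (1 - n%:R * K))); last first.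
  by rewrite ler_wpM2l// subr_ge0.
have : 0 <= n%:R :> R by []; rewrite -natr1; set v := n%:R => v0; nra.
Qed.

Section comparison.
Context {R : realType} {I : finType}.
Local Notation gauss := (normal_prob (0 : R) 1).
Local Open Scope ereal_scope.
Implicit Types (f g : (I -> R) -> \bar R) (z a b : I -> R) (s : seq (I -> R)).

(** Finite-difference form of a nonpositive mixed second derivative in directions i and j. *)
Definition submodular f (i j : I) : Prop := forall z (x y : R),
  (0 <= x)%R -> (0 <= y)%R ->
  f (vshift (vshift z (ebase i) x) (ebase j) y) + f z <=
  f (vshift z (ebase i) x) + f (vshift z (ebase j) y).

Lemma coord_meas_translate f a (x : R) : coord_meas f ->
  coord_meas (fun z => f (vshift z a x)).
Proof.
move=> [f0 mf]; split => // d T c mc; apply: (mf _ _ (fun t => vshift (c t) a x)).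
by move=> i; apply: measurable_funD.
Qed.

Lemma gauss_ex_translate f s a (x : R) z :
  gauss_ex s f (vshift z a x) = gauss_ex s (fun y => f (vshift y a x)) z.
Proof.
rewrite -[s in LHS]map_id; apply: (gauss_ex_map (L := fun y => vshift y a x)).
by move=> y b t; apply/funext => i; rewrite /vshift; ring.
Qed.

Lemma submodular_gauss_ex f s i j : coord_meas f -> submodular f i j ->
  submodular (gauss_ex s f) i j.
Proof.
move=> mf sf z x y x0 y0; rewrite !gauss_ex_translate.
have mT g b t : coord_meas g -> coord_meas (fun u => g (vshift u b t)).
  exact: coord_meas_translate.
have m1 b t := mT f b t mf.
have m2 : coord_meas (fun u => f (vshift (vshift u (ebase i) x) (ebase j) y)).
  exact: (mT (fun u => f (vshift u (ebase j) y))).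
rewrite -!gauss_exD//.
apply: le_gauss_ex => [||u].
- exact: coord_measD.
- by apply: coord_measD; exact: mT.
- exact: sf.
Qed.

Lemma lee_double (x y : \bar R) : 0 <= x -> 0 <= y -> x + x <= y + y -> x <= y.
Proof.
by case: x y => [x| |] [y| |]//=; rewrite ?leey// -!EFinD !lee_fin; lra.
Qed.

(** At the corner (min, min) submodularity says F(x, x) + F(y, y) <= F(x, y) + F(y, x); averaging
    over independent x and y compares common with independent noise. *)
Lemma gauss_ex_common_le f i j (c : R) z : coord_meas f -> (0 <= c)%R ->
  (c != 0%R -> submodular f i j) ->
  gauss_ex [:: fun k => (c * (ebase i k + ebase j k))%R] f z <=
  gauss_ex [:: fun k => (c * ebase i k)%R; fun k => (c * ebase j k)%R] f z.
Proof.
move=> mf c0 sf.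
have [c00|cn0] := eqVneq c 0%R.
  rewrite !gauss_ex_cov0// => k; rewrite !gcov_cons /gcov big_nil c00; by ring.
move: (sf cn0) => {}sf /=.
pose F (u : R * R) := f (vshift (vshift z (ebase i) (c * u.1)) (ebase j) (c * u.2)).
have F0 u : 0 <= F u by exact: mf.1.
have mF : measurable_fun setT F.
  apply: mf.2 => k; apply: measurable_funD; first apply: measurable_funD => //.
    by apply: measurable_funM => //; exact: measurable_funM.
  by apply: measurable_funM => //; exact: measurable_funM.
have FE x y : F (x, y) + F (y, x) >= F (x, x) + F (y, y).
  wlog xy : x y / (x <= y)%R.
    move=> H; have [|/ltW] := leP x y; first exact: H.
    by move=> /H; rewrite addeC (addeC (F (y, x))).
  pose z' := vshift (vshift z (ebase i) (c * x)) (ebase j) (c * x).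
  pose t := (c * (y - x))%R.
  have E1 : F (y, y) = f (vshift (vshift z' (ebase i) t) (ebase j) t).
    by rewrite /F; congr f; apply/funext => k; rewrite /z' /t /vshift /=; ring.
  have E2 : F (y, x) = f (vshift z' (ebase i) t).
    by rewrite /F; congr f; apply/funext => k; rewrite /z' /t /vshift /=; ring.
  have E3 : F (x, y) = f (vshift z' (ebase j) t).
    by rewrite /F; congr f; apply/funext => k; rewrite /z' /t /vshift /=; ring.
  rewrite E1 E2 E3 addeC (addeC (f (vshift z' (ebase j) t))).
  by apply: sf; rewrite mulr_ge0// subr_ge0.
have mFd : measurable_fun setT (fun x : measurableTypeR R => F (x, x)).
  by apply: (measurableT_comp mF); exact: measurable_fun_pair.
have mFsw : measurable_fun setT (fun u : R * R => F (u.2, u.1)).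
  by apply: (measurableT_comp mF); exact: measurable_fun_pair.
have mFx x : measurable_fun setT (fun y : measurableTypeR R => F (x, y)).
  by apply: (measurableT_comp mF); exact: measurable_fun_pair.
have mFy y : measurable_fun setT (fun x : measurableTypeR R => F (x, y)).
  by apply: (measurableT_comp mF); exact: measurable_fun_pair.
have mIF : measurable_fun setT (fun x : measurableTypeR R => \int[gauss]_y F (x, y)).
  exact: (@measurable_fun_fubini_tonelli_F _ _ _ _ _ gauss F mF F0).
have mIFs : measurable_fun setT (fun x : measurableTypeR R => \int[gauss]_y F (y, x)).
  exact: (@measurable_fun_fubini_tonelli_F _ _ _ _ _ gauss _ mFsw (fun u => F0 _)).
have I0 (h : R -> \bar R) : (forall x, 0 <= h x) -> 0 <= \int[gauss]_y h y.
  by move=> h0; exact: integral_ge0.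
set A := (X in X <= _); set B := (X in _ <= X).
have AE : A = \int[gauss]_x F (x, x).
  apply: eq_integral => x _; rewrite /F; congr f; apply/funext => k.
  by rewrite /vshift /=; ring.
have BE : B = \int[gauss]_x \int[gauss]_y F (x, y).
  apply: eq_integral => x _; apply: eq_integral => y _; rewrite /F; congr f.
  by apply/funext => k; rewrite /vshift /=; ring.
(* Both integrals may be infinite, so doubled integrals are compared and nothing is subtracted. *)
suff AB : A + A <= B + B.
  apply: lee_double AB; first by rewrite AE; exact: I0.
  by rewrite BE; apply: (I0 _) => x; exact: I0.
have -> : A + A = \int[gauss]_x \int[gauss]_y (F (x, x) + F (y, y)).
  transitivity (\int[gauss]_x (F (x, x) + A)).
    rewrite ge0_integralD//; last by move=> x _; rewrite AE; exact: I0.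
    by rewrite gauss_int_cst -AE.
  apply: eq_integral => x _; rewrite ge0_integralD//.
  by rewrite gauss_int_cst AE.
have -> : B + B = \int[gauss]_x \int[gauss]_y (F (x, y) + F (y, x)).
  transitivity (\int[gauss]_x (\int[gauss]_y F (x, y) + \int[gauss]_y F (y, x))).
    rewrite (@ge0_integralD _ _ _ gauss _ measurableT _ _ (fun x _ => I0 _ (fun y => F0 _)) mIF (fun x _ => I0 _ (fun y => F0 _)) mIFs).
    by rewrite -BE -[in X in _ = _ + X](@fubini_tonelli _ _ _ _ _ gauss gauss F mF F0) BE.
  by apply: eq_integral => x _; rewrite ge0_integralD.
apply: le_gauss_int => [x|||x].
- by apply: (I0 _) => y; exact: adde_ge0.
- apply: (@measurable_fun_fubini_tonelli_F _ _ _ _ _ gauss (fun u => F (u.1, u.1) + F (u.2, u.2))).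
    apply: emeasurable_funD; first by apply: (measurableT_comp mFd).
    by apply: (measurableT_comp mFd).
  by move=> u; exact: adde_ge0.
- apply: (@measurable_fun_fubini_tonelli_F _ _ _ _ _ gauss (fun u => F (u.1, u.2) + F (u.2, u.1))).
    exact: emeasurable_funD.
  by move=> u; exact: adde_ge0.
- apply: le_gauss_int => [y|||y].
  + exact: adde_ge0.
  + exact: emeasurable_funD.
  + exact: emeasurable_funD.
  + exact: FE.
Qed.

Section pairs.
Variable c : I * I -> R.
Definition common_noise (ps : seq (I * I)) : seq (I -> R) :=
  [seq (fun k => (c p * (ebase p.1 k + ebase p.2 k))%R) | p <- ps].
Definition indep_noise (ps : seq (I * I)) : seq (I -> R) :=
  flatten [seq [:: fun k => (c p * ebase p.1 k)%R; fun k => (c p * ebase p.2 k)%R]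
    | p <- ps].

Lemma gauss_ex_common_noise_le f ps z : coord_meas f ->
  (forall p, (0 <= c p)%R) ->
  (forall p, c p != 0%R -> submodular f p.1 p.2) ->
  gauss_ex (common_noise ps) f z <= gauss_ex (indep_noise ps) f z.
Proof.
move=> mf c0 sf; elim: ps z => [//|p ps IH] z.
rewrite -[common_noise _]/([:: _] ++ common_noise ps).
rewrite -[indep_noise _]/([:: _; _] ++ indep_noise ps) !gauss_ex_cat.
apply: (@le_trans _ _ (gauss_ex [:: fun k => (c p * (ebase p.1 k + ebase p.2 k))%R]
   (gauss_ex (indep_noise ps) f) z)).
  by apply: le_gauss_ex => //; exact: coord_meas_gauss_ex.
apply: gauss_ex_common_le => //; first exact: coord_meas_gauss_ex.
by move=> /sf; exact: submodular_gauss_ex.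
Qed.

Lemma gcov_common_noise ps k l : (gcov (common_noise ps) k l =
  \sum_(p <- ps) c p ^+ 2 * ((ebase p.1 k + ebase p.2 k) * (ebase p.1 l + ebase p.2 l)))%R.
Proof. by rewrite /gcov big_map; apply: eq_bigr => p _; ring. Qed.

Lemma gcov_indep_noise ps k l : (gcov (indep_noise ps) k l =
  \sum_(p <- ps) c p ^+ 2 * (ebase p.1 k * ebase p.1 l + ebase p.2 k * ebase p.2 l))%R.
Proof.
elim: ps => [|p ps IH]; first by rewrite /gcov !big_nil.
rewrite big_cons -IH -[indep_noise _]/([:: _; _] ++ indep_noise ps) gcov_cat.
by rewrite !gcov_cons [gcov [::] _ _]/gcov big_nil; ring.
Qed.

End pairs.

Definition diag_noise (w : I -> R) : seq (I -> R) :=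
  [seq (fun k => (Num.sqrt (w i) * ebase i k)%R) | i <- enum I].

Lemma gcov_diag_noise w k l : (forall i, (0 <= w i)%R) ->
  gcov (diag_noise w) k l = ((k == l)%:R * w k)%R.
Proof.
move=> w0; rewrite /gcov big_map big_enum /= (bigD1 k)//= big1 => [|i ik].
  rewrite addr0 /ebase eqxx mulr1 eq_sym.
  by case: eqP => _; rewrite ?mulr0 ?mul0r// mulr1 mul1r -expr2 sqr_sqrtr.
by rewrite /ebase [k == i]eq_sym (negbTE ik) mulr0 mul0r.
Qed.

Definition scale_noise (t : R) s : seq (I -> R) :=
  [seq (fun k => (Num.sqrt t * a k)%R) | a <- s].

Lemma gcov_scale_noise t s k l : (0 <= t)%R ->
  gcov (scale_noise t s) k l = (t * gcov s k l)%R.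
Proof.
move=> t0; rewrite /gcov big_map mulr_sumr; apply: eq_bigr => a _.
by rewrite mulrACA -expr2 sqr_sqrtr// mulrA.
Qed.

Lemma gcovC s i j : gcov s i j = gcov s j i.
Proof. by apply: eq_bigr => a _; rewrite mulrC. Qed.

Section path.
Variables (s1 s2 : seq (I -> R)) (f : (I -> R) -> \bar R).
Let D i j := (gcov s1 i j - gcov s2 i j)%R.
Hypothesis mf : coord_meas f.
Hypothesis D0 : forall i j, (0 <= D i j)%R.
Hypothesis sf : forall i j, D i j != 0%R -> submodular f i j.

Let Dsym i j : D i j = D j i. Proof. by rewrite /D !(gcovC _ i j). Qed.

(* Along the segment of covariances from s2 to s1, each step moves part of the
   diagonal noise into common noise of pairs of coordinates. *)
Let L (n : nat) (eps : R) (k : nat) :=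
  scale_noise (k%:R / n%:R) s1 ++ scale_noise (1 - k%:R / n%:R) s2 ++
  diag_noise (fun=> eps).

Let gauss_ex_step (n m : nat) (eps : R) z : (m < n)%N ->
  (forall i, \sum_j D i j / n%:R <= eps)%R ->
  gauss_ex (L n eps m.+1) f z <= gauss_ex (L n eps m) f z.
Proof.
move=> mn Deps.
have n0 : (0 < n%:R :> R)%R by rewrite ltr0n (leq_ltn_trans _ mn).
have eps0 (i : I) : (0 <= eps)%R.
  by rewrite (le_trans _ (Deps i))// sumr_ge0// => j _; rewrite divr_ge0// ltW.
have t01 k : (k <= n)%N -> (0 <= k%:R / n%:R :> R)%R /\ (0 <= 1 - k%:R / n%:R :> R)%R.
  move=> kn; rewrite divr_ge0 ?ler0n ?(ltW n0)//; split => //.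
  by rewrite subr_ge0 ler_pdivrMr// mul1r ler_nat.
(* One step must raise the covariance by D / n. Every unordered pair is met twice, hence the further
   half. *)
pose c (p : I * I) := Num.sqrt (D p.1 p.2 / n%:R / 2)%R.
have c2 p : (c p ^+ 2 = D p.1 p.2 / n%:R / 2)%R.
  by rewrite sqr_sqrtr// !divr_ge0// ltW.
(* What remains of the diagonal noise. Independent pair noise restores it to [eps]; common pair
   noise restores it and adds exactly D / n. *)
pose w i := (eps - \sum_j D i j / n%:R)%R.
have w0 i : (0 <= w i)%R by rewrite subr_ge0.
pose L' := scale_noise (m%:R / n%:R) s1 ++ scale_noise (1 - m%:R / n%:R) s2 ++
  diag_noise w.
have covI k l : gcov (indep_noise c (enum {: I * I})) k l =
    ((k == l)%:R * \sum_j D k j / n%:R)%R.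
  rewrite gcov_indep_noise big_enum /=.
  rewrite -(@sum2_ebase_diag _ _ (fun i j => D i j / n%:R)%R); last first.
    by move=> i j; rewrite Dsym.
  by rewrite pair_bigA /=; apply: eq_bigr => p _; rewrite c2.
have covC k l : gcov (common_noise c (enum {: I * I})) k l =
    ((k == l)%:R * (\sum_j D k j / n%:R) + D k l / n%:R)%R.
  rewrite -covI gcov_indep_noise gcov_common_noise !big_enum /=.
  rewrite -[LHS](subrK (\sum_p c p ^+ 2 * (ebase p.1 k * ebase p.1 l + ebase p.2 k * ebase p.2 l)))%R.
  rewrite [LHS]addrC; congr (_ + _)%R; rewrite -sumrB.
  rewrite -(@sum2_ebase_off _ _ (fun i j => D i j / n%:R)%R); last first.
    by move=> i j; rewrite Dsym.
  by rewrite pair_bigA /=; apply: eq_bigr => p _; rewrite c2; ring.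
have [tm tm'] := t01 m (ltnW mn); have [tm1 tm1'] := t01 _ mn.
have -> : gauss_ex (L n eps m.+1) f z =
    gauss_ex (L' ++ common_noise c (enum {: I * I})) f z.
  apply: gauss_ex_cov => // k l; rewrite /L /L' !gcov_cat !gcov_scale_noise//.
  rewrite !gcov_diag_noise// covC.
  rewrite /w -natr1 /D; set S := (\sum_j _)%R; by field; rewrite gt_eqF.
have -> : gauss_ex (L n eps m) f z =
    gauss_ex (L' ++ indep_noise c (enum {: I * I})) f z.
  apply: gauss_ex_cov => // k l; rewrite /L /L' !gcov_cat !gcov_scale_noise//.
  rewrite !gcov_diag_noise// covI.
  by rewrite /w; ring.
rewrite !(gauss_ex_cat L'); apply: le_gauss_ex => [||u].
- exact: coord_meas_gauss_ex.
- exact: coord_meas_gauss_ex.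
- apply: gauss_ex_common_noise_le => // [p|p cp]; first exact: sqrtr_ge0.
  apply: sf; apply: contraNneq cp => Dp.
  by rewrite /c Dp !mul0r sqrtr0.
Qed.

Lemma gauss_ex_comparison_noise (eps : R) z : (0 < eps)%R ->
  gauss_ex (s1 ++ diag_noise (fun=> eps)) f z <=
  gauss_ex (s2 ++ diag_noise (fun=> eps)) f z.
Proof.
move=> eps0.
(* Enough steps for each row sum of D / n to fit into the diagonal noise [eps]. *)
pose n := (Num.truncn ((\sum_i \sum_j D i j) / eps)%R).+1.
have n0 : (0 < n%:R :> R)%R by rewrite ltr0n.
have Deps i : (\sum_j D i j / n%:R <= eps)%R.
  rewrite -mulr_suml ler_pdivrMr// mulrC -ler_pdivrMr//.
  apply/ltW/(le_lt_trans _ (truncnS_gt _)); rewrite ler_pM2r ?invr_gt0//.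
  rewrite [leRHS](bigD1 i)//= lerDl sumr_ge0// => j _.
  by rewrite sumr_ge0// => k _.
have Lle m : (m <= n)%N -> gauss_ex (L n eps m) f z <= gauss_ex (L n eps 0%N) f z.
  elim: m => [//|m IH mn]; apply: le_trans (IH (ltnW mn)).
  exact: (gauss_ex_step z mn Deps).
have := Lle n (leqnn n); congr (_ <= _); apply: gauss_ex_cov => // k l;
  rewrite /L !gcov_cat !gcov_scale_noise ?divff ?gt_eqF// ?mul0r ?subr0 ?subrr//;
  by ring.
Qed.

End path.

Section noise_removal.
Variables (lam : R) (f : (I -> R) -> R).
Hypothesis lam0 : (0 < lam)%R.
Hypothesis mf : coord_meas (fun y => (f y)%:E).
Hypothesis fLip : forall x y : I -> R,
  (f (fun i => x i + y i) <= f x * expR (lam * \sum_i `|y i|))%R.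

(** The bound is linear in c, so the effect of the auxiliary noise tends to 0 with its size. *)
Lemma gauss_abs_mgf (c : R) : (0 <= c <= 1)%R ->
  \int[gauss]_x (expR (c * `|x|))%:E <= (1 + 2 * expR 2 * c)%:E.
Proof.
move=> /andP[c0 c1].
have mexp (t : R) : measurable_fun setT (fun x : measurableTypeR R => (expR (t * x))%:E).
  by apply/measurable_EFinP; apply: measurableT_comp => //; exact: measurable_funM.
have e0 (t x : R) : 0 <= (expR (t * x))%:E by rewrite lee_fin expR_ge0.
have -> : (1 + 2 * expR 2 * c)%:E = \int[gauss]_x
    (1%:E + (c%:E * (expR (2 * x))%:E + c%:E * (expR (- 2 * x))%:E)).
  rewrite ge0_integralD//; last 2 first.
  - by move=> x _; rewrite adde_ge0// mule_ge0.
  - by apply: emeasurable_funD; exact: measurable_funeM.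
  rewrite gauss_int_cst ge0_integralD//; first last.
  - exact: measurable_funeM.
  - by move=> x _; rewrite mule_ge0.
  - exact: measurable_funeM.
  - by move=> x _; rewrite mule_ge0.
  rewrite !ge0_integralZl// !gauss_mgf -!EFinM -!EFinD; congr (_%:E).
  rewrite sqrrN; have -> : (2 ^+ 2 / 2 = 2 :> R)%R by field.
  by ring.
apply: le_gauss_int.
- by move=> x; rewrite lee_fin expR_ge0.
- apply/measurable_EFinP; apply: measurableT_comp => //; exact: measurable_funM.
- by apply: emeasurable_funD => //; apply: emeasurable_funD; exact: measurable_funeM.
move=> x; rewrite -!EFinM -!EFinD lee_fin -mulrDr.
(* e^u <= 1 + u e^u, and c |x| e^(c|x|) <= c e^(2|x|) *)
have u0 : (0 <= c * `|x|)%R by rewrite mulr_ge0.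
have h1 : (expR (c * `|x|) <= 1 + c * `|x| * expR (c * `|x|))%R.
  have := expR_ge1Dx (- (c * `|x|))%R; rewrite expRN => h.
  have E0 := expR_gt0 (c * `|x|)%R.
  move: h; rewrite -(ler_pM2r E0) mulVf ?gt_eqF//; lra.
apply: (le_trans h1); rewrite lerD2l -mulrA ler_wpM2l//.
have h2 : (`|x| * expR (c * `|x|) <= expR (2 * `|x|))%R.
  have -> : (2 * `|x| = `|x| + `|x|)%R by ring.
  rewrite expRD ler_pM ?expR_ge0//.
    by rewrite (le_trans _ (expR_ge1Dx _))// lerDr.
  by rewrite ler_expR ler_piMl.
apply: (le_trans h2); have [x0|x0] := leP 0%R x.
  by rewrite ger0_norm// lerDl expR_ge0.
by rewrite ltr0_norm// mulrN -mulNr lerDr expR_ge0.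
Qed.

Let f0 y : (0 <= f y)%R. Proof. by have := mf.1 y; rewrite lee_fin. Qed.

Let sum_abs_ebase (i : I) (x : R) : (\sum_j `|x * ebase i j| = `|x|)%R.
Proof.
rewrite (bigD1 i)//= big1 /ebase ?eqxx ?mulr1 ?addr0// => j ji.
by rewrite (negbTE ji) mulr0 normr0.
Qed.

Let mexpabs (c : R) : measurable_fun setT (fun x : measurableTypeR R => (expR (c * `|x|))%:E).
Proof.
apply/measurable_EFinP; apply: measurableT_comp => //; exact: measurable_funM.
Qed.

Let one_noise (eps : R) (i : I) z : (0 < eps)%R -> (lam * eps <= 1)%R ->
  let K := (2 * expR 2 * (lam * eps))%R in
  (1 - K)%:E * (f z)%:E <= gauss_ex [:: fun k => (eps * ebase i k)%R] (fun y => (f y)%:E) z /\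
  gauss_ex [:: fun k => (eps * ebase i k)%R] (fun y => (f y)%:E) z <= (1 + K)%:E * (f z)%:E.
Proof.
move=> eps0 c1 K; set c := (lam * eps)%R.
have c01 : (0 <= c <= 1)%R by rewrite /c c1 andbT mulr_ge0// ltW.
pose b : I -> R := fun k => (eps * ebase i k)%R.
have up (x : R) : (f (vshift z b x) <= f z * expR (c * `|x|))%R.
  apply: (le_trans (fLip z (fun k => x * b k)%R)).
  under eq_bigr do rewrite /b mulrA.
  rewrite sum_abs_ebase normrM (gtr0_norm eps0).
  by have -> : (lam * (`|x| * eps) = c * `|x|)%R by rewrite /c; ring.
have dn (x : R) : (f z * expR (- c * `|x|) <= f (vshift z b x))%R.
  have := fLip (vshift z b x) (fun k => - x * b k)%R.
  have -> : (fun k => vshift z b x k + - x * b k)%R = z.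
    by apply/funext => k; rewrite /vshift; ring.
  under eq_bigr do rewrite /b mulrA.
  rewrite sum_abs_ebase normrM normrN (gtr0_norm eps0) => h.
  rewrite mulNr expRN ler_pdivrMr ?expR_gt0//.
  by move: h; have -> : (lam * (`|x| * eps) = c * `|x|)%R by rewrite /c; ring.
have mfs : measurable_fun setT (fun x : measurableTypeR R => (f (vshift z b x))%:E).
  exact: (coord_meas_vshift z b mf).
have mm k : measurable_fun setT (fun x : measurableTypeR R => (f z)%:E * (expR (k * `|x|))%:E).
  exact: measurable_funeM.
have e0 (t x : R) : 0 <= (expR (t * `|x|))%:E by rewrite lee_fin expR_ge0.
split => /=; last first.
  apply: (@le_trans _ _ (\int[gauss]_x ((f z)%:E * (expR (c * `|x|))%:E))).
    by apply: le_gauss_int => // x; rewrite ?lee_fin// -EFinM lee_fin.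
  rewrite ge0_integralZl// ?lee_fin// muleC lee_wpmul2r ?lee_fin//.
  exact: gauss_abs_mgf.
apply: (@le_trans _ _ (\int[gauss]_x ((f z)%:E * (expR (- c * `|x|))%:E))); last first.
  apply: le_gauss_int => [x|||x]; [by rewrite mule_ge0 ?lee_fin|exact: mm|exact: mfs|].
  by rewrite -EFinM lee_fin.
rewrite ge0_integralZl// ?lee_fin// muleC lee_wpmul2l ?lee_fin//.
(* The lower estimate follows from the upper one, since exp (- u) + exp u >= 2. *)
have : 2%:E <= \int[gauss]_x ((expR (- c * `|x|))%:E + (expR (c * `|x|))%:E).
  rewrite -[leLHS]gauss_int_cst; apply: le_gauss_int => //.
    exact: emeasurable_funD.
  move=> x; rewrite -EFinD lee_fin mulNr.
  by have := expR_ge1Dx (c * `|x|)%R; have := expR_ge1Dx (- (c * `|x|))%R; lra.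
rewrite ge0_integralD// => h.
have := le_trans h (leeD (lexx _) (gauss_abs_mgf c01)).
have : 0 <= \int[gauss]_x (expR (- c * `|x|))%:E by apply: integral_ge0.
case: (\int[gauss]_x _) => [r| |//]; rewrite -?EFinD ?lee_fin ?leey//.
by rewrite /K -/c; lra.
Qed.

Lemma gauss_ex_small_noise (eps : R) (l : seq I) z : (0 < eps)%R -> (lam * eps <= 1)%R ->
  let K := (2 * expR 2 * (lam * eps))%R in (K <= 1)%R ->
  let s := [seq (fun k => (eps * ebase i k)%R) | i <- l] in
  ((1 - K) ^+ size l)%:E * (f z)%:E <= gauss_ex s (fun y => (f y)%:E) z /\
  gauss_ex s (fun y => (f y)%:E) z <= ((1 + K) ^+ size l)%:E * (f z)%:E.
Proof.
move=> eps0 c1 K K1; have K0 : (0 <= K)%R.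
  by rewrite !mulr_ge0 ?expR_ge0// ltW.
elim: l z => [|i l IH] z /=; first by rewrite !expr0 mul1e.
have [d1 u1] := one_noise i z eps0 c1.
set b := fun k => (eps * ebase i k)%R in d1 u1 *.
pose F (q : R) (y : I -> R) := q%:E * (f y)%:E.
have mF q : (0 <= q)%R -> coord_meas (F q).
  by move=> q0; apply: coord_measM => //; exact: coord_meas_cst.
set s := [seq _ | i <- l] in IH *.
have mG : coord_meas (gauss_ex s (fun y => (f y)%:E)) by exact: coord_meas_gauss_ex.
have q1 : (0 <= (1 - K) ^+ size l)%R by rewrite exprn_ge0// subr_ge0.
have q2 : (0 <= (1 + K) ^+ size l)%R by rewrite exprn_ge0// addr_ge0.
split.
- apply: (@le_trans _ _ (gauss_ex [:: b] (F ((1 - K) ^+ size l)%R) z)).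
    rewrite gauss_exZ// exprS mulrC EFinM -muleA lee_wpmul2l ?lee_fin//.
  rewrite -[leRHS]/(gauss_ex [:: b] (gauss_ex s (fun y => (f y)%:E)) z).
  by apply: le_gauss_ex => //; [exact: mF|move=> y; have [] := IH y].
- apply: (@le_trans _ _ (gauss_ex [:: b] (F ((1 + K) ^+ size l)%R) z)).
    rewrite -[leLHS]/(gauss_ex [:: b] (gauss_ex s (fun y => (f y)%:E)) z).
    by apply: le_gauss_ex => //; [exact: mF|move=> y; have [] := IH y].
  rewrite gauss_exZ// exprS mulrC EFinM -muleA lee_wpmul2l ?lee_fin//.
Qed.

Theorem gauss_ex_comparison (s1 s2 : seq (I -> R)) z :
  (forall i j, gcov s2 i j <= gcov s1 i j)%R ->
  (forall i j, gcov s1 i j != gcov s2 i j -> submodular (fun y => (f y)%:E) i j) ->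
  gauss_ex s1 (fun y => (f y)%:E) z <= gauss_ex s2 (fun y => (f y)%:E) z.
Proof.
move=> D0 sf; set F := fun y => (f y)%:E.
set X := gauss_ex s1 F z; set Y := gauss_ex s2 F z.
have X0 : 0 <= X by exact: gauss_ex_ge0.
have Y0 : 0 <= Y by exact: gauss_ex_ge0.
pose N := size (enum I).
have key (K : R) : (0 < K <= 1)%R -> ((1 - K) ^+ N)%:E * X <= ((1 + K) ^+ N)%:E * Y.
  move=> /andP[K0 K1]; pose M : R := (2 * expR 2)%R.
  have M1 : (1 <= M)%R.
    rewrite /M; have := expR_ge1Dx (2 : R)%R; lra.
  have M0 : (0 < M)%R by exact: lt_le_trans M1.
  (* With this noise size the relative error per coordinate is exactly K. *)
  pose eps := (K / M / lam)%R.
  have eps0 : (0 < eps)%R by rewrite !divr_gt0.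
  have le1 : (lam * eps = K / M)%R by rewrite /eps mulrC divfK// gt_eqF.
  have KE : (2 * expR 2 * (lam * eps) = K)%R by rewrite le1 -/M mulrC divfK// gt_eqF.
  have c1 : (lam * eps <= 1)%R by rewrite le1 ler_pdivrMr// mul1r (le_trans K1).
  have noise y := gauss_ex_small_noise (enum I) y eps0 c1.
  rewrite /= KE in noise.
  have dE : diag_noise (fun=> eps ^+ 2)%R = [seq (fun k => (eps * ebase i k)%R) | i <- enum I].
    by rewrite /diag_noise sqrtr_sqr (gtr0_norm eps0).
  have q1 : (0 <= (1 - K) ^+ N)%R by rewrite exprn_ge0// subr_ge0.
  have q2 : (0 <= (1 + K) ^+ N)%R by rewrite exprn_ge0// addr_ge0// ltW.
  have mF q : (0 <= q)%R -> coord_meas (fun y => q%:E * F y).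
    by move=> q0; apply: coord_measM => //; exact: coord_meas_cst.
  have mG : coord_meas (gauss_ex (diag_noise (fun=> eps ^+ 2)%R) F).
    exact: coord_meas_gauss_ex.
  rewrite -!gauss_exZ//.
  apply: (@le_trans _ _ (gauss_ex (s1 ++ diag_noise (fun=> eps ^+ 2)%R) F z)).
    rewrite gauss_ex_cat; apply: le_gauss_ex => //; first exact: mF.
    by move=> y; rewrite dE; have [] := noise y K1.
  apply: (@le_trans _ _ (gauss_ex (s2 ++ diag_noise (fun=> eps ^+ 2)%R) F z)).
    apply: gauss_ex_comparison_noise => //.
    - by move=> i j; rewrite subr_ge0.
    - by move=> i j; rewrite subr_eq0; exact: sf.
    - by rewrite exprn_gt0.
  rewrite gauss_ex_cat; apply: le_gauss_ex => //; first exact: mF.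
  by move=> y; rewrite dE; have [] := noise y K1.
(* With K = u / (N + 1), Bernoulli's inequality makes each of the two N-fold factors cost at most 1
   - u, and (1 - u)^2 >= 1 - 2 u. *)
have {key} key (u : R) : (0 < u <= 1 / 2)%R -> (1 - 2 * u)%:E * X <= Y.
  move=> /andP[u0 u1]; pose K := (u / N.+1%:R)%R.
  have K0 : (0 < K)%R by rewrite divr_gt0.
  have K1 : (K <= 1 / 2)%R.
    by rewrite (le_trans _ u1)// ler_pdivrMr// ler_peMr ?ler1n// ltW.
  have NK : (N%:R * K <= u)%R.
    rewrite /K mulrCA ler_piMr ?(ltW u0)// ler_pdivrMr// mul1r ler_nat//.
  have B1 : (1 - u <= (1 - K) ^+ N)%R.
    apply: le_trans (bernoulli_ineq N _); last by lra.
    by rewrite lerD2l lerN2.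
  have B2 : (1 - u <= ((1 + K) ^+ N)^-1)%R.
    apply: (le_trans B1); rewrite -exprVn; apply: lerXn2r; rewrite ?nnegrE ?invr_ge0; try lra.
    rewrite -[leRHS]mul1r ler_pdivlMr; [nra|lra].
  have kk : (0 < (1 + K) ^+ N)%R by rewrite exprn_gt0//; lra.
  have := key K; rewrite K0 (le_trans K1)//; last by lra.
  move=> /(_ isT) h.
  have : (((1 + K) ^+ N)^-1)%:E * (((1 - K) ^+ N)%:E * X) <= Y.
    rewrite -[leRHS]mul1e -[in leRHS](mulVf (lt0r_neq0 kk)) EFinM -muleA.
    by rewrite lee_wpmul2l// lee_fin invr_ge0 ltW.
  apply: le_trans; rewrite muleA -EFinM lee_wpmul2r// lee_fin.
  have : ((1 - u) * (1 - u) <= ((1 + K) ^+ N)^-1 * (1 - K) ^+ N)%R.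
    by rewrite ler_pM//; lra.
  by nra.
have [->|Yfin] := eqVneq Y +oo; first by rewrite leey.
have Xy : X != +oo.
  apply: contra_neq Yfin => Xoo; have := key (1 / 4)%R.
  rewrite Xoo gt0_muley; last by rewrite lte_fin; lra.
  rewrite leye_eq => h; apply/eqP/h; lra.
move: X Y X0 Y0 Xy Yfin key => [x| |] [y| |]// X0 Y0 _ _ key.
rewrite lee_fin; apply/ler_addgt0Pr => e e0.
rewrite lee_fin in X0.
pose u := Num.min (1 / 2)%R (e / (2 * (x + 1)))%R.
have x1 : (0 < 2 * (x + 1))%R by lra.
have u0 : (0 < u)%R by rewrite lt_min; apply/andP; split; [lra|exact: divr_gt0].
have u1 : (u <= 1 / 2)%R by rewrite ge_min lexx.
have u2 : (u * (2 * (x + 1)) <= e)%R.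
  by rewrite -ler_pdivlMr// ge_min lexx orbT.
have := key u; rewrite u0 u1 -EFinM lee_fin => /(_ isT) h; nra.
Qed.
End noise_removal.
End comparison.

(** * Independent normal variables *)

Section gaussian_law.
Context {R : realType} {d : measure_display} {T : measurableType d}.
Local Notation gauss := (normal_prob (0 : R) 1).
Local Open Scope ereal_scope.

Lemma ge0_integral_indep_pair (d2 : measure_display) (T2 : measurableType d2)
    (mu : {measure set T -> \bar R}) (X : T -> measurableTypeR R) (W : T -> T2)
    (F : measurableTypeR R * T2 -> \bar R) :
  mu setT < +oo -> measurable_fun setT X -> measurable_fun setT W ->
  (forall A B, measurable A -> measurable B ->
    mu (X @^-1` A `&` W @^-1` B) = gauss A * mu (W @^-1` B)) ->
  measurable_fun setT F -> (forall u, 0 <= F u) ->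
  \int[mu]_w F (X w, W w) = \int[gauss]_x \int[mu]_w F (x, W w).
Proof.
move=> muoo mX mW XW mF F0.
have mXW : measurable_fun setT (fun w => (X w, W w)) by exact: measurable_fun_pair.
pose HW := isMeasurableFun.Build _ _ _ _ _ mW.
pose W' : {mfun T >-> T2} := HB.pack W HW.
pose HXW := isMeasurableFun.Build _ _ _ _ _ mXW.
pose XW' : {mfun T >-> (measurableTypeR R * T2)%type} := HB.pack (fun w => (X w, W w)) HXW.
pose nu_ : {measure set T2 -> \bar R} := pushforward mu W'.
pose nu : {measure set T2 -> \bar R} := nu_ mW.
have nufin : fin_num_fun nu.
  move=> A mA; rewrite ge0_fin_numE// (le_lt_trans _ muoo)//.
  rewrite -[leLHS]/(mu (W @^-1` A)); apply: le_measure; rewrite ?inE//.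
  by rewrite -[X in measurable X]setTI; exact: (mW measurableT _ mA).
pose H1 := Measure_isFinite.Build _ _ _ nu nufin.
pose nu' : {finite_measure set T2 -> \bar R} := HB.pack (Measure.sort nu) H1.
pose m_ : {measure set (measurableTypeR R * T2)%type -> \bar R} := pushforward mu XW'.
pose m' : {measure set (measurableTypeR R * T2)%type -> \bar R} := m_ mXW.
have E : forall Y, measurable Y -> (gauss \x nu') Y = m' Y.
  apply: product_measure_unique => A B mA mB.
  exact: XW.
transitivity (\int[m']_u F u).
  by rewrite [RHS]ge0_integral_pushforward.
transitivity (\int[gauss \x nu']_u F u).
  by apply: eq_measure_integral => Y mY _; first [exact: E|exact/esym/E].
rewrite (fubini_tonelli1 F mF F0); apply: eq_integral => x _.
rewrite /fubini_F.
have mFx : measurable_fun setT (fun t => F (x, t)) by exact: (measurableT_comp mF).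
exact: (@ge0_integral_pushforward _ _ _ _ R W mW mu setT (fun t => F (x, t)) measurableT mFx (fun t _ => F0 _)).
Qed.

(** Independence is given on rectangles only. The measure is an arbitrary finite one so that the
    induction hypothesis also applies to [mu] restricted to an event of the first variable. *)
Lemma integral_indep_normal n : forall (mu : {measure set T -> \bar R})
    (X : nat -> T -> measurableTypeR R) (I : Type) (a : nat -> I -> R)
    (f : (I -> R) -> \bar R) (z : I -> R),
  mu setT < +oo -> (forall k, measurable_fun setT (X k)) ->
  (forall B : nat -> set R, (forall k, measurable (B k)) ->
    mu [set w | forall k, (k < n)%N -> B k (X k w)] =
    mu setT * \prod_(k < n) gauss (B k)) ->
  coord_meas f ->
  \int[mu]_w f (fun i => z i + \sum_(k < n) X k w * a k i)%R =
  mu setT * gauss_ex [seq a k | k <- iota 0 n] f z.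
Proof.
elim: n => [|n IH] mu X I a f z muoo mX rect mf.
  transitivity (\int[mu]_w f z).
    by apply: eq_integral => w _; congr f; apply/funext => i; rewrite big_ord0 addr0.
  by rewrite integral_cst//= muleC.
pose X' k := X k.+1.
have mX' k : measurable_fun setT (X' k) by exact: mX.
pose Bc (A : set R) (B : nat -> set R) k := if k is k'.+1 then B k' else A.
have rectA (A : set R) B : measurable A -> (forall k, measurable (B k)) ->
    mu (X 0%N @^-1` A `&` [set w | forall k, (k < n)%N -> B k (X' k w)]) =
    mu setT * gauss A * \prod_(k < n) gauss (B k).
  move=> mA mB; rewrite -muleA -[gauss A * _]/(_ * _).
  have -> : gauss A * \prod_(k < n) gauss (B k) = \prod_(k < n.+1) gauss (Bc A B k).
    by rewrite big_ord_recl.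
  rewrite -rect; last by case.
  congr (mu _); apply/seteqP; split => w /=.
    by move=> [A0 H] [|k]//=; rewrite ltnS; exact: H.
  by move=> H; split; [exact: (H 0%N)|move=> k kn; exact: (H k.+1)].
have gaussT : gauss setT = 1 by exact: probability_setT.
have prodT : \prod_(k < n) gauss setT = 1 by rewrite big1.
have mXA A : measurable A -> measurable (X 0%N @^-1` A).
  by move=> mA; rewrite -[X in measurable X]setTI; exact: mX.
have muA (A : set R) : measurable A -> mu (X 0%N @^-1` A) = mu setT * gauss A.
  move=> mA; have := rectA A (fun=> setT) mA (fun=> measurableT).
  rewrite prodT mule1 => <-; congr (mu _); apply/seteqP; split => w /=; last by case.
  by move=> ?; split.
pose W (w : T) : n.-tuple (measurableTypeR R) := [tuple X' i w | i < n].
have mW : measurable_fun setT W.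
  by apply/measurable_fun_tnthP => i; rewrite (_ : _ \o _ = X' i)//;
    apply/funext => w /=; rewrite tnth_mktuple.
(* The law of the remaining variables, written as a Gaussian integral of an indicator. The induction
   hypothesis evaluates it on all measurable sets, not only rectangles. *)
pose cB (B : set (n.-tuple (measurableTypeR R))) : \bar R :=
  gauss_ex [seq (fun i : 'I_n => (i == k :> nat)%:R%R) | k <- iota 0 n]
    (fun y : 'I_n -> R => (\1_B ([tuple y i | i < n] : n.-tuple (measurableTypeR R)))%:E) (fun=> 0%R).
have indB (nu : {measure set T -> \bar R}) B : measurable B -> nu setT < +oo ->
    (forall B : nat -> set R, (forall k, measurable (B k)) ->
    nu [set w | forall k, (k < n)%N -> B k (X' k w)] =
    nu setT * \prod_(k < n) gauss (B k)) ->
    nu (W @^-1` B) = nu setT * cB B.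
  move=> mB nuoo nurect; rewrite /cB -(IH nu X')//; last first.
    split => [y|d' T' c mc]; first by rewrite lee_fin.
    have mi : measurable_fun setT (\1_B : n.-tuple (measurableTypeR R) -> R).
      exact: measurable_indic.
    have mt : measurable_fun setT
        (fun t => [tuple c t i | i < n] : n.-tuple (measurableTypeR R)).
      apply/measurable_fun_tnthP => i; rewrite (_ : _ \o _ = fun t => c t i); first exact: mc.
      by apply/funext => t /=; rewrite tnth_mktuple.
    by apply/measurable_EFinP; exact: (measurableT_comp mi mt).
  transitivity (\int[nu]_w (\1_(W @^-1` B) w)%:E).
    by rewrite integral_indic ?setIT//; rewrite -[X in measurable X]setTI; exact: mW.
  apply: eq_integral => w _; congr (_%:E).
  rewrite /indic; congr ((_ \in B)%:R)%R; apply: eq_from_tnth => i.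
  rewrite !tnth_mktuple add0r (bigD1 i)//= eqxx mulr1 big1 ?addr0// => j ji.
  by rewrite eq_sym (inj_eq val_inj) (negbTE ji) mulr0.
have rectT : forall B : nat -> set R, (forall k, measurable (B k)) ->
    mu [set w | forall k, (k < n)%N -> B k (X' k w)] =
    mu setT * \prod_(k < n) gauss (B k).
  move=> B mB; have := rectA setT B measurableT mB.
  by rewrite preimage_setT setTI gaussT mule1.
pose F (u : measurableTypeR R * n.-tuple (measurableTypeR R)) :=
  f (fun i => vshift z (a 0%N) u.1 i + \sum_(k < n) tnth u.2 k * a k.+1 i)%R.
have mF : measurable_fun setT F.
  apply: mf.2 => i; apply: measurable_funD.
    by apply: measurable_funD => //; exact: measurable_funM.
  apply: measurable_sum => k; apply: measurable_funM => //.
  by apply: (measurableT_comp (measurable_tnth k)).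
have -> : \int[mu]_w f (fun i => z i + \sum_(k < n.+1) X k w * a k i)%R =
    \int[mu]_w F (X 0%N w, W w).
  apply: eq_integral => w _; rewrite /F; congr f; apply/funext => i.
  rewrite big_ord_recl /vshift /= addrA; congr (_ + _)%R.
  by apply: eq_bigr => k _; rewrite tnth_mktuple.
rewrite (ge0_integral_indep_pair muoo (mX 0%N) mW _ mF (fun u => mf.1 _)); last first.
  move=> A B mA mB.
  (* Under the restriction to X_0 in A the tail has the same normalized law [cB], which is
     independence of the first variable from the whole tail. *)
  have := @indB (mrestr mu (mXA A mA)) B mB; rewrite /= /mrestr setTI => h.
  rewrite setIC h.
  - by rewrite (indB mu B)// muA// muleAC muleC.
  - by rewrite (le_lt_trans _ muoo)//; apply: le_measure; rewrite ?inE//; exact: mXA.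
  - by move=> B' mB'; rewrite setIC rectA// muA.
have -> : [seq a k | k <- iota 0 n.+1] = a 0%N :: [seq a k.+1 | k <- iota 0 n].
  by rewrite /= -[1%N]addn0 iotaDl -map_comp.
move=> /=; rewrite -ge0_integralZl//; last 2 first.
- exact: measurable_gauss_ex.
- by move=> x _; exact: gauss_ex_ge0.
apply: eq_integral => x _; rewrite -(IH mu X')//.
apply: eq_integral => w _; rewrite /F /=; congr f; apply/funext => i.
by congr (_ + _)%R; apply: eq_bigr => k _; rewrite tnth_mktuple.
Qed.

Lemma expect_indep_normal (P : probability T R) (J : finType)
    (X : J -> {RV P >-> R}) (I : Type) (a : J -> I -> R)
    (f : (I -> R) -> \bar R) (z : I -> R) :
  (forall j, std_normal (X j)) -> mutually_independent X -> coord_meas f ->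
  \int[P]_w f (fun i => z i + \sum_j X j w * a j i)%R =
  gauss_ex [seq a j | j <- enum J] f z.
Proof.
move=> Xn Xi mf.
have PT : (P : {measure set T -> \bar R}) setT = 1 by exact: probability_setT.
pose Xs := [seq (X j : T -> R) | j <- enum J].
pose as_ := [seq a j | j <- enum J].
pose Y k : T -> measurableTypeR R := nth (cst 0%R) Xs k.
have sX : size Xs = #|J| by rewrite size_map cardE.
have mY k : measurable_fun setT (Y k).
  have [kn|kn] := ltnP k #|J|; last first.
    by rewrite /Y nth_default ?sX//; exact: measurable_cst.
  by rewrite /Y (nth_map (enum_val (Ordinal kn))) -?cardE//; exact: (measurable_funPT (X _)).
have YE (j : 'I_#|J|) : Y j = X (enum_val j).
  by rewrite /Y (nth_map (enum_val j)) -?cardE// /enum_val; congr (X _); apply: set_nth_default; rewrite -cardE.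
have aE (j : 'I_#|J|) : nth (fun=> 0%R) as_ j = a (enum_val j).
  by rewrite /as_ (nth_map (enum_val j)) -?cardE// /enum_val; congr (a _); apply: set_nth_default; rewrite -cardE.
rewrite -/as_.
have <- : [seq nth (fun=> 0%R) as_ k | k <- iota 0 #|J|] = as_.
  have <- : size as_ = #|J| by rewrite size_map cardE.
  by rewrite map_nth_iota0 ?take_size.
rewrite -[RHS]mul1e -PT -(integral_indep_normal (n := #|J|) (X := Y))//.
- apply: eq_integral => w _; congr f; apply/funext => i; congr (_ + _)%R.
  rewrite (reindex (enum_val (A := J))) /=; last exact/onW_bij/enum_val_bij.
  by apply: eq_bigr => j _; rewrite YE aE.
- by rewrite PT ltry.
- move=> B mB; rewrite PT mul1e.
  pose B' (j : J) := B (enum_rank j).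
  have := Xi [set: J]%SET B' (fun j _ => mB _).
  have -> : \bigcap_(i in [set` [set: J]%SET]) (X i @^-1` B' i) =
      [set w | forall k, (k < #|J|)%N -> B k (Y k w)].
    apply/seteqP; split => w /=.
      move=> H k kn; have := H (enum_val (Ordinal kn)); rewrite /= inE => /(_ isT).
      by rewrite /B' enum_valK /= -YE.
    by move=> H j _; have := H (enum_rank j) (ltn_ord _); rewrite /B' YE enum_rankK.
  move=> H; etransitivity; first exact: H.
  rewrite (reindex (enum_val (A := J))) /=; last exact/onW_bij/enum_val_bij.
  apply: eq_big => [j|j _]; first by rewrite inE.
  by rewrite /B' enum_valK; exact: Xn.
Qed.

(** Membership of y in the affine space z + span s, which carries the law of [gauss_ex s] at z. *)
Fixpoint reach (I : Type) (s : seq (I -> R)) (z y : I -> R) : Prop :=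
  if s is a :: s' then exists x, reach s' (vshift z a x) y else y = z.

Lemma reach_translate (I : Type) (s : seq (I -> R)) z y a (x : R) :
  reach s z y -> reach s (vshift z a x) (vshift y a x).
Proof.
elim: s z => [z ->//|b s IH] z /= [t /IH H]; exists t.
rewrite (_ : vshift (vshift z a x) b t = vshift (vshift z b t) a x)//.
by apply/funext => i; rewrite /vshift; ring.
Qed.

Lemma finite_poly_roots (p : {poly R}) (x0 : R) : p != 0%R ->
  finite_set [set x | p.[x - x0] = 0]%R.
Proof.
move=> p0; apply: contrapT => /(infinite_set_fset (size p))[B BA sB].
have := @max_poly_roots _ p [seq x - x0 | x <- finmap.enum_fset B]%R p0.
rewrite size_map ltnNge sB => H; apply: notF; apply: H.
  by apply/allP => y /mapP[x xB ->]; apply/eqP; exact: (BA x).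
by rewrite map_inj_uniq ?finmap.fset_uniq//; exact: addIr.
Qed.

(** A nonzero value at a reachable y makes the restriction to the line through y along [a] a nonzero
    polynomial. Away from its finitely many roots, y translated along [a] is a witness for the
    remaining directions. *)
Lemma gauss_ex_poly_zero (I : Type) (F : (I -> R) -> R) s z :
  (forall y a, exists p : {poly R}, forall x, F (vshift y a x) = p.[x]%R) ->
  coord_meas (fun y => ((F y == 0)%R%:R)%:E) ->
  (exists2 y, reach s z y & F y != 0%R) ->
  gauss_ex s (fun y => ((F y == 0)%R%:R)%:E) z = 0.
Proof.
move=> Fp mf; elim: s z => [|a s IH] z /=.
  by move=> [y -> /negbTE ->].
move=> [y [x0 yr] Fy].
have [p Ep] := Fp y a.
have p0 : p != 0%R.
  apply: contra_neq Fy => p0; have := Ep 0%R; rewrite p0 horner0 => <-.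
  by congr F; apply/funext => i; rewrite /vshift mul0r addr0.
have z0 x : p.[x - x0]%R != 0%R ->
    gauss_ex s (fun y => ((F y == 0)%R%:R)%:E) (vshift z a x) = 0.
  move=> px; apply: IH; exists (vshift y a (x - x0)); last by rewrite Ep.
  have := reach_translate a (x - x0)%R yr.
  congr reach; apply/funext => i; rewrite /vshift; ring.
pose S := [set x | p.[x - x0] = 0]%R.
have cS : countable S := finite_set_countable (finite_poly_roots x0 p0).
have mS : measurable (S : set (measurableTypeR R)) by exact: countable_measurable.
rewrite (@ae_eq_integral _ _ _ gauss setT (cst 0))//.
- exact: integral0.
- exact: measurable_gauss_ex.
- exists S; split => //.
    have dom := normal_prob_dominates (0 : R) 1.
    exact: ((null_content_dominatesP _ _).1 dom S mS (countable_lebesgue_measure0 cS)).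
  move=> x /= H; apply: contrapT => nS; apply: H => _; apply: z0; exact/eqP.
Qed.

End gaussian_law.

(** * Laplace transforms of the norm of a Gaussian vector *)

Section stein.
Context {R : realType}.
Variables (lam q0 : R).
Hypotheses (lam0 : 0 <= lam) (q00 : 0 < q0).
Local Notation mu := (@lebesgue_measure R).
Local Notation gauss := (normal_prob (0 : R) 1).

(** One coordinate is free; [q0] will hold the squares of the other coordinates plus a
    regularization that keeps [rho] smooth at 0. Integration by parts is the identity B' = k - h. *)
Let rho (x : R) : R := Num.sqrt (x ^+ 2 + q0).
Let E (x : R) : R := expR (- lam * rho x - x ^+ 2 / 2).
Let ri (x : R) : R := (rho x)^-1.
Let B (x : R) : R := x * ri x * E x.
Let k (x : R) : R := ri x * E x.
Let h (x : R) : R := x ^+ 2 * (ri x + lam * ri x ^+ 2 + ri x ^+ 3) * E x.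

Let u0 x : 0 < x ^+ 2 + q0. Proof. by rewrite ltr_wpDl// sqr_ge0. Qed.
Let rho_gt0 x : 0 < rho x. Proof. by rewrite sqrtr_gt0. Qed.
Let ri_gt0 x : 0 < ri x. Proof. by rewrite invr_gt0. Qed.
Let E_gt0 x : 0 < E x. Proof. exact: expR_gt0. Qed.

Let d_rho (x : R) : is_derive x 1 rho (x * ri x).
Proof.
have d1 : is_derive x 1 (fun y : R => y ^+ 2 + q0) (2 * x).
  apply: (@is_derive_eq _ _ _ (id * id + cst q0)).
  by rewrite /GRing.scale /=; ring.
have d2 := is_derive1_sqrt (u0 x).
apply: (@is_derive_eq _ _ _ (Num.sqrt \o (fun y => y ^+ 2 + q0))).
by rewrite /ri /rho; field; rewrite gt_eqF// rho_gt0.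
Qed.

Let d_ri (x : R) : is_derive x 1 ri (- x * ri x ^+ 3).
Proof.
have dr := d_rho x.
apply: (@is_derive_eq _ _ _ (fun y => (rho y)^-1)).
  by apply: is_deriveV; rewrite gt_eqF// rho_gt0.
by rewrite -[LHS]/(_ * _) /ri; field; rewrite gt_eqF// rho_gt0.
Qed.

Let d_E (x : R) : is_derive x 1 E ((- lam * (x * ri x) - x) * E x).
Proof.
have dr := d_rho x.
have d1 : is_derive x 1 (fun y => - lam * rho y - y ^+ 2 / 2) (- lam * (x * ri x) - x).
  have d2 : is_derive x 1 (fun y => (- lam) *: rho y) (- lam *: (x * ri x)).
    exact: is_deriveZ.
  have d3 : is_derive x 1 (fun y : R => y ^+ 2 / 2) x.
    have d4 : is_derive x 1 (fun y : R => y * y) (x + x).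
      by apply: (@is_derive_eq _ _ _ ((id : R -> R) * (id : R -> R))); rewrite /GRing.scale /=; ring.
    have -> : (fun y : R => y ^+ 2 / 2) = (fun y : R => 2^-1 *: (y * y)).
      by apply/funext => y; rewrite expr2 mulrC.
    by apply: (is_derive_eq (is_deriveZ (2^-1) d4)); rewrite /GRing.scale /=; field.
  exact: (is_deriveB d2 d3).
apply: (@is_derive_eq _ _ _ (expR \o (fun y => - lam * rho y - y ^+ 2 / 2))).
by rewrite mulrC.
Qed.

Let d_B (x : R) : is_derive x 1 B (k x - h x).
Proof.
have d1 := d_ri x; have d2 := d_E x.
apply: (@is_derive_eq _ _ _ ((id * ri) * E)).
rewrite -![_ *: _]/(_ * _) /= /k /h.
have -> : (id * ri) x = x * ri x by [].
by ring.
Qed.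

Let c_id : continuous (fun x : R => x). Proof. by move=> x; exact: cvg_id. Qed.
Let derive_cont (f : R -> R) (df : R -> R) : (forall x : R, is_derive x 1 f (df x)) -> continuous f.
Proof.
by move=> d x; apply: differentiable_continuous; apply/derivable1_diffP; case: (d x).
Qed.
Let c_M (f g : R -> R) : continuous f -> continuous g -> continuous (fun x => f x * g x).
Proof. by move=> cf cg x; apply: cvgM; [exact: cf|exact: cg]. Qed.
Let c_D (f g : R -> R) : continuous f -> continuous g -> continuous (fun x => f x + g x).
Proof. by move=> cf cg x; apply: cvgD; [exact: cf|exact: cg]. Qed.
Let c_N (f : R -> R) : continuous f -> continuous (fun x => - f x).
Proof. by move=> cf x; apply: cvgN; exact: cf. Qed.
Let c_cst (a : R) : continuous (fun _ : R => a). Proof. by move=> x; exact: cvg_cst. Qed.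
Let c_ri : continuous ri. Proof. exact: (derive_cont d_ri). Qed.
Let c_E : continuous E. Proof. exact: (derive_cont d_E). Qed.
Let c_B : continuous B. Proof. exact: (derive_cont d_B). Qed.
Let c_k : continuous k. Proof. exact: c_M. Qed.
Let c_h : continuous h.
Proof.
apply: c_M => //; apply: c_M; first exact: (c_M c_id c_id).
apply: c_D; last by apply: (c_M c_ri); exact: (c_M c_ri c_ri).
by apply: c_D => //; apply: c_M => //; exact: (c_M c_ri c_ri).
Qed.

Let mk : measurable_fun setT (EFin \o k).
Proof. by apply/measurable_EFinP; exact: continuous_measurable_fun. Qed.
Let mh : measurable_fun setT (EFin \o h).
Proof. by apply/measurable_EFinP; exact: continuous_measurable_fun. Qed.
Let k0 x : 0 <= k x. Proof. by rewrite mulr_ge0 ?ltW. Qed.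
Let h0 x : 0 <= h x.
Proof.
rewrite mulr_ge0 ?(ltW (E_gt0 x))// mulr_ge0 ?sqr_ge0// !addr_ge0 ?(ltW (ri_gt0 _))//.
  by rewrite mulr_ge0// sqr_ge0.
by rewrite exprn_ge0// ltW.
Qed.

Let ftc_sym (a : R) : 0 < a ->
  (\int[mu]_(x in `[(- a)%R, a]%classic) (k x)%:E =
   \int[mu]_(x in `[(- a)%R, a]%classic) (h x)%:E + (B a - B (- a))%R%:E)%E.
Proof.
move=> a0.
have aa : - a < a by lra.
have within (f : R -> R) : continuous f -> {within `[(- a)%R, a]%classic, continuous f}.
  by move=> cf; exact: continuous_subspaceT.
have intg (f : R -> R) : continuous f -> mu.-integrable `[(- a)%R, a]%classic (EFin \o f).
  by move=> cf; apply: continuous_compact_integrable; [exact: segment_compact|exact: within].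
have ckh : continuous (fun x => k x - h x) by apply: c_D => //; exact: c_N.
have F : (\int[mu]_(x in `[(- a)%R, a]%classic) (k x - h x)%:E = (B a)%:E - (B (- a))%:E)%E.
  apply: (continuous_FTC2 aa).
  - exact: within.
  - split.
    + by move=> x _; case: (d_B x).
    + by apply: cvg_at_right_filter; exact: c_B.
    + by apply: cvg_at_left_filter; exact: c_B.
  - by move=> x _; rewrite derive1E; apply: derive_val; exact: d_B.
rewrite EFinB -F -integralD//=; [|exact: (intg h)|exact: (intg _ ckh)].
by apply: eq_integral => x _; rewrite -EFinD addrC subrK.
Qed.

Let stein_lebesgue : (\int[mu]_x (k x)%:E <= \int[mu]_x (h x)%:E)%E.
Proof.
apply/lee_addgt0Pr => e e0.
pose Sn (n : nat) : set R := `[- n.+1%:R, n.+1%:R]%classic.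
have cvk : (\int[mu]_(x in Sn n) (k x)%:E @[n --> \oo] --> \int[mu]_(x in \bigcup_n Sn n) (k x)%:E)%E.
  apply: ge0_nondecreasing_set_cvg_integral => //.
  - move=> m n mn; apply/subsetPset => x; rewrite /Sn /= !in_itv /=.
    have : (m.+1%:R <= n.+1%:R :> R) by rewrite ler_nat ltnS.
    by move=> mn' /andP[? ?]; apply/andP; split; lra.
  - by move=> i; exact: measurable_itv.
  - by move=> i; exact: measurable_funTS.
  - by move=> i x _; rewrite lee_fin.
have UT : \bigcup_n Sn n = [set: R].
  apply/seteqP; split => // x _; exists (Num.truncn `|x|) => //.
  rewrite /Sn /= in_itv /= -ler_norml; apply: ltW; exact: truncnS_gt.
rewrite UT in cvk; rewrite -(cvg_lim _ cvk)//; apply: lime_le.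
  by apply/cvg_ex; eexists; exact: cvk.
near=> n.
have n1 : 0 < n.+1%:R :> R by [].
rewrite ftc_sym//; apply: leeD.
  by apply: ge0_subset_integral => // x _; rewrite lee_fin.
rewrite lee_fin.
have BE (x : R) : `|B x| <= expR (- x ^+ 2 / 2).
  rewrite /B !normrM (gtr0_norm (ri_gt0 x)) (gtr0_norm (E_gt0 x)) -[leRHS]mul1r.
  apply: ler_pM; rewrite ?mulr_ge0 ?(ltW (ri_gt0 _)) ?(ltW (E_gt0 _))//.
    rewrite ler_pdivrMr// mul1r -sqrtr_sqr ler_wsqrtr// lerDl ltW//.
  by rewrite /E ler_expR; have := mulr_ge0 lam0 (ltW (rho_gt0 x)); lra.
have := BE n.+1%:R; have := BE (- n.+1%:R); rewrite sqrrN !ler_norml.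
move=> /andP[b1 _] /andP[_ b2].
have ee : expR (- n.+1%:R ^+ 2 / 2) <= e / 2.
  have := expR_ge1Dx (n.+1%:R ^+ 2 / 2 : R) => h1.
  rewrite mulNr expRN invf_ple ?posrE ?expR_gt0 ?divr_gt0//.
  apply: le_trans h1.
  have N1 : 4 / e <= n.+1%:R.
    rewrite (@le_trans _ _ n%:R)// ?ler_nat//; near: n; exact: nbhs_infty_ger.
  have n11 : 1 <= n.+1%:R :> R by rewrite ler1n.
  have -> : (e / 2)^-1 = 4 / e / 2 by field; rewrite gt_eqF.
  by set v : R := n.+1%:R in n11 N1 *; nra.
by lra.
Unshelve. all: by end_near. Qed.

(** Stein's identity E g'(x) = E x g(x) for g = x exp (- lam rho) / rho, in the direction needed;
    the term with rho^-1 alone stays on the left so that both sides are nonnegative. *)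
Lemma stein_ineq :
  (\int[gauss]_x (expR (- lam * rho x) / rho x)%:E <=
   \int[gauss]_x (x ^+ 2 * ((rho x)^-1 + lam * (rho x)^-1 ^+ 2 + (rho x)^-1 ^+ 3) *
     expR (- lam * rho x))%:E)%E.
Proof.
have cexp : continuous (fun x => expR (- lam * rho x)).
  apply: (derive_cont (df := fun x => (- lam * (x * ri x)) * expR (- lam * rho x))) => x.
  have dr := d_rho x.
  have d2 : is_derive x 1 (fun y => - lam * rho y) (- lam * (x * ri x)).
    exact: (is_deriveZ (- lam) dr).
  by apply: (@is_derive_eq _ _ _ (expR \o (fun y => - lam * rho y))); rewrite mulrC.
have pw (p : R -> R) x : ((p x * expR (- lam * rho x))%:E * (normal_pdf 0 1 x)%:E =
    (normal_peak 1)%:E * (p x * E x)%:E)%E.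
  rewrite -!EFinM normal_pdf01E /E expRD [- x ^+ 2 / 2]mulNr; congr (_%:E); ring.
have pk : 0 <= normal_peak (1 : R) by exact: normal_peak_ge0.
rewrite !integral_normal_prob; first last.
- by move=> x; rewrite lee_fin mulr_ge0 ?expR_ge0// invr_ge0 ltW.
- apply/measurable_EFinP; apply: continuous_measurable_fun; exact: c_M.
- move=> x; rewrite lee_fin mulr_ge0 ?expR_ge0//.
  by have := h0 x; rewrite /h (pmulr_lge0 _ (E_gt0 x)).
- apply/measurable_EFinP; apply: continuous_measurable_fun.
  apply: c_M => //; apply: c_M; first exact: (c_M c_id c_id).
  apply: c_D; last by apply: (c_M c_ri); exact: (c_M c_ri c_ri).
  by apply: c_D => //; apply: c_M => //; exact: (c_M c_ri c_ri).
have -> : (\int[mu]_x ((expR (- lam * rho x) / rho x)%:E * (normal_pdf 0 1 x)%:E) =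
   (normal_peak 1)%:E * \int[mu]_x (k x)%:E)%E.
  rewrite -ge0_integralZl//; last by move=> x _; rewrite lee_fin.
  by apply: eq_integral => x _; rewrite mulrC; exact: (pw ri).
have -> : (\int[mu]_x ((x ^+ 2 * ((rho x)^-1 + lam * (rho x)^-1 ^+ 2 + (rho x)^-1 ^+ 3) *
     expR (- lam * rho x))%:E * (normal_pdf 0 1 x)%:E) =
   (normal_peak 1)%:E * \int[mu]_x (h x)%:E)%E.
  rewrite -ge0_integralZl//; last by move=> x _; rewrite lee_fin.
  apply: eq_integral => x _; exact: (pw (fun x => x ^+ 2 * (ri x + lam * ri x ^+ 2 + ri x ^+ 3))).
apply: lee_wpmul2l; first by rewrite lee_fin.
exact: stein_lebesgue.
Qed.

End stein.

Lemma measurable_inv_pos (R : realType) (d : measure_display) (T : measurableType d)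
    (f : T -> R) : measurable_fun setT f -> (forall t, 0 < f t) ->
  measurable_fun setT (fun t => (f t)^-1).
Proof.
move=> mf f0; have -> : (fun t => (f t)^-1) = (fun t => f t `^ (- 1)).
  by apply/funext => t; rewrite powR_inv1// ltW.
exact: (measurableT_comp (measurable_powR _)).
Qed.

Lemma measurable_sqrt (R : realType) (d : measure_display) (T : measurableType d)
    (f : T -> R) : measurable_fun setT f ->
  measurable_fun setT (fun t => Num.sqrt (f t)).
Proof.
move=> mf; apply: (measurableT_comp (f := Num.sqrt : R -> R)) => //.
by apply: continuous_measurable_fun; exact: sqrt_continuous.
Qed.

(** * The norm of a standard Gaussian vector *)

Section chi.
Context {R : realType} (n : nat).
Local Notation gauss := (normal_prob (0 : R) 1).
Local Open Scope ereal_scope.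
Implicit Types (y z : 'I_n -> R).

Definition ebases (l : seq 'I_n) : seq ('I_n -> R) := [seq ebase i | i <- l].

Definition std_gauss_ex (f : ('I_n -> R) -> \bar R) : \bar R :=
  gauss_ex (ebases (enum 'I_n)) f (fun=> 0%R).

Definition sqnorm y : R := (\sum_i y i ^+ 2)%R.

Lemma sqnorm_ge0 y : (0 <= sqnorm y)%R.
Proof. by rewrite sumr_ge0// => i _; exact: sqr_ge0. Qed.

Lemma measurable_sqnorm (d : measure_display) (T : measurableType d) (c : T -> 'I_n -> R) :
  (forall i, measurable_fun setT (fun t => c t i)) ->
  measurable_fun setT (fun t => sqnorm (c t)).
Proof.
by move=> mc; apply: measurable_sum => i; exact: measurable_funX.
Qed.

Lemma sqnorm_vshift y i (x : R) : y i = 0%R ->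
  sqnorm (vshift y (ebase i) x) = (x ^+ 2 + sqnorm y)%R.
Proof.
move=> yi; rewrite /sqnorm (bigD1 i)//= [in RHS](bigD1 i)//= yi expr0n add0r.
rewrite /vshift /ebase eqxx yi add0r mulr1; congr (_ + _)%R.
by apply: eq_bigr => j ji; rewrite (negbTE ji) mulr0 addr0.
Qed.

Lemma vshift_ebase0 y i j (x : R) : i != j -> y i = 0%R -> vshift y (ebase j) x i = 0%R.
Proof. by move=> ij yi; rewrite /vshift /ebase (negbTE ij) mulr0 addr0. Qed.

Lemma le_gauss_ex_ebases l i f g z : i \notin l -> coord_meas f -> coord_meas g ->
  z i = 0%R -> (forall y, y i = 0%R -> f y <= g y) ->
  gauss_ex (ebases l) f z <= gauss_ex (ebases l) g z.
Proof.
move=> + mf mg + fg; elim: l z => [|j l IH] z /=; first by move=> _; exact: fg.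
rewrite inE negb_or => /andP[ij il] zi.
apply: le_gauss_int => [x|||x]; [exact: gauss_ex_ge0| | |].
- exact: measurable_gauss_ex.
- exact: measurable_gauss_ex.
- by apply: IH => //; exact: vshift_ebase0.
Qed.

(** Integrating coordinate i innermost freezes the others, so the one-dimensional Stein inequality
    applies with their squares inside [q0]. *)
Lemma gauss_ex_last i f z : coord_meas f ->
  gauss_ex (ebases (enum 'I_n)) f z =
  gauss_ex (ebases (rem i (enum 'I_n))) (gauss_ex [:: ebase i] f) z.
Proof.
move=> mf; rewrite -gauss_ex_cat; apply: gauss_ex_cov => // j k.
have gE l : (gcov (ebases l) j k = \sum_(t <- l) ebase t j * ebase t k)%R.
  by rewrite /gcov big_map.
rewrite gcov_cat gcov_cons [gcov [::] _ _]/gcov big_nil addr0 !gE.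
have ie : i \in enum 'I_n by rewrite mem_enum.
by rewrite (perm_big _ (perm_to_rem ie))/= big_cons addrC.
Qed.

Lemma gauss_ex_sum (s : seq ('I_n -> R)) (r : seq 'I_n) (F : 'I_n -> ('I_n -> R) -> \bar R) z :
  (forall i, coord_meas (F i)) ->
  coord_meas (fun y => \sum_(i <- r) F i y) /\
  gauss_ex s (fun y => \sum_(i <- r) F i y) z = \sum_(i <- r) gauss_ex s (F i) z.
Proof.
move=> mF; elim: r => [|i r [IH1 IH2]].
  split; first by under eq_fun do rewrite big_nil; exact: coord_meas_cst.
  by under eq_fun do rewrite big_nil; rewrite gauss_ex_cst big_nil.
have E : (fun y => \sum_(j <- i :: r) F j y) = (fun y => F i y + \sum_(j <- r) F j y).
  by apply/funext => y; rewrite big_cons.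
by rewrite E big_cons -IH2; split; [exact: coord_measD|exact: gauss_exD].
Qed.

Lemma gauss_ex_sqnorm_mgf (th : R) : (0 <= th < 1 / 2)%R ->
  std_gauss_ex (fun y => (expR (th * sqnorm y))%:E) =
  (((Num.sqrt (1 - 2 * th))^-1) ^+ n)%:E.
Proof.
move=> th01; set q := (_^-1)%R; pose F y := (expR (th * sqnorm y))%:E.
have mF : coord_meas F.
  apply: coord_meas_EFin => [y|d T c mc]; first exact: expR_ge0.
  apply: measurableT_comp => //; apply: measurable_funM => //.
  exact: measurable_sqnorm.
suff H l z : uniq l -> (forall i, i \in l -> z i = 0%R) ->
    gauss_ex (ebases l) F z = (q ^+ size l)%:E * F z.
  rewrite /std_gauss_ex H ?enum_uniq// -cardE card_ord /F.
  have -> : sqnorm (fun=> 0%R) = 0%R.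
    by rewrite /sqnorm big1// => i _; rewrite expr0n.
  by rewrite mulr0 expR0 mule1.
elim: l z => [|i l IH] z /=; first by rewrite expr0 mul1e.
move=> /andP[il ul] zl.
have zi : z i = 0%R by rewrite zl// inE eqxx.
transitivity (\int[gauss]_x (((q ^+ size l)%:E * F z) * (expR (th * x ^+ 2))%:E)).
  apply: eq_integral => x _; rewrite IH//.
    by rewrite /F sqnorm_vshift// mulrDr expRD EFinM -muleA [X in _ * X]muleC.
  move=> j jl; apply: vshift_ebase0; first by apply: contraNneq il => <-.
  by rewrite zl// inE jl orbT.
rewrite ge0_integralZl//.
- rewrite gauss_mgf_sqr// exprS -/q EFinM muleC -!muleA; congr (_ * _).
- by apply/measurable_EFinP; apply: measurableT_comp => //; apply: measurable_funM => //.
- by rewrite mule_ge0 ?lee_fin ?expR_ge0// exprn_ge0// invr_ge0 sqrtr_ge0.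
Qed.

Lemma chi_mgf_upper (lam : R) : (0 < n)%N -> (0 < lam)%R ->
  std_gauss_ex (fun y => (expR (lam * Num.sqrt (sqnorm y)))%:E) <=
  (expR (lam * Num.sqrt n%:R + lam ^+ 2 / 2))%:E.
Proof.
move=> n0 lam0; set rn := Num.sqrt n%:R.
have rn0 : (0 < rn)%R by rewrite sqrtr_gt0 ltr0n.
have rn2 : (rn ^+ 2 = n%:R)%R by rewrite sqr_sqrtr.
(* The norm v is linearized by lam v <= lam c / 2 + lam v^2 / (2 c). This c turns the factor of each
   coordinate into sqrt (1 + lam / rn) <= exp (lam / (2 rn)), and the exponents add up to the stated
   one. *)
pose c := (rn + lam)%R; have c0 : (0 < c)%R by rewrite addr_gt0.
pose th := (lam / (2 * c))%R.
have th0 : (0 <= th)%R by rewrite divr_ge0 ?ltW// mulr_gt0.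
have th1 : (1 - 2 * th = rn / c)%R by rewrite /th /c; field; rewrite gt_eqF.
have th2 : (th < 1 / 2)%R.
  have : (0 < rn / c)%R by rewrite divr_gt0.
  by rewrite -th1; lra.
pose F y := (expR (th * sqnorm y))%:E.
have mF : coord_meas F.
  apply: coord_meas_EFin => [y|d T cc mc]; first exact: expR_ge0.
  by apply: measurableT_comp => //; apply: measurable_funM => //; exact: measurable_sqnorm.
apply: (@le_trans _ _ (std_gauss_ex (fun y => (expR (lam * c / 2))%:E * F y))).
  apply: le_gauss_ex.
  - apply: coord_meas_EFin => [y|d T cc mc]; first exact: expR_ge0.
    apply: measurableT_comp => //; apply: measurable_funM => //.
    by apply: measurable_sqrt; exact: measurable_sqnorm.
  - by apply: coord_measM => //; apply: coord_meas_cst; exact: expR_ge0.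
  - move=> y; rewrite -EFinM lee_fin -expRD ler_expR /th.
    have : (Num.sqrt (sqnorm y) ^+ 2 = sqnorm y)%R by rewrite sqr_sqrtr// sqnorm_ge0.
    set v := Num.sqrt _ => <-.
    have -> : (lam * c / 2 + lam / (2 * c) * v ^+ 2 = lam * v + lam / (2 * c) * (v - c) ^+ 2)%R.
      by field; rewrite gt_eqF.
    by rewrite lerDl mulr_ge0 ?sqr_ge0// divr_ge0 ?ltW// mulr_gt0.
rewrite /std_gauss_ex gauss_exZ ?expR_ge0// -/(std_gauss_ex F) gauss_ex_sqnorm_mgf ?th0//.
rewrite -EFinM lee_fin th1.
have x1 : (1 + lam / rn <= expR (lam / rn))%R by exact: expR_ge1Dx.
have -> : ((Num.sqrt (rn / c))^-1 = Num.sqrt (1 + lam / rn))%R.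
  rewrite -sqrtrV ?divr_ge0 ?ltW//; congr Num.sqrt.
  by rewrite /c; field; rewrite !gt_eqF.
have h1 : (Num.sqrt (1 + lam / rn) <= expR (lam / rn / 2))%R.
  rewrite -(@ler_pXn2r _ 2)// ?nnegrE ?sqrtr_ge0 ?expR_ge0//.
  rewrite sqr_sqrtr; last by rewrite addr_ge0// divr_ge0// ltW.
  by rewrite -expRM_natr divfK.
apply: (@le_trans _ _ (expR (lam * c / 2) * expR (lam / rn / 2) ^+ n)%R).
  rewrite ler_wpM2l ?expR_ge0//; apply: lerXn2r => //; rewrite nnegrE ?sqrtr_ge0 ?expR_ge0//.
rewrite -expRM_natr -expRD ler_expR -rn2 /c le_eqVlt; apply/orP; left; apply/eqP.
by field; rewrite gt_eqF.
Qed.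

Section lower.
Variable q0 : R.
Hypothesis q00 : (0 < q0)%R.
Let rho y : R := Num.sqrt (sqnorm y + q0).
Let rho_gt0 y : (0 < rho y)%R.
Proof. by rewrite sqrtr_gt0 ltr_wpDl// sqnorm_ge0. Qed.
Let rho2 y : (rho y ^+ 2 = sqnorm y + q0)%R.
Proof. by rewrite sqr_sqrtr// addr_ge0 ?sqnorm_ge0// ltW. Qed.

Let e (lam : R) y : R := expR (- lam * rho y).
Let e_gt0 lam y : (0 < e lam y)%R. Proof. exact: expR_gt0. Qed.

Let m_rho (d : measure_display) (T : measurableType d) (c : T -> 'I_n -> R) :
  (forall i, measurable_fun setT (fun t => c t i)) ->
  measurable_fun setT (fun t => rho (c t)).
Proof.
by move=> mc; apply: measurable_sqrt; apply: measurable_funD => //; exact: measurable_sqnorm.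
Qed.
Let m_e lam (d : measure_display) (T : measurableType d) (c : T -> 'I_n -> R) :
  (forall i, measurable_fun setT (fun t => c t i)) ->
  measurable_fun setT (fun t => e lam (c t)).
Proof.
by move=> mc; apply: measurableT_comp => //; apply: measurable_funM => //; exact: m_rho.
Qed.
Let m_ri (d : measure_display) (T : measurableType d) (c : T -> 'I_n -> R) :
  (forall i, measurable_fun setT (fun t => c t i)) ->
  measurable_fun setT (fun t => (rho (c t))^-1%R).
Proof. by move=> mc; apply: measurable_inv_pos => //; exact: m_rho. Qed.

Let cm_e lam : coord_meas (fun y => (e lam y)%:E).
Proof. by apply: coord_meas_EFin => [y|d T c mc]; [exact: ltW|exact: m_e]. Qed.
Let cm_re lam : coord_meas (fun y => (rho y * e lam y)%:E).
Proof.
apply: coord_meas_EFin => [y|d T c mc]; first by rewrite mulr_ge0 ?ltW.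
by apply: measurable_funM; [exact: m_rho|exact: m_e].
Qed.
Let cm_ie lam : coord_meas (fun y => (e lam y / rho y)%:E).
Proof.
apply: coord_meas_EFin => [y|d T c mc]; first by rewrite divr_ge0 ?ltW.
by apply: measurable_funM; [exact: m_e|exact: m_ri].
Qed.
Let H (lam : R) i y : R :=
  (y i ^+ 2 * ((rho y)^-1 + lam * (rho y)^-1 ^+ 2 + (rho y)^-1 ^+ 3) * e lam y)%R.
Let cm_H lam i : (0 <= lam)%R -> coord_meas (fun y => (H lam i y)%:E).
Proof.
move=> lam0; apply: coord_meas_EFin => [y|d T c mc].
  have r0 : (0 <= (rho y)^-1)%R by rewrite invr_ge0 ltW.
  rewrite mulr_ge0 ?(ltW (e_gt0 _ _))// mulr_ge0 ?sqr_ge0//.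
  by rewrite !addr_ge0// ?mulr_ge0 ?exprn_ge0 ?sqr_ge0.
apply: measurable_funM; last exact: m_e.
apply: measurable_funM; first exact: measurable_funX.
apply: measurable_funD; last by apply: measurable_funX; exact: m_ri.
apply: measurable_funD; first exact: m_ri.
by apply: measurable_funM => //; apply: measurable_funX; exact: m_ri.
Qed.

Let stein_coord lam i : (0 <= lam)%R ->
  std_gauss_ex (fun y => (e lam y / rho y)%:E) <= std_gauss_ex (fun y => (H lam i y)%:E).
Proof.
move=> lam0; rewrite /std_gauss_ex !(gauss_ex_last i)//; last exact: cm_H.
apply: (@le_gauss_ex_ebases _ i) => //.
- by rewrite mem_rem_uniq ?enum_uniq// inE eqxx.
- by apply: coord_meas_gauss_ex.
- by apply: coord_meas_gauss_ex; exact: cm_H.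
move=> y yi /=.
have qy : (0 < sqnorm y + q0)%R by rewrite ltr_wpDl// sqnorm_ge0.
have rE (x : R) : rho (vshift y (ebase i) x) = Num.sqrt (x ^+ 2 + (sqnorm y + q0)).
  by rewrite /rho sqnorm_vshift// addrA.
have E1 (x : R) : (e lam (vshift y (ebase i) x) / rho (vshift y (ebase i) x) =
    expR (- lam * Num.sqrt (x ^+ 2 + (sqnorm y + q0))) / Num.sqrt (x ^+ 2 + (sqnorm y + q0)))%R.
  by rewrite /e rE.
have E2 (x : R) : H lam i (vshift y (ebase i) x) =
   (let r := Num.sqrt (x ^+ 2 + (sqnorm y + q0)) in
   x ^+ 2 * (r^-1 + lam * r^-1 ^+ 2 + r^-1 ^+ 3) * expR (- lam * r))%R.
  by rewrite /H /e rE /vshift /ebase eqxx yi add0r mulr1.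
under eq_integral do rewrite E1.
under [leRHS]eq_integral do rewrite E2.
exact: stein_ineq lam0 qy.
Qed.

Let bounded_fin (f : ('I_n -> R) -> R) (r : R) : coord_meas (fun y => (f y)%:E) ->
  (forall y, (f y <= r)%R) -> std_gauss_ex (fun y => (f y)%:E) \is a fin_num.
Proof.
move=> mf fr; rewrite ge0_fin_numE; last exact: gauss_ex_ge0.
apply: (@le_lt_trans _ _ r%:E); last exact: ltry.
rewrite -[leRHS](gauss_ex_cst (ebases (enum 'I_n)) r%:E (fun=> 0%R)).
apply: le_gauss_ex => //.
  apply: coord_meas_cst; have := mf.1 (fun=> 0%R); rewrite lee_fin => /le_trans; exact.
Qed.

(** Moments of exp (- lam rho) with weights 1, rho and 1 / rho. Formally M' = - S, so a lower bound
    of S by M is a differential inequality; [K] is an intermediate to be eliminated. *)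
Let M lam := fine (std_gauss_ex (fun y => (e lam y)%:E)).
Let S lam := fine (std_gauss_ex (fun y => (rho y * e lam y)%:E)).
Let K lam := fine (std_gauss_ex (fun y => (e lam y / rho y)%:E)).

Let ME lam : (0 <= lam)%R -> std_gauss_ex (fun y => (e lam y)%:E) = (M lam)%:E.
Proof.
move=> l0; rewrite /M fineK//; apply: (@bounded_fin _ 1%R) => // y.
by rewrite -expR0 ler_expR mulNr oppr_le0 mulr_ge0// ltW.
Qed.
Let SE lam : (0 < lam)%R -> std_gauss_ex (fun y => (rho y * e lam y)%:E) = (S lam)%:E.
Proof.
move=> l0; rewrite /S fineK//; apply: (@bounded_fin _ lam^-1%R) => // y.
rewrite /e mulNr expRN ler_pdivrMr ?expR_gt0// ler_pdivlMl//.
by rewrite (le_trans _ (expR_ge1Dx _))// lerDr.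
Qed.
Let KE lam : (0 <= lam)%R -> std_gauss_ex (fun y => (e lam y / rho y)%:E) = (K lam)%:E.
Proof.
move=> l0; rewrite /K fineK//; apply: (@bounded_fin _ (Num.sqrt q0)^-1%R) => // y.
rewrite -[leRHS]mul1r ler_pM ?invr_ge0 ?(ltW (rho_gt0 _)) ?(ltW (e_gt0 _ _))//.
  by rewrite -expR0 ler_expR mulNr oppr_le0 mulr_ge0// ltW.
by rewrite /rho lef_pV2 ?posrE ?sqrtr_gt0 ?ltr_wpDl ?sqnorm_ge0// ler_wsqrtr// lerDr sqnorm_ge0.
Qed.

Let std_exZ (k : R) (f : ('I_n -> R) -> R) : (0 <= k)%R -> coord_meas (fun y => (f y)%:E) ->
  std_gauss_ex (fun y => (k * f y)%:E) = k%:E * std_gauss_ex (fun y => (f y)%:E).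
Proof. by move=> k0 mf; rewrite /std_gauss_ex -gauss_exZ. Qed.

Let std_exD (f g : ('I_n -> R) -> R) :
  coord_meas (fun y => (f y)%:E) -> coord_meas (fun y => (g y)%:E) ->
  std_gauss_ex (fun y => (f y + g y)%:E) =
  std_gauss_ex (fun y => (f y)%:E) + std_gauss_ex (fun y => (g y)%:E).
Proof. by move=> mf mg; rewrite /std_gauss_ex -gauss_exD. Qed.

Let cmZ (k : R) (f : ('I_n -> R) -> R) : (0 <= k)%R -> coord_meas (fun y => (f y)%:E) ->
  coord_meas (fun y => (k * f y)%:E).
Proof.
move=> k0 mf; have := coord_measM (coord_meas_cst k0) mf.
by under eq_fun do rewrite -EFinM.
Qed.

Let cmD (f g : ('I_n -> R) -> R) :
  coord_meas (fun y => (f y)%:E) -> coord_meas (fun y => (g y)%:E) ->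
  coord_meas (fun y => (f y + g y)%:E).
Proof. by move=> mf mg; have := coord_measD mf mg; under eq_fun do rewrite -EFinD. Qed.

Let exE_SMK (x y z lam : R) : (0 < lam)%R -> (0 <= x)%R -> (0 <= y)%R -> (0 <= z)%R ->
  std_gauss_ex (fun u => (x * (rho u * e lam u) + (y * e lam u + z * (e lam u / rho u)))%:E) =
  (x * S lam + (y * M lam + z * K lam))%:E.
Proof.
move=> l0 x0 y0 z0; have l0' := ltW l0.
have m1 := cmZ x0 (cm_re lam); have m2 := cmZ y0 (cm_e lam); have m3 := cmZ z0 (cm_ie lam).
rewrite (std_exD m1 (cmD m2 m3)) (std_exD m2 m3).
rewrite (std_exZ x0 (cm_re lam)) (std_exZ y0 (cm_e lam)) (std_exZ z0 (cm_ie lam)).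
by rewrite SE// ME// KE// -!EFinM -!EFinD.
Qed.

Let cm_SMK (x y z lam : R) : (0 <= x)%R -> (0 <= y)%R -> (0 <= z)%R ->
  coord_meas (fun u => (x * (rho u * e lam u) + (y * e lam u + z * (e lam u / rho u)))%:E).
Proof.
move=> x0 y0 z0; apply: (cmD (cmZ x0 (cm_re lam))).
exact: (cmD (cmZ y0 (cm_e lam)) (cmZ z0 (cm_ie lam))).
Qed.

(** Stein's inequality summed over the coordinates: the squares x_i^2 add up to at most rho^2. *)
Let key1 lam : (0 < lam)%R -> (n%:R * K lam <= S lam + lam * M lam + K lam)%R.
Proof.
move=> l0; have l0' := ltW l0.
rewrite -lee_fin.
have -> : (S lam + lam * M lam + K lam = 1 * S lam + (lam * M lam + 1 * K lam))%R by ring.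
rewrite -(exE_SMK l0 ler01 l0' ler01).
apply: (@le_trans _ _ (\sum_(i <- enum 'I_n) std_gauss_ex (fun y => (H lam i y)%:E))).
  have -> : (n%:R * K lam)%:E =
     \sum_(i <- enum 'I_n) std_gauss_ex (fun y => (e lam y / rho y)%:E).
    by rewrite KE// sumEFin big_enum /= sumr_const card_ord mulr_natl.
  by apply: lee_sum => i _; exact: stein_coord.
have [cms <-] := gauss_ex_sum (ebases (enum 'I_n)) (enum 'I_n) (fun=> 0%R) (fun i => cm_H i l0').
apply: le_gauss_ex => //; first exact: cm_SMK.
move=> y; rewrite sumEFin lee_fin /H -mulr_suml -mulr_suml big_enum /= -/(sqnorm y).
have -> : (1 * (rho y * e lam y) + (lam * e lam y + 1 * (e lam y / rho y)) =
    (rho y + lam + (rho y)^-1) * e lam y)%R by ring.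
rewrite ler_wpM2r ?(ltW (e_gt0 _ _))//.
have -> : (rho y + lam + (rho y)^-1 = rho y ^+ 2 * ((rho y)^-1 + lam * (rho y)^-1 ^+ 2 + (rho y)^-1 ^+ 3))%R.
  by field; rewrite gt_eqF.
have r0 : (0 <= (rho y)^-1)%R by rewrite invr_ge0 ltW.
rewrite ler_wpM2r//; last by rewrite rho2 lerDl ltW.
by rewrite !addr_ge0// ?mulr_ge0 ?exprn_ge0 ?sqr_ge0.
Qed.

(** Expectation of (rho - c)^2 / rho >= 0. *)
Let key2 lam (c : R) : (0 < lam)%R -> (0 < c)%R -> (2 * c * M lam <= c ^+ 2 * K lam + S lam)%R.
Proof.
move=> l0 c0; have l0' := ltW l0.
have c2 : (0 <= 2 * c)%R by lra.
have cc : (0 <= c ^+ 2)%R by exact: sqr_ge0.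
suff : std_gauss_ex (fun u => (0 * (rho u * e lam u) + (2 * c * e lam u + 0 * (e lam u / rho u)))%:E) <=
       std_gauss_ex (fun u => (1 * (rho u * e lam u) + (0 * e lam u + c ^+ 2 * (e lam u / rho u)))%:E).
  by rewrite !exE_SMK// lee_fin; lra.
apply: le_gauss_ex; [exact: cm_SMK|exact: cm_SMK|move=> y].
rewrite lee_fin -subr_ge0.
have -> : (1 * (rho y * e lam y) + (0 * e lam y + c ^+ 2 * (e lam y / rho y)) -
   (0 * (rho y * e lam y) + (2 * c * e lam y + 0 * (e lam y / rho y))) =
   (rho y - c) ^+ 2 * (e lam y / rho y))%R by field; rewrite gt_eqF.
by rewrite mulr_ge0 ?sqr_ge0// divr_ge0 ?ltW.
Qed.

(** The choice c^2 = n - 1 eliminates K between the two preceding inequalities. *)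
Let key lam : (1 < n)%N -> (0 < lam)%R ->
  ((Num.sqrt (n%:R - 1) - lam / 2) * M lam <= S lam)%R.
Proof.
move=> n1 l0; set c := Num.sqrt _.
have n1' : (0 < n%:R - 1 :> R)%R by rewrite subr_gt0 ltr1n.
have c0 : (0 < c)%R by rewrite sqrtr_gt0.
have c2 : (c ^+ 2 = n%:R - 1)%R by rewrite sqr_sqrtr// ltW.
have := key1 l0; have := key2 l0 c0; rewrite c2; nra.
Qed.

(** A Gronwall step without derivatives: exp u >= 1 + u at u = dl (rho - m) bounds [M lam] from
    below by moments at lam + dl, and [key] cancels the linear term. *)
Let chi_step lam dl : (1 < n)%N -> (0 <= lam)%R -> (0 < dl)%R ->
  (lam + dl <= 2 * Num.sqrt (n%:R - 1))%R ->
  (M (lam + dl) <= expR (- dl * (Num.sqrt (n%:R - 1) - (lam + dl) / 2)) * M lam)%R.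
Proof.
move=> n1 l0 d0; set c := Num.sqrt _ => lc; set m := (c - _)%R; set mu := (lam + dl)%R.
have mu0 : (0 < mu)%R by rewrite /mu; lra.
have m0 : (0 <= m)%R by rewrite /m; lra.
have x0 : (0 <= expR (dl * m) * dl)%R by rewrite mulr_ge0 ?expR_ge0 ?ltW.
have z0 : (0 <= expR (dl * m) * (dl * m))%R by rewrite mulr_ge0 ?expR_ge0// mulr_ge0// ltW.
have := key n1 mu0; rewrite -/c -/m => k0.
suff hS : (expR (dl * m) * dl * S mu + expR (dl * m) * M mu <=
    expR (dl * m) * (dl * m) * M mu + M lam)%R.
  rewrite mulNr expRN mulrC ler_pdivlMr ?expR_gt0//.
  have : (expR (dl * m) * dl * (m * M mu) <= expR (dl * m) * dl * S mu)%R by exact: ler_wpM2l.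
  have e1 : (M mu * expR (dl * m) = expR (dl * m) * M mu)%R by rewrite mulrC.
  rewrite e1; move: hS; set E := expR _; nra.
have := exE_SMK mu0 x0 (expR_ge0 (dl * m)) (lexx 0%R); rewrite mul0r addr0 => E1.
have E2 : std_gauss_ex (fun y => (expR (dl * m) * (dl * m) * e mu y + e lam y)%:E) =
   (expR (dl * m) * (dl * m) * M mu + M lam)%:E.
  rewrite (std_exD (cmZ z0 (cm_e mu)) (cm_e lam)) (std_exZ z0 (cm_e mu)) ME ?ltW// ME//.
rewrite -lee_fin -E1 -E2; apply: le_gauss_ex.
- by apply: cm_SMK => //; exact: expR_ge0.
- exact: (cmD (cmZ z0 (cm_e mu)) (cm_e lam)).
move=> y; rewrite lee_fin mul0r addr0.
have -> : e lam y = (expR (dl * m) * expR (dl * (rho y - m)) * e mu y)%R.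
  by rewrite /e -!expRD; congr expR; rewrite /mu; ring.
have h1 : (0 <= expR (dl * (rho y - m)) - (1 + dl * (rho y - m)))%R.
  by rewrite subr_ge0 expR_ge1Dx.
have h2 : (0 <= expR (dl * m) * e mu y)%R by rewrite mulr_ge0 ?expR_ge0// ltW.
have := mulr_ge0 h1 h2; set X := expR (dl * m); set Y := e mu y; set Z := expR _; lra.
Qed.

Let chi_iter (dl : R) k : (1 < n)%N -> (0 < dl)%R ->
  (dl * k%:R <= 2 * Num.sqrt (n%:R - 1))%R ->
  (M (dl * k%:R) <= expR (- (dl * k%:R) * Num.sqrt (n%:R - 1) +
      dl ^+ 2 * k%:R * (k%:R + 1) / 4))%R.
Proof.
move=> n1 d0; set c := Num.sqrt _; elim: k => [|k IH] kc.
  rewrite !(mulr0, mul0r) oppr0 !(mul0r, addr0) expR0 -lee_fin -ME//.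
  rewrite -[leRHS](gauss_ex_cst (ebases (enum 'I_n)) 1%:E (fun=> 0%R)).
  apply: le_gauss_ex => // y.
  by rewrite /e oppr0 mul0r expR0.
have kk : (dl * k.+1%:R = dl * k%:R + dl)%R by rewrite -natr1; ring.
rewrite kk in kc *.
apply: (le_trans (chi_step n1 _ d0 kc)); first by rewrite mulr_ge0// ltW.
apply: (@le_trans _ _ (expR (- dl * (c - (dl * k%:R + dl) / 2)) * expR (- (dl * k%:R) * c +
      dl ^+ 2 * k%:R * (k%:R + 1) / 4))%R).
  by rewrite ler_wpM2l ?expR_ge0// IH//; lra.
rewrite -expRD ler_expR -natr1 le_eqVlt; apply/orP; left; apply/eqP; by field.
Qed.

Lemma chi_reg_mgf_lower (lam : R) N : (1 < n)%N -> (0 < N)%N -> (0 < lam)%R ->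
  (lam <= 2 * Num.sqrt (n%:R - 1))%R ->
  std_gauss_ex (fun y => (expR (- lam * Num.sqrt (sqnorm y)))%:E) <=
  (expR (lam * Num.sqrt q0 - lam * Num.sqrt (n%:R - 1) + lam ^+ 2 / 4 * (1 + N%:R^-1)))%:E.
Proof.
move=> n1 N0 l0 lc; set c := Num.sqrt (n%:R - 1).
have N0' : (N%:R != 0 :> R)%R by rewrite pnatr_eq0 -lt0n.
have d0 : (0 < lam / N%:R)%R by rewrite divr_gt0// ltr0n.
have h := chi_iter (k := N) n1 d0; rewrite divfK// in h.
have := h lc; rewrite -/c => {}h.
apply: (@le_trans _ _ (std_gauss_ex (fun y => (expR (lam * Num.sqrt q0) * e lam y)%:E))).
  apply: le_gauss_ex.
  - apply: coord_meas_EFin => [y|d T cc mc]; first exact: expR_ge0.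
    apply: measurableT_comp => //; apply: measurable_funM => //.
    by apply: measurable_sqrt; exact: measurable_sqnorm.
  - by apply: cmZ => //; exact: expR_ge0.
  - move=> y; rewrite lee_fin -expRD ler_expR.
    have -> : (lam * Num.sqrt q0 + - lam * rho y = lam * (Num.sqrt q0 - rho y))%R by ring.
    rewrite mulNr -mulrN ler_wpM2l ?(ltW l0)//.
    rewrite lerBrDr -lerBrDl opprK addrC.
    rewrite -(@ler_pXn2r _ 2)// ?nnegrE ?addr_ge0 ?sqrtr_ge0 ?(ltW (rho_gt0 _))//.
    rewrite rho2 sqrrD !sqr_sqrtr ?sqnorm_ge0 ?(ltW q00)//.
    have : (0 <= Num.sqrt (sqnorm y) * Num.sqrt q0)%R by rewrite mulr_ge0 ?sqrtr_ge0.
    by lra.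
rewrite (std_exZ (expR_ge0 _) (cm_e lam)) ME ?(ltW l0)// -EFinM lee_fin.
apply: (le_trans (ler_wpM2l (expR_ge0 _) h)).
rewrite -expRD ler_expR le_eqVlt; apply/orP; left; apply/eqP; field.
exact: N0'.
Qed.
End lower.

(** With sqrt q0 = 1/100 and N = 10 the claim reduces to sqrt n - sqrt (n - 1) + 1/100 <= 9 lam /
    40. For n >= 5 the left side is at most 100/423 + 1/100, and lam >= 23/20 suffices. *)
Lemma chi_mgf_lower (lam : R) : (4 < n)%N -> (23 / 20 <= lam)%R ->
  (lam <= 2 * Num.sqrt (n%:R - 1))%R ->
  std_gauss_ex (fun y => (expR (- lam * Num.sqrt (sqnorm y)))%:E) <=
  (expR (- lam * Num.sqrt n%:R + lam ^+ 2 / 2))%:E.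
Proof.
move=> n4 ll lc.
have q0 : (0 < (1 / 100) ^+ 2 :> R)%R by rewrite exprn_gt0//; lra.
have l0 : (0 < lam)%R by lra.
have n1 : (1 < n)%N by lia.
apply: (le_trans (chi_reg_mgf_lower q0 (N := 10) n1 _ l0 lc)) => //.
rewrite lee_fin ler_expR sqrtr_sqr ger0_norm; last by lra.
have n5 : (5 <= n%:R :> R)%R by rewrite (ler_nat _ 5).
have rn : (223 / 100 <= Num.sqrt n%:R :> R)%R.
  rewrite -(@ler_pXn2r _ 2)// ?nnegrE ?sqrtr_ge0// ?sqr_sqrtr//; lra.
have rn1 : (2 <= Num.sqrt (n%:R - 1) :> R)%R.
  rewrite -(@ler_pXn2r _ 2)// ?nnegrE ?sqrtr_ge0// ?sqr_sqrtr//; lra.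
have e1 : (Num.sqrt n%:R ^+ 2 = n%:R :> R)%R by rewrite sqr_sqrtr.
have e2 : (Num.sqrt (n%:R - 1) ^+ 2 = n%:R - 1 :> R)%R by rewrite sqr_sqrtr//; lra.
move: rn rn1 e1 e2 lc; set x := Num.sqrt n%:R; set y := Num.sqrt _ => rn rn1 e1 e2 lc.
have h : ((x - y) * (x + y) = 1)%R by nra.
have h2 : (x - y <= 100 / 423)%R.
  rewrite leNgt; apply/negP => h3.
  have : (100 / 423 * (423/100) < (x - y) * (x + y))%R by apply: ltr_pM; lra.
  by rewrite h; lra.
have : (0 <= lam * (lam * (9/40) - (x - y) - 1/100))%R by rewrite mulr_ge0 ?ltW//; lra.
by lra.
Qed.
End chi.

(** * Nets *)

Section norm2_theory.
Context {R : realType} {n : nat}.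
Implicit Types u v w : 'cV[R]_n.

Lemma norm2_sqr u : norm2 u ^+ 2 = dotcv u u.
Proof.
rewrite /norm2 sqr_sqrtr; last by apply: sumr_ge0 => i _; exact: sqr_ge0.
by rewrite dotcvE; apply: eq_bigr => i _; rewrite expr2.
Qed.

Lemma norm2_ge0 u : 0 <= norm2 u. Proof. exact: sqrtr_ge0. Qed.

Lemma norm2E u : norm2 u = Num.sqrt (dotcv u u).
Proof. by rewrite -norm2_sqr sqrtr_sqr ger0_norm// norm2_ge0. Qed.

Lemma norm2_eq0 u : (norm2 u == 0) = (u == 0).
Proof. by rewrite -dotcv_eq0 -norm2_sqr sqrf_eq0. Qed.

Lemma norm2Z (a : R) u : norm2 (a *: u) = `|a| * norm2 u.
Proof.
apply/eqP; rewrite -(@eqrXn2 _ 2)// ?norm2_ge0// ?mulr_ge0 ?norm2_ge0//.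
by rewrite exprMn !norm2_sqr dotcvZr dotcvZl real_normK ?num_real// expr2 mulrA.
Qed.

Lemma norm2N u : norm2 (- u) = norm2 u.
Proof. by rewrite -scaleN1r norm2Z normrN1 mul1r. Qed.

Lemma cauchy_schwarz u v : dotcv u v <= norm2 u * norm2 v.
Proof.
have [->|u0] := eqVneq u 0.
  by rewrite dotcvC dotcv0r mulr_ge0 ?norm2_ge0.
have nu : 0 < norm2 u by rewrite lt_neqAle eq_sym norm2_eq0 u0 norm2_ge0.
have := dotcv_ge0 (norm2 v *: u - norm2 u *: v).
rewrite !(dotcvBr, dotcvBl, dotcvZr, dotcvZl) -!norm2_sqr (dotcvC v u).
have := norm2_ge0 v; set x := norm2 u; set y := norm2 v; set z := dotcv u v => y0 h.
have [y00|y1] := eqVneq y 0.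
  have /eqP : norm2 v = 0 by [].
  by rewrite norm2_eq0 /z => /eqP ->; rewrite dotcv0r mulr_ge0 ?norm2_ge0.
have y2 : 0 < y by rewrite lt_neqAle eq_sym y1.
have {}h : 0 <= (x * y) * (2 * (x * y - z)) by move: h; lra.
by rewrite pmulr_rge0 ?mulr_gt0// pmulr_rge0// subr_ge0 in h.
Qed.

Lemma norm2D u v : norm2 (u + v) <= norm2 u + norm2 v.
Proof.
rewrite -(@ler_pXn2r _ 2)// ?nnegrE ?addr_ge0 ?norm2_ge0//.
rewrite norm2_sqr !(dotcvDr, dotcvDl) -!norm2_sqr (dotcvC v u).
by have := cauchy_schwarz u v; lra.
Qed.

Lemma norm2B u v : norm2 u - norm2 v <= norm2 (u - v).
Proof. by have := norm2D (u - v) v; rewrite subrK; lra. Qed.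

End norm2_theory.

Lemma norm2_mulmx_bounded (R : realType) (m n : nat) (B : 'M[R]_(m, n)) :
  exists2 D : R, 0 <= D & forall u, norm2 (B *m u) <= D * norm2 u.
Proof.
exists (Num.sqrt (\sum_i norm2 (row i B)^T ^+ 2)) => [|u]; first exact: sqrtr_ge0.
have S0 : 0 <= \sum_i norm2 (row i B)^T ^+ 2 by apply: sumr_ge0 => i _; exact: sqr_ge0.
rewrite -(@ler_pXn2r _ 2)// ?nnegrE ?mulr_ge0 ?norm2_ge0 ?sqrtr_ge0//.
rewrite norm2_sqr dotcvE exprMn sqr_sqrtr// mulr_suml; apply: ler_sum => i _.
have -> : (B *m u) i 0 = dotcv (row i B)^T u.
  by rewrite dotcvE mxE; apply: eq_bigr => j _; rewrite !mxE.
set x := (row i B)^T; rewrite -expr2 -exprMn -(real_normK (num_real (dotcv _ _))).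
rewrite lerXn2r ?nnegrE ?mulr_ge0 ?norm2_ge0//.
rewrite ler_norml cauchy_schwarz andbT lerNl -dotcvNr -[in leRHS](norm2N u).
exact: cauchy_schwarz.
Qed.

Section sphere_net.
Context {R : realType} {n : nat}.
Implicit Types u v : 'cV[R]_n.

Definition sphere_net (J : finType) (U : J -> 'cV[R]_n) (delta : R) : Prop :=
  (forall j, norm2 (U j) = 1) /\
  forall u, norm2 u = 1 -> exists j, norm2 (u - U j) <= delta.

(** The cube is cut into cells of side 1 / N, and a unit vector is picked in each cell that has one,
    so the net lies on the sphere. Two unit vectors of one cell are within sqrt n / N. The
    coordinate value 1 has index 2 N, hence 2 N + 1 indices. *)
Lemma sphere_net_exists (delta : R) : (0 < n)%N -> 0 < delta ->
  exists (J : finType) (U : J -> 'cV[R]_n), sphere_net U delta.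
Proof.
move=> n0 d0.
have [N N0 Nd] : exists2 N : nat, (0 < N)%N & n%:R / N%:R ^+ 2 <= delta ^+ 2.
  pose x := Num.sqrt n%:R / delta.
  exists (Num.truncn x).+1 => //.
  have x0 : 0 <= x by rewrite divr_ge0 ?sqrtr_ge0 ?ltW.
  have h : x <= (Num.truncn x).+1%:R by apply: ltW; exact: truncnS_gt.
  rewrite ler_pdivrMr ?exprn_gt0 ?ltr0n// -exprMn -[leLHS](@sqr_sqrtr _ n%:R)//.
  rewrite lerXn2r ?nnegrE ?sqrtr_ge0 ?mulr_ge0 ?(ltW d0)//.
  by move: h; rewrite /x ler_pdivrMr// mulrC.
pose cell u : {ffun 'I_n -> 'I_(2 * N).+1} :=
  [ffun i => inord (Num.truncn ((u i 0 + 1) * N%:R))].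
pose e1 : 'cV[R]_n := \col_i (i == Ordinal n0)%:R.
have e1n : norm2 e1 = 1.
  rewrite norm2E dotcvE (bigD1 (Ordinal n0))//= !mxE eqxx mulr1 big1 ?addr0 ?sqrtr1//.
  by move=> i ii; rewrite !mxE (negbTE ii) mulr0.
pose U j := xget e1 [set u | norm2 u = 1 /\ cell u = j].
exists {ffun 'I_n -> 'I_(2 * N).+1}, U; split => [j|u u1].
  by rewrite /U; case: xgetP => [v _ []|_].
exists (cell u).
have [Un Uc] : norm2 (U (cell u)) = 1 /\ cell (U (cell u)) = cell u.
  by rewrite /U; case: xgetP => [v _ []//|/(_ u)[]].
set v := U _ in Un Uc *.
have bnd (w : 'cV[R]_n) i : norm2 w = 1 -> 0 <= (w i 0 + 1) * N%:R < (2 * N).+1%:R.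
  move=> w1; have : w i 0 ^+ 2 <= 1.
    have := norm2_sqr w; rewrite w1 expr1n => ->; rewrite dotcvE (bigD1 i)//= expr2 lerDl.
    by apply: sumr_ge0 => j _; rewrite -expr2 sqr_ge0.
  move=> h; have h1 : -1 <= w i 0 <= 1 by rewrite -ler_norml -sqrtr_sqr -sqrtr1 ler_wsqrtr.
  rewrite mulr_ge0 ?ler0n//=; last by move: h1 => /andP[]; lra.
  rewrite -natr1 natrM ltr_pwDr//; apply: ler_wpM2r => //; move: h1 => /andP[]; lra.
have dif i : (u i 0 - v i 0) ^+ 2 <= (N%:R^-1) ^+ 2.
  have := Uc => /ffunP/(_ i)/(congr1 val); rewrite !ffunE /=.
  have /andP[a1 a2] := bnd u i u1; have /andP[b1 b2] := bnd v i Un.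
  rewrite !inordK; last 2 first.
  - by rewrite -(ltr_nat R) (le_lt_trans _ a2)// truncn_le.
  - by rewrite -(ltr_nat R) (le_lt_trans _ b2)// truncn_le.
  move=> e; have := truncn_itv a1; have := truncn_itv b1; rewrite e.
  move: (Num.truncn _) => k /andP[k1 k2] /andP[k3 k4]; rewrite -natr1 in k2 k4.
  have NR : 0 < N%:R :> R by rewrite ltr0n.
  have : `|(u i 0 - v i 0) * N%:R| <= 1.
    by rewrite ler_norml; apply/andP; split; lra.
  rewrite -real_normK ?num_real// => h; rewrite lerXn2r ?nnegrE// ?invr_ge0 ?ler0n//.
  by move: h; rewrite normrM (ger0_norm (ltW NR)) -ler_pdivlMr// mul1r.
rewrite -(@ler_pXn2r _ 2)// ?nnegrE ?norm2_ge0 ?(ltW d0)//.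
apply: le_trans Nd; rewrite norm2_sqr dotcvE.
apply: (@le_trans _ _ (\sum_(i < n) (N%:R^-1) ^+ 2)).
  by apply: ler_sum => i _; rewrite !mxE -expr2.
by rewrite sumr_const card_ord exprVn mulr_natl.
Qed.

Lemma sphere_net_dot (J : finType) (U : J -> 'cV[R]_n) (delta : R) v :
  (0 < n)%N -> sphere_net U delta -> exists j, (1 - delta) * norm2 v <= dotcv (U j) v.
Proof.
move=> n0 [U1 Ud].
have [v0|v0] := eqVneq v 0.
  have [|j _] := Ud (\col_i (i == Ordinal n0)%:R).
    rewrite norm2E dotcvE (bigD1 (Ordinal n0))//= !mxE eqxx mulr1 big1 ?addr0 ?sqrtr1//.
    by move=> i ii; rewrite !mxE (negbTE ii) mulr0.
  by exists j; rewrite v0 dotcv0r norm2E dotcv0r sqrtr0 mulr0.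
have nv : 0 < norm2 v by rewrite lt_neqAle eq_sym norm2_eq0 v0 norm2_ge0.
have [|j jd] := Ud ((norm2 v)^-1 *: v).
  by rewrite norm2Z ger0_norm ?invr_ge0 ?norm2_ge0// mulVf// gt_eqF.
exists j; have := cauchy_schwarz ((norm2 v)^-1 *: v - U j) v.
rewrite dotcvBl dotcvZl -norm2_sqr expr2 mulrA mulVf ?gt_eqF// mul1r => h.
have := ler_wpM2r (ltW nv) jd; lra.
Qed.

End sphere_net.

(* A net argument: the largest singular value S satisfies S <= c / (1 - delta) + delta S. *)
Lemma net_norm_le (R : realType) (r s : nat) (J K : finType) (U : J -> 'cV[R]_r)
    (V : K -> 'cV[R]_s) (delta c : R) (B : 'M[R]_(s, r)) :
  (0 < r)%N -> (0 < s)%N -> 0 <= delta < 1 -> sphere_net U delta -> sphere_net V delta ->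
  (forall j k, dotcv (V k) (B *m U j) <= (1 - delta) ^+ 2 * c) ->
  forall u, norm2 (B *m u) <= c * norm2 u.
Proof.
move=> r0 s0 /andP[d0 d1] nU nV h.
have [D D0 hD] := norm2_mulmx_bounded B.
pose E := [set norm2 (B *m u) | u in [set u | norm2 u = 1]].
have Eub : ubound E D by move=> _ [u u1 <-]; rewrite -[D]mulr1 -u1.
have unit_nz : exists u0 : 'cV[R]_r, norm2 u0 = 1.
  exists (\col_i (i == Ordinal r0)%:R).
  rewrite norm2E dotcvE (bigD1 (Ordinal r0))//= !mxE eqxx mulr1 big1 ?addr0 ?sqrtr1//.
  by move=> i ii; rewrite !mxE (negbTE ii) mulr0.
have E0 : E !=set0 by have [u0 u01] := unit_nz; exists (norm2 (B *m u0)), u0.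
have supE u : norm2 (B *m u) <= sup E * norm2 u.
  have [->|u0] := eqVneq u 0; first by rewrite mulmx0 !norm2E !dotcv0r sqrtr0 mulr0.
  have nu : 0 < norm2 u by rewrite lt_neqAle eq_sym norm2_eq0 u0 norm2_ge0.
  rewrite -ler_pdivrMr//.
  have -> : norm2 (B *m u) / norm2 u = norm2 (B *m ((norm2 u)^-1 *: u)).
    by rewrite -scalemxAr norm2Z ger0_norm ?invr_ge0 ?norm2_ge0// mulrC.
  apply: ub_le_sup; first by exists D.
  exists ((norm2 u)^-1 *: u) => //=.
  by rewrite norm2Z ger0_norm ?invr_ge0 ?norm2_ge0// mulVf// gt_eqF.
have key : sup E <= (1 - delta) * c + delta * sup E.
  apply: ge_sup => // _ [u u1 <-].
  have [j uj] := nU.2 u u1.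
  have [k vk] := sphere_net_dot (B *m U j) s0 nV.
  have := norm2D (B *m U j) (B *m (u - U j)); rewrite -mulmxDr addrC subrK => hh.
  have h1 : norm2 (B *m U j) <= (1 - delta) * c.
    rewrite -(@ler_pM2l _ (1 - delta)) ?subr_gt0//.
    by apply: (le_trans vk); apply: (le_trans (h j k)); rewrite expr2 mulrA.
  have sE0 : 0 <= sup E.
    have [u0 u01] := unit_nz; have := supE u0; rewrite u01 mulr1.
    by apply: le_trans; exact: norm2_ge0.
  have h2 : norm2 (B *m (u - U j)) <= delta * sup E.
    by apply: (le_trans (supE _)); rewrite mulrC; apply: ler_wpM2r.
  by rewrite addrC in hh; apply: (le_trans hh); rewrite addrC; exact: lerD.
have key2 : sup E <= c.
  have : (1 - delta) * sup E <= (1 - delta) * c by move: key; lra.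
  by rewrite ler_pM2l ?subr_gt0.
by move=> u; apply: (le_trans (supE u)); apply: ler_wpM2r => //; exact: norm2_ge0.
Qed.

(** Moving from u to a net point changes the image by at most c delta, so the upper bound must be
    known first. *)
Lemma net_norm_ge (R : realType) (r s : nat) (J K : finType) (U : J -> 'cV[R]_r)
    (V : K -> 'cV[R]_s) (delta c c' : R) (B : 'M[R]_(s, r)) :
  0 <= c -> sphere_net U delta -> (forall k, norm2 (V k) = 1) ->
  (forall u, norm2 (B *m u) <= c * norm2 u) ->
  (forall j, exists k, c' + delta * c <= dotcv (V k) (B *m U j)) ->
  forall u, c' * norm2 u <= norm2 (B *m u).
Proof.
move=> c0 nU nV hc h u.
have [->|u0] := eqVneq u 0; first by rewrite mulmx0 !norm2E !dotcv0r sqrtr0 mulr0.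
have nu : 0 < norm2 u by rewrite lt_neqAle eq_sym norm2_eq0 u0 norm2_ge0.
pose w := (norm2 u)^-1 *: u.
have w1 : norm2 w = 1 by rewrite norm2Z ger0_norm ?invr_ge0 ?norm2_ge0// mulVf// gt_eqF.
suff : c' <= norm2 (B *m w).
  rewrite -scalemxAr norm2Z ger0_norm ?invr_ge0 ?norm2_ge0// mulrC.
  by rewrite ler_pdivlMr.
have [j wj] := nU.2 w w1; have [k hk] := h j.
have h1 : dotcv (V k) (B *m U j) <= norm2 (B *m U j).
  by rewrite -[leRHS]mul1r -(nV k) cauchy_schwarz.
have := norm2B (B *m U j) (B *m (U j - w)).
rewrite -mulmxBr opprB addrCA subrr addr0 => h2.
have h3 : norm2 (B *m (U j - w)) <= c * delta.
  apply: (le_trans (hc _)); apply: ler_wpM2l => //.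
  by rewrite -norm2N opprB.
lra.
Qed.

(** * Extreme singular values of a Gaussian matrix *)

Lemma measurable_bigmaxr (R : realType) (d : measure_display) (T : measurableType d)
    (I : Type) (l : seq I) (g : I -> T -> R) :
  (forall i, measurable_fun setT (g i)) ->
  measurable_fun setT (fun t => \big[Num.max/0]_(i <- l) g i t).
Proof.
move=> mg; elim: l => [|i l IH]; first by under eq_fun do rewrite big_nil; exact: measurable_cst.
by under eq_fun do rewrite big_cons; exact: (measurable_maxr (mg i) IH).
Qed.

(* [minmax lam x] is exp (- lam * min_j max_k x (j, k)). *)
Section minmax.
Context {R : realType} {J K : finType}.
Variables (lam : R) (j0 : J) (k0 : K).
Hypothesis lam0 : 0 < lam.
Implicit Types x y z : J * K -> R.

Definition blockmax x j : R := \big[Num.max/0]_k expR (lam * x (j, k)).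
Definition minmax x : R := \big[Num.max/0]_j (blockmax x j)^-1.

Lemma blockmax_gt0 x j : 0 < blockmax x j.
Proof. exact: lt_le_trans (expR_gt0 _) (le_bigmax _ _ k0). Qed.

Lemma minmax_ge0 x : 0 <= minmax x. Proof. exact: bigmax_ge_id. Qed.

Lemma minmax_shift x y j (c : R) : (forall k, x (j, k) <= y (j, k) + c) ->
  (blockmax y j)^-1 <= (blockmax x j)^-1 * expR (lam * c).
Proof.
move=> xy; rewrite ler_pdivlMl ?blockmax_gt0// ler_pdivrMr ?blockmax_gt0//.
apply: bigmax_le => [|k _]; first by rewrite mulr_ge0 ?expR_ge0// ltW// blockmax_gt0.
apply: (@le_trans _ _ (expR (lam * c) * expR (lam * y (j, k)))).
  by rewrite -expRD ler_expR -mulrDr ler_wpM2l ?(ltW lam0)// addrC.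
by rewrite ler_wpM2l ?expR_ge0//; exact: (le_bigmax _ (fun k => expR (lam * y (j, k))) k).
Qed.

Lemma le_minmax x y (c : R) : (forall i, x i <= y i + c) ->
  minmax y <= minmax x * expR (lam * c).
Proof.
move=> xy; apply: bigmax_le => [|j _]; first by rewrite mulr_ge0 ?expR_ge0 ?minmax_ge0.
apply: (@le_trans _ _ ((blockmax x j)^-1 * expR (lam * c))); first exact: minmax_shift.
by rewrite ler_wpM2r ?expR_ge0//; exact: (le_bigmax _ (fun j => (blockmax x j)^-1) j).
Qed.

Lemma minmax_lip x y :
  minmax (fun i => x i + y i) <= minmax x * expR (lam * \sum_i `|y i|).
Proof.
apply: le_minmax => i; rewrite (bigD1 i)//=.
have : 0 <= \sum_(i0 | i0 != i) `|y i0| by apply: sumr_ge0.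
by have := ler_norm (- y i); rewrite normrN; lra.
Qed.

Lemma coord_meas_minmax : coord_meas (fun x => (minmax x)%:E).
Proof.
apply: coord_meas_EFin => [x|d T c mc]; first exact: minmax_ge0.
apply: measurable_bigmaxr => j; apply: measurable_inv_pos; last by move=> t; exact: blockmax_gt0.
apply: measurable_bigmaxr => k; apply: measurableT_comp => //.
by apply: measurable_funM.
Qed.

Lemma minmax_le x (c : R) : (forall j, exists k, c <= x (j, k)) ->
  minmax x <= expR (- (lam * c)).
Proof.
move=> h; apply: bigmax_le => [|j _]; first exact: expR_ge0.
rewrite expRN lef_pV2 ?posrE ?expR_gt0 ?blockmax_gt0//; have [k ck] := h j.
apply: le_trans (le_bigmax _ (fun k => expR (lam * x (j, k))) k).
by rewrite ler_expR ler_wpM2l// ltW.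
Qed.

Lemma minmax_lt x (c : R) : minmax x < expR (- (lam * c)) ->
  forall j, exists k, c <= x (j, k).
Proof.
move=> h j; apply: contrapT => /forallNP hk; move: h; apply/negP; rewrite -leNgt.
apply: le_trans (le_bigmax _ (fun j => (blockmax x j)^-1) j).
rewrite expRN lef_pV2 ?posrE ?expR_gt0 ?blockmax_gt0//.
apply: bigmax_le => [|k _]; first exact: expR_ge0.
by rewrite ler_expR ler_wpM2l ?(ltW lam0)//; have /negP := hk k; rewrite -ltNge => /ltW.
Qed.

(** Let j be the block that attains the value at z. It differs from p.1 or from q.1, so one of the
    two single shifts leaves block j unchanged and keeps at least that value; monotonicity compares
    the other single shift with the double one. *)
Lemma minmax_submodular p q : p.1 != q.1 ->
  submodular (fun x => (minmax x)%:E) p q.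
Proof.
move=> pq z x y x0 y0; rewrite -!EFinD lee_fin.
set z1 := vshift z (ebase p) x; set z2 := vshift z (ebase q) y; set z12 := vshift z1 _ _.
have up i : z i <= z1 i by rewrite /z1 /vshift lerDl mulr_ge0// ler0n.
have up1 i : z1 i <= z12 i by rewrite /z12 /vshift lerDl mulr_ge0// ler0n.
have up2 i : z2 i <= z12 i.
  by rewrite /z12 /z2 /z1 /vshift; have := up i; rewrite /z1 /vshift; lra.
have mono a b : (forall i, a i <= b i) -> minmax b <= minmax a.
  move=> ab; rewrite -[leRHS]mulr1 -expR0 -(mulr0 lam); apply: le_minmax => i.
  by rewrite addr0.
have same1 j : j != p.1 -> blockmax z1 j = blockmax z j.
  move=> jp; apply: eq_bigr => k _; congr (expR (_ * _)).
  rewrite /z1 /vshift /ebase; case: eqP => [e|_]; last by rewrite mulr0 addr0.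
  by move: jp; rewrite -e eqxx.
have same2 j : j != q.1 -> blockmax z2 j = blockmax z j.
  move=> jp; apply: eq_bigr => k _; congr (expR (_ * _)).
  rewrite /z2 /vshift /ebase; case: eqP => [e|_]; last by rewrite mulr0 addr0.
  by move: jp; rewrite -e eqxx.
have [j _ zj] : {j | j \in predT & minmax z = (blockmax z j)^-1}.
  by apply: (eq_bigmax j0) => // j _; rewrite invr_ge0 ltW// blockmax_gt0.
have [jp|jp] := eqVneq j p.1.
  apply: lerD; first exact: mono.
  rewrite zj -same2; first exact: (le_bigmax _ (fun j => (blockmax z2 j)^-1) j).
  by rewrite jp.
rewrite addrC; apply: lerD; last exact: mono.
rewrite zj -same1//.
exact: (le_bigmax _ (fun j => (blockmax z1 j)^-1) j).
Qed.

End minmax.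

Lemma probability_markov (R : realType) (d : measure_display) (T : measurableType d)
    (P : probability T R) (f : T -> R) (c : R) :
  measurable_fun setT f -> (forall t, 0 <= f t) -> 0 < c ->
  (P [set t | (c <= f t)%R] <= (c^-1)%:E * \int[P]_t (f t)%:E)%E.
Proof.
move=> mf f0 c0.
have mD : measurable [set t | c <= f t].
  by rewrite -[X in measurable X]setTI; exact: measurable_fun_le.
have mE : measurable_fun setT (EFin \o f) by exact/measurable_EFinP.
have h : (c%:E * P [set t | (c <= f t)%R] <= \int[P]_t (f t)%:E)%E.
  rewrite -integral_cst//; apply: (@le_trans _ _ (\int[P]_(t in [set t | (c <= f t)%R]) (f t)%:E)%E).
    apply: ge0_le_integral => //.
    - by move=> t _; rewrite lee_fin ltW.
    - exact: (measurable_funS measurableT _ mE).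
  by apply: ge0_subset_integral => // t _; rewrite lee_fin f0.
have := lee_wpmul2l _ h; move=> /(_ (c^-1)%:E); rewrite lee_fin invr_ge0 ltW// => /(_ isT).
by rewrite muleA -EFinM mulVf ?gt_eqF// mul1e.
Qed.

Section chevet.
Context {R : realType} {J K : finType} {r s : nat}.
Variables (j0 : J) (k0 : K) (sg lam : R).
Hypotheses (sg1 : sg ^+ 2 = 1) (lam0 : 0 < lam).
Variables (iu : J * K -> 'cV[R]_r) (iv : J * K -> 'cV[R]_s).
Hypotheses (iu1 : forall p, norm2 (iu p) = 1) (iv1 : forall p, norm2 (iv p) = 1).
Hypothesis same_block : forall p q, p.1 = q.1 -> iu p = iu q \/ iv p = iv q.
Local Open Scope ereal_scope.
Local Notation gauss := (normal_prob (0 : R) 1).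
Local Notation f := (fun x : J * K -> R => (minmax lam x)%:E).

Definition cvf n (g : 'I_n -> R) : 'cV[R]_n := \col_i g i.

(** The sign serves both extremes: sg = 1 gives the min-max for the smallest singular value, and sg
    = - 1 with one-element blocks turns the minimum into minus a maximum. *)
Definition chevet_field (g : 'I_s -> R) (h : 'I_r -> R) (p : J * K) : R :=
  (sg * (dotcv (cvf g) (iv p) + dotcv (cvf h) (iu p)))%R.

Let sG : seq (J * K -> R) := [seq (fun p => sg * iv p k 0)%R | k <- enum 'I_s].
Let sH : seq (J * K -> R) := [seq (fun p => sg * iu p l 0)%R | l <- enum 'I_r].

Let gcov_sG p q : gcov sG p q = dotcv (iv p) (iv q).
Proof.
rewrite /gcov big_map big_enum /= dotcvE; apply: eq_bigr => k _.
by rewrite mulrACA -expr2 sg1 mul1r.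
Qed.

Let gcov_sH p q : gcov sH p q = dotcv (iu p) (iu q).
Proof.
rewrite /gcov big_map big_enum /= dotcvE; apply: eq_bigr => k _.
by rewrite mulrACA -expr2 sg1 mul1r.
Qed.

Let dot_le1 n (u v : 'cV[R]_n) : norm2 u = 1%R -> norm2 v = 1%R -> (dotcv u v <= 1)%R.
Proof. by move=> u1 v1; have := cauchy_schwarz u v; rewrite u1 v1 mulr1. Qed.

Let mf : coord_meas f. Proof. exact: coord_meas_minmax. Qed.

Let m_dot n (d : measure_display) (T : measurableType d) (c : T -> 'I_n -> R) (v : 'cV[R]_n) :
  (forall i, measurable_fun setT (fun t => c t i)) ->
  measurable_fun setT (fun t => dotcv (cvf (c t)) v).
Proof.
move=> mc; under eq_fun do rewrite dotcvE.
by apply: measurable_sum => i; under eq_fun do rewrite mxE; exact: measurable_funM.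
Qed.

Let gauss_ex_sH g : gauss_ex sH f (fun p => (sg * dotcv (cvf g) (iv p))%R) =
  std_gauss_ex (fun h => f (chevet_field g h)).
Proof.
pose L' (h : 'I_r -> R) : J * K -> R := fun p => (sg * dotcv (cvf h) (iu p))%R.
have sHE : sH = [seq L' a | a <- ebases (enum 'I_r)].
  rewrite -map_comp; apply: eq_map => k; apply/funext => p /=.
  rewrite /L' dotcvE; congr (_ * _)%R; rewrite (bigD1 k)//= big1 ?addr0.
    by rewrite mxE /ebase eqxx mul1r.
  by move=> i ik; rewrite mxE /ebase (negbTE ik) mul0r.
have L0 : (fun p => (sg * dotcv (cvf g) (iv p))%R) = chevet_field g (fun=> 0%R).
  apply/funext => p; rewrite /chevet_field [X in (_ + X)%R]dotcvE big1 ?addr0// => i _.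
  by rewrite mxE mul0r.
rewrite sHE L0 (gauss_ex_map (L := chevet_field g))// => z a x.
apply/funext => p; rewrite /chevet_field /L' /vshift mulrCA -mulrDr -addrA -dotcvZl -dotcvDl.
by congr (_ * (_ + dotcv _ _))%R; apply/matrixP => i j; rewrite !mxE.
Qed.

(* Adding a common standard normal variable makes the product covariance
   dominate the sum covariance; it contributes the factor exp (lam ^ 2 / 2). *)
Lemma chevet_comparison (sA : seq (J * K -> R)) :
  (forall p q, gcov sA p q = dotcv (iv p) (iv q) * dotcv (iu p) (iu q))%R ->
  (expR (lam ^+ 2 / 2))%:E * gauss_ex sA f (fun=> 0%R) <=
  std_gauss_ex (fun g => std_gauss_ex (fun h => f (chevet_field g h))).
Proof.
move=> sAE; pose one : J * K -> R := fun=> 1%R.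
have step1 : (expR (lam ^+ 2 / 2))%:E * gauss_ex sA f (fun=> 0%R) <=
    gauss_ex (one :: sA) f (fun=> 0%R).
  have -> : (lam ^+ 2 = (- lam) ^+ 2)%R by rewrite sqrrN.
  rewrite -gauss_mgf -ge0_integralZr//.
  - apply: le_gauss_int.
    + by move=> x; rewrite mule_ge0 ?lee_fin ?expR_ge0// gauss_ex_ge0.
    + apply: emeasurable_funM => //.
      by apply/measurable_EFinP; apply: measurableT_comp => //; apply: measurable_funM.
    + exact: measurable_gauss_ex.
    + move=> x; change ((expR (- lam * x))%:E * gauss_ex sA f (fun=> 0%R) <=
        gauss_ex sA f (vshift (fun=> 0%R) one x)).
      rewrite gauss_ex_translate.
      rewrite -gauss_exZ ?expR_ge0//; apply: le_gauss_ex.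
      * by apply: coord_measM => //; apply: coord_meas_cst; exact: expR_ge0.
      * exact: (coord_meas_translate one x mf).
      * move=> y; rewrite -EFinM lee_fin mulNr expRN ler_pdivrMl ?expR_gt0// mulrC.
        by apply: le_minmax => // i; rewrite /vshift /one mulr1.
  - by apply/measurable_EFinP; apply: measurableT_comp => //; apply: measurable_funM.
  - exact: gauss_ex_ge0.
apply: (le_trans step1).
apply: (@le_trans _ _ (gauss_ex (sG ++ sH) f (fun=> 0%R))).
  (* The constant contributed by the added variable makes the difference factor. It is nonnegative,
     and zero inside a block, so submodularity is needed only across blocks. *)
  have dif p q : (gcov (one :: sA) p q - gcov (sG ++ sH) p q =
     (1 - dotcv (iv p) (iv q)) * (1 - dotcv (iu p) (iu q)))%R.
    by rewrite gcov_cons gcov_cat gcov_sG gcov_sH sAE /one; ring.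
  apply: (@gauss_ex_comparison _ _ lam) => //.
  - exact: minmax_lip.
  - move=> p q; rewrite -subr_ge0 dif mulr_ge0// subr_ge0 dot_le1//.
  - move=> p q; rewrite -subr_eq0 dif => nz; apply: minmax_submodular => //.
    apply: contra_neq nz => /same_block[] ->.
      by rewrite -[dotcv (iu q) _]norm2_sqr iu1 expr1n subrr mulr0.
    by rewrite -[dotcv (iv q) _]norm2_sqr iv1 expr1n subrr mul0r.
rewrite gauss_ex_cat.
pose LG (g : 'I_s -> R) : J * K -> R := fun p => (sg * dotcv (cvf g) (iv p))%R.
have LGv z a x : LG (vshift z a x) = vshift (LG z) (LG a) x.
  apply/funext => p; rewrite /LG [RHS]/vshift.
  have -> : cvf (vshift z a x) = (cvf z + x *: cvf a)%R by apply/matrixP => i j; rewrite !mxE.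
  by rewrite dotcvDl dotcvZl; ring.
have sGE : sG = [seq LG a | a <- ebases (enum 'I_s)].
  rewrite -map_comp; apply: eq_map => k; apply/funext => p /=.
  rewrite /LG dotcvE; congr (_ * _)%R; rewrite (bigD1 k)//= big1 ?addr0.
    by rewrite mxE /ebase eqxx mul1r.
  by move=> i ik; rewrite mxE /ebase (negbTE ik) mul0r.
have LG0 : (fun=> 0%R) = LG (fun=> 0%R).
  apply/funext => p; rewrite /LG dotcvE big1 ?mulr0// => i _; by rewrite mxE mul0r.
rewrite sGE LG0 gauss_ex_map// le_eqVlt; apply/orP; left; apply/eqP.
by apply: eq_gauss_ex => g; exact: gauss_ex_sH.
Qed.

(** A product majorant separates the two independent vectors, so each contributes its own Laplace
    transform; the factor exp (- lam^2 / 2) comes from the added variable. *)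
Lemma chevet_bound (sA : seq (J * K -> R)) (phi : ('I_s -> R) -> R)
    (psi : ('I_r -> R) -> R) (C1 C2 : R) :
  (forall p q, gcov sA p q = dotcv (iv p) (iv q) * dotcv (iu p) (iu q))%R ->
  coord_meas (fun g => (phi g)%:E) -> coord_meas (fun h => (psi h)%:E) -> (0 <= C2)%R ->
  (forall g h, minmax lam (chevet_field g h) <= phi g * psi h)%R ->
  std_gauss_ex (fun g => (phi g)%:E) <= C1%:E ->
  std_gauss_ex (fun h => (psi h)%:E) <= C2%:E ->
  gauss_ex sA f (fun=> 0%R) <= (expR (- (lam ^+ 2 / 2)) * (C1 * C2))%:E.
Proof.
move=> sAE mphi mpsi C20 fle hphi hpsi.
rewrite expRN EFinM lee_pdivlMl ?expR_gt0//.
apply: (le_trans (chevet_comparison sAE)).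
apply: (@le_trans _ _ (std_gauss_ex (fun g => C2%:E * (phi g)%:E))); last first.
  by rewrite /std_gauss_ex gauss_exZ// mulrC EFinM; apply: lee_wpmul2l; rewrite ?lee_fin.
apply: le_gauss_ex.
- split => [g|d T c mc].
    by rewrite -gauss_ex_sH; exact: gauss_ex_ge0.
  under eq_fun do rewrite -gauss_ex_sH.
  apply: (coord_meas_gauss_ex sH mf).2 => p.
  by apply: measurable_funM => //; exact: m_dot.
- by apply: coord_measM => //; exact: coord_meas_cst.
move=> g.
apply: (@le_trans _ _ (std_gauss_ex (fun h => (phi g)%:E * (psi h)%:E))); last first.
  rewrite /std_gauss_ex gauss_exZ//; last by have := mphi.1 g; rewrite lee_fin.
  by rewrite muleC; apply: lee_wpmul2r => //; exact: mphi.1.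
apply: le_gauss_ex.
- split => [h|d T c mc]; first by rewrite lee_fin; exact: minmax_ge0.
  apply: mf.2 => p; apply: measurable_funM => //; apply: measurable_funD => //.
  exact: m_dot.
- by apply: coord_measM => //; apply: coord_meas_cst; have := mphi.1 g; rewrite lee_fin.
by move=> h; rewrite -EFinM lee_fin.
Qed.

End chevet.

Section gaussian_matrix_tail.
Context {R : realType} {d : measure_display} {T : measurableType d}.
Variables (P : probability T R) (r s m : nat).
Variables (G : 'I_s -> 'I_m -> {RV P >-> R}) (Q : 'M[R]_(r, m)).
Hypotheses (hG : gaussian_matrix G) (QQ : Q *m Q^T = 1%:M).
Local Open Scope ereal_scope.

Lemma measurable_sample_dot (v : 'cV[R]_s) (w : 'cV[R]_m) :
  measurable_fun setT (fun t => dotcv v (sample_mx G t *m w)).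
Proof.
under eq_fun do rewrite dotcvE.
apply: measurable_sum => i; apply: measurable_funM => //.
under eq_fun do rewrite mxE.
apply: measurable_sum => j; apply: measurable_funM => //.
by under eq_fun do rewrite mxE; exact: measurable_funPT.
Qed.

Section tail.
Variables (J K : finType) (j0 : J) (k0 : K) (sg lam : R).
Hypotheses (sg1 : (sg ^+ 2 = 1)%R) (lam0 : (0 < lam)%R).
Variables (iu : J * K -> 'cV[R]_r) (iv : J * K -> 'cV[R]_s).
Hypotheses (iu1 : forall p, norm2 (iu p) = 1%R) (iv1 : forall p, norm2 (iv p) = 1%R).
Hypothesis same_block : forall p q, p.1 = q.1 -> iu p = iu q \/ iv p = iv q.

Definition sample_field t (p : J * K) : R :=
  (sg * dotcv (iv p) (sample_mx G t *m (Q^T *m iu p)))%R.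

Lemma measurable_minmax_field : measurable_fun setT (fun t => minmax lam (sample_field t)).
Proof.
apply/measurable_EFinP; apply: (coord_meas_minmax lam k0).2 => p.
by apply: measurable_funM => //; exact: measurable_sample_dot.
Qed.

Lemma chevet_tail (phi : ('I_s -> R) -> R) (psi : ('I_r -> R) -> R) (C1 C2 c : R) :
  coord_meas (fun g => (phi g)%:E) -> coord_meas (fun h => (psi h)%:E) -> (0 <= C2)%R ->
  (forall g h, minmax lam (chevet_field sg iu iv g h) <= phi g * psi h)%R ->
  std_gauss_ex (fun g => (phi g)%:E) <= C1%:E ->
  std_gauss_ex (fun h => (psi h)%:E) <= C2%:E ->
  P [set t | (expR (- (lam * c)) <= minmax lam (sample_field t))%R] <=
  (expR (lam * c - lam ^+ 2 / 2) * (C1 * C2))%:E.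
Proof.
move=> mphi mpsi C20 fle hphi hpsi.
have mf := @coord_meas_minmax R J K lam k0.
pose a (kl : 'I_s * 'I_m) (p : J * K) : R :=
  (sg * (iv p kl.1 0 * (Q^T *m iu p) kl.2 0))%R.
have fE t : sample_field t = (fun p => 0 + \sum_kl G kl.1 kl.2 t * a kl p)%R.
  apply/funext => p; rewrite add0r /sample_field dotcvE mulr_sumr.
  rewrite -(pair_bigA _ (fun k l => G k l t * a (k, l) p)%R)/=.
  apply: eq_bigr => k _; rewrite mxE !mulr_sumr; apply: eq_bigr => l _.
  by rewrite [sample_mx _ _ _ _]mxE /a /=; ring.
have := probability_markov P measurable_minmax_field (fun t => minmax_ge0 lam (sample_field t))
  (expR_gt0 (- (lam * c))).
move=> /le_trans; apply.
have -> : \int[P]_t (minmax lam (sample_field t))%:E =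
    gauss_ex [seq a kl | kl <- enum {: 'I_s * 'I_m}] (fun x => (minmax lam x)%:E) (fun=> 0%R).
  under eq_integral do rewrite fE.
  apply: (expect_indep_normal (X := fun kl : 'I_s * 'I_m => G kl.1 kl.2)) => //.
    by move=> kl; exact: hG.1.
  exact: hG.2.
rewrite -expRN opprK expRD -mulrA EFinM; apply: lee_wpmul2l; first by rewrite lee_fin expR_ge0.
apply: (chevet_bound j0 k0 sg1 lam0 iu1 iv1 same_block _ mphi mpsi) => // p q.
rewrite /gcov big_map big_enum /=.
(* Orthonormal rows of [Q] make [Q^T] an isometry, so the entries of [G] can be used directly
   without first finding the law of G Q^T. *)
have -> : (dotcv (iu p) (iu q) = dotcv (Q^T *m iu p) (Q^T *m iu q))%R.
  by rewrite dotcv_mull trmxK mulmxA QQ mul1mx.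
rewrite !dotcvE big_distrlr /= -(pair_bigA _ (fun k l => a (k, l) p * a (k, l) q)%R)/=.
apply: eq_bigr => k _; apply: eq_bigr => l _; rewrite /a /=.
have -> : forall x y z u : R, (sg * (x * y) * (sg * (z * u)) = sg ^+ 2 * (x * z * (y * u)))%R.
  by move=> x y z u; ring.
by rewrite sg1 mul1r.
Qed.

End tail.

Lemma coord_meas_exp_norm n (b : R) :
  coord_meas (fun g : 'I_n -> R => (expR (b * Num.sqrt (sqnorm g)))%:E).
Proof.
apply: coord_meas_EFin => [g|d' T' c mc]; first exact: expR_ge0.
apply: measurableT_comp => //; apply: measurable_funM => //.
by apply: measurable_sqrt; exact: measurable_sqnorm.
Qed.

Lemma norm2_cvf n (g : 'I_n -> R) : norm2 (cvf g) = Num.sqrt (sqnorm g).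
Proof. by rewrite /norm2; congr Num.sqrt; apply: eq_bigr => i _; rewrite mxE. Qed.

Hypotheses (r0 : (0 < r)%N) (s4 : (4 < s)%N).
Variables (t delta : R).
Hypotheses (d0 : (0 < delta)%R) (d1 : (delta < 1)%R) (td : (23 / 20 <= (1 - delta) * t)%R)
  (ts : (t <= 2 * Num.sqrt (s%:R - 1))%R).
Let shi := (Num.sqrt s%:R + Num.sqrt r%:R + t)%R.
Let slo := (Num.sqrt s%:R - Num.sqrt r%:R - t)%R.
Let t0 : (0 < t)%R.
Proof.
have d1' : (0 < 1 - delta)%R by rewrite subr_gt0.
by rewrite -(pmulr_rgt0 _ d1'); apply: lt_le_trans td; rewrite divr_gt0.
Qed.

(** The inequality for vectors is exact; all losses due to the nets are moved into the factor exp (2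
    delta t shi) of the probability. *)
Lemma gaussian_net_event : exists E : set T,
  [/\ measurable E,
      (forall w, E w -> forall u : 'cV[R]_r,
        (slo * norm2 u <= norm2 (sample_mx G w *m (Q^T *m u)) <= shi * norm2 u)%R) &
      (1 - expR (- (t ^+ 2 / 2)) * (2 * expR (delta * (2 * t * shi))))%:E <= P E].
Proof.
have s0 : (0 < s)%N by exact: leq_trans s4.
have [J [U nU]] := sphere_net_exists r0 d0; have [K [V nV]] := sphere_net_exists s0 d0.
have [k0 _] := sphere_net_dot 0 s0 nV; have [j0 _] := sphere_net_dot 0 r0 nU.
have shi0 : (0 <= shi)%R by rewrite !addr_ge0 ?sqrtr_ge0// ltW.
(* Thresholds on the net that pay in advance for the passage to all vectors: [net_norm_ge] loses
   delta shi, and [net_norm_le] asks for the factor (1 - delta)^2. *)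
pose clo := (slo + delta * shi)%R; pose chi := (- ((1 - delta) ^+ 2 * shi))%R.
pose Flo := sample_field (J := J) (K := K) 1 (fun p => U p.1) (fun p => V p.2).
pose Fhi := sample_field (J := (J * K)%type) (K := unit) (-1)%R (fun p => U p.1.1) (fun p => V p.1.2).
pose Blo := [set w | (expR (- (t * clo)) <= minmax t (Flo w))%R].
pose Bhi := [set w | (expR (- (t * chi)) <= minmax t (Fhi w))%R].
have mlo : measurable Blo.
  rewrite -[Blo]setTI; apply: measurable_fun_le => //; exact: measurable_minmax_field.
have mhi : measurable Bhi.
  rewrite -[Bhi]setTI; apply: measurable_fun_le => //; exact: measurable_minmax_field.
have upr := chi_mgf_upper r0 t0; have ups := chi_mgf_upper s0 t0.
have dots n (g : 'I_n -> R) (v : 'cV[R]_n) : norm2 v = 1%R ->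
    (- Num.sqrt (sqnorm g) <= dotcv (cvf g) v <= Num.sqrt (sqnorm g))%R.
  move=> v1; have := cauchy_schwarz (cvf g) v; have := cauchy_schwarz (- cvf g)%R v.
  by rewrite norm2N norm2_cvf v1 mulr1 dotcvNl => h1 h2; apply/andP; split; lra.
have PBlo : P Blo <= (expR (- (t ^+ 2 / 2)) * expR (delta * (2 * t * shi)))%:E.
  (* On a net the maximum over v of the inner product with g is only (1 - delta) |g|, so the
     transform is taken at (1 - delta) t, which still has to be at least 23/20. *)
  have lows : std_gauss_ex (fun g : 'I_s -> R => (expR (- ((1 - delta) * t) * Num.sqrt (sqnorm g)))%:E)
      <= (expR (- ((1 - delta) * t) * Num.sqrt s%:R + ((1 - delta) * t) ^+ 2 / 2))%:E.
    by apply: chi_mgf_lower => //; apply: le_trans ts; rewrite ler_piMl ?(ltW t0)// gerBl ltW.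
  apply: (le_trans (chevet_tail (iu := fun p => U p.1) (iv := fun p => V p.2)
    j0 k0 (expr1n _ _) t0 _ _ _ clo (coord_meas_exp_norm _ _)
    (coord_meas_exp_norm _ _) (expR_ge0 _) _ lows upr)).
  - by move=> p; exact: nU.1.
  - by move=> p; exact: nV.1.
  - by move=> p q ->; left.
  - move=> g h; rewrite -expRD.
    apply: (le_trans (minmax_le k0 t0 (c := ((1 - delta) * Num.sqrt (sqnorm g) - Num.sqrt (sqnorm h))%R) _)).
      move=> j; have [k hk] := sphere_net_dot (cvf g) s0 nV; exists k.
      rewrite /chevet_field /= mul1r; rewrite norm2_cvf dotcvC in hk.
      by have /andP[] := dots _ h (U j) (nU.1 j); lra.
    by rewrite ler_expR; lra.
  - rewrite lee_fin -!expRD ler_expR /clo /slo.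
    have : (0 <= t * delta * (Num.sqrt r%:R + t))%R.
      by rewrite !mulr_ge0 ?addr_ge0 ?sqrtr_ge0 ?(ltW d0) ?(ltW t0).
    have : (0 <= t ^+ 2 * (delta * (2 - delta)))%R.
      rewrite mulr_ge0 ?sqr_ge0// mulr_ge0 ?(ltW d0)//; have := d1; lra.
    rewrite /shi; lra.
have sgN : ((-1) ^+ 2 = 1 :> R)%R by rewrite sqrrN expr1n.
have PBhi : P Bhi <= (expR (- (t ^+ 2 / 2)) * expR (delta * (2 * t * shi)))%:E.
  apply: (le_trans (chevet_tail (iu := fun p => U p.1.1) (iv := fun p => V p.1.2)
    (j0, k0) tt sgN t0 _ _ _ chi (coord_meas_exp_norm _ _)
    (coord_meas_exp_norm _ _) (expR_ge0 _) _ ups upr)).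
  - by move=> p; exact: nU.1.
  - by move=> p; exact: nV.1.
  - by move=> p q ->; left.
  - move=> g h; rewrite -expRD.
    apply: (le_trans (minmax_le tt t0 (c := (- (Num.sqrt (sqnorm g) + Num.sqrt (sqnorm h)))%R) _)).
      move=> [j k]; exists tt; rewrite /chevet_field /=.
      have /andP[] := dots _ h (U j) (nU.1 j); have /andP[] := dots _ g (V k) (nV.1 k); lra.
    by rewrite ler_expR; lra.
  - rewrite lee_fin -!expRD ler_expR /chi.
    have : (0 <= t * delta ^+ 2 * shi)%R.
      exact: mulr_ge0 (mulr_ge0 (ltW t0) (sqr_ge0 _)) shi0.
    rewrite /shi; lra.
exists (~` (Blo `|` Bhi)); split.
- by apply: measurableC; exact: measurableU.
- move=> w; rewrite setCU => -[/negP + /negP]; rewrite -!ltNge => wlo whi.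
  have up u : (norm2 (sample_mx G w *m Q^T *m u) <= shi * norm2 u)%R.
    apply: (net_norm_le r0 s0 _ nU nV); first by rewrite (ltW d0).
    move=> j k; have [[]] := minmax_lt tt t0 whi (j, k).
    by rewrite /Fhi /sample_field /= /chi mulN1r lerN2 mulmxA.
  move=> u; rewrite mulmxA up andbT.
  apply: (net_norm_ge shi0 nU nV.1 up) => j.
  have [k hk] := minmax_lt k0 t0 wlo j; exists k.
  by move: hk; rewrite /Flo /sample_field /= mul1r /clo mulmxA.
- rewrite probability_setC; last exact: measurableU.
  have := measureU2 P mlo mhi.
  have fb : P (Blo `|` Bhi) \is a fin_num by apply: fin_num_measure; exact: measurableU.
  rewrite -(fineK fb) -EFinD lee_fin => h.
  suff : (fine (P (Blo `|` Bhi)) <= expR (- (t ^+ 2 / 2)) * (2 * expR (delta * (2 * t * shi))))%R.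
    by lra.
  rewrite -lee_fin fineK//; apply: (le_trans (measureU2 P mlo mhi)).
  apply: (le_trans (leeD PBlo PBhi)); rewrite -EFinD lee_fin; lra.
Qed.

End gaussian_matrix_tail.

Lemma expR_le1D2x (R : realType) (x : R) : 0 <= x <= 1 / 2 -> expR x <= 1 + 2 * x.
Proof.
move=> /andP[x0 x1]; have := expR_ge1Dx (- x); rewrite expRN => h.
have e0 := expR_gt0 x; 
have h2 : (1 - x) * expR x <= 1 by rewrite -ler_pdivlMr// div1r.
by nra.
Qed.

(** The conclusion on vectors does not involve the mesh, so it survives the union of the events over
    all meshes, while the loss in probability disappears in the limit. *)
Lemma gaussian_singular_values (R : realType) (d : measure_display) (T : measurableType d)
    (P : probability T R) (r s m : nat) (G : 'I_s -> 'I_m -> {RV P >-> R})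
    (Q : 'M[R]_(r, m)) (t : R) :
  gaussian_matrix G -> Q *m Q^T = 1%:M -> (0 < r)%N -> (4 < s)%N -> 23 / 20 < t ->
  t <= 2 * Num.sqrt (s%:R - 1) ->
  exists E : set T,
    [/\ measurable E,
        (forall w, E w -> forall u : 'cV[R]_r,
          (Num.sqrt s%:R - Num.sqrt r%:R - t) * norm2 u <=
          norm2 (sample_mx G w *m (Q^T *m u)) <=
          (Num.sqrt s%:R + Num.sqrt r%:R + t) * norm2 u) &
        ((1 - 2 * expR (- (t ^+ 2 / 2)))%:E <= P E)%E].
Proof.
move=> hG QQ r0 s4 t1 ts.
have t0 : 0 < t by apply: lt_trans t1; lra.
pose c := 2 * t * (Num.sqrt s%:R + Num.sqrt r%:R + t).
have c0 : 0 < c.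
  by rewrite mulr_gt0// ?mulr_gt0// ltr_wpDl// addr_ge0// sqrtr_ge0.
(* The largest mesh with (1 - d0) t >= 23/20; it is positive because t exceeds 23/20 strictly. *)
pose d0 := 1 - 23 / 20 / t.
have d00 : 0 < d0 by rewrite subr_gt0 ltr_pdivrMr// mul1r.
have d01 : d0 < 1 by rewrite gtrBl divr_gt0//; lra.
pose dl n := d0 / n.+1%:R.
have dl0 n : 0 < dl n by rewrite divr_gt0.
have dld n : dl n <= d0 by rewrite ler_pdivrMr// ler_peMr ?(ltW d00)// ler1n.
have tdl n : 23 / 20 <= (1 - dl n) * t.
  have h : (1 - d0) * t <= (1 - dl n) * t by rewrite ler_pM2r// lerD2l lerN2.
  by apply: le_trans h; rewrite /d0 opprB addrC subrK divfK// gt_eqF.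
have ev n := gaussian_net_event hG QQ r0 s4 (dl0 n) (le_lt_trans (dld n) d01) (tdl n) ts.
have [F hF] := choice ev.
have mF n : measurable (F n) by case: (hF n).
have mE : measurable (\bigcup_n F n) by exact: bigcup_measurable.
exists (\bigcup_n F n); split => //.
  by move=> w [n _ Fw]; case: (hF n) => _ + _; apply.
have fE : P (\bigcup_n F n) \is a fin_num by exact: fin_num_measure.
rewrite -(fineK fE) lee_fin; apply/ler_addgt0Pr => eta eta0.
(* The first summand makes the loss at most [eta]; the second brings the exponent below 1/2, where
   exp x <= 1 + 2 x. *)
pose n := Num.truncn (4 * d0 * c / eta + 2 * d0 * c).
have dc := mulr_gt0 d00 c0.
have x0 : 0 <= 4 * d0 * c / eta by rewrite -(mulrA 4) divr_ge0 ?(ltW eta0)// mulr_ge0 ?(ltW dc).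
have y0 : 0 <= 2 * d0 * c by rewrite -mulrA mulr_ge0 ?(ltW dc).
have hn : 4 * d0 * c / eta + 2 * d0 * c <= n.+1%:R by apply: ltW; exact: truncnS_gt.
have h1 : 4 * (dl n * c) <= eta.
  rewrite /dl mulrAC mulrA ler_pdivrMr// [leRHS]mulrC -ler_pdivrMr//.
  by apply: le_trans hn; rewrite mulrA lerDl.
have h2 : dl n * c <= 1 / 2.
  rewrite /dl mulrAC ler_pdivrMr//; lra.
have h3 : 0 <= dl n * c by rewrite mulr_ge0 ?ltW.
have h4 := @expR_le1D2x R (dl n * c); rewrite h3 h2 in h4.
have [_ _ PF] := hF n.
have h5 : 1 - expR (- (t ^+ 2 / 2)) * (2 * expR (dl n * c)) <= fine (P (\bigcup_n F n)).
  rewrite -lee_fin fineK//; apply: (le_trans PF); apply: le_measure; rewrite ?inE//.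
  exact: bigcup_sup.
have e1 : expR (- (t ^+ 2 / 2)) <= 1.
  by rewrite -expR0 ler_expR oppr_le0 divr_ge0// sqr_ge0.
have e0 := expR_ge0 (- (t ^+ 2 / 2)).
have := h4 isT; move: h5 e1 e0; set e := expR (- _); set x := expR _ => h5 e1 e0 h6.
have : e * (2 * x) <= 2 * e + eta.
  have : e * (2 * x) <= e * (2 * (1 + 2 * (dl n * c))) by rewrite ler_wpM2l//; lra.
  have : e * (4 * (dl n * c)) <= 1 * eta by apply: ler_pM => //; lra.
  lra.
lra.
Qed.

(** * Orthonormal bases, pseudoinverses and the preconditioned problem *)

Lemma eqmx_usubmx_col (F : fieldType) (m p k r : nat) (A : 'M[F]_(p + k, m)) (Q : 'M[F]_(r, m)) :
  (Q :=: dsubmx A)%MS -> (A :=: col_mx (usubmx A) Q)%MS.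
Proof.
move=> QA; rewrite -{1}[A]vsubmxK.
apply: eqmx_trans (eqmx_sym (addsmxE _ _)) _.
exact: eqmx_trans (adds_eqmx (eqmx_refl _) (eqmx_sym QA)) (addsmxE _ _).
Qed.

Lemma gram_schmidt (R : realType) (m k : nat) (A : 'M[R]_(k, m)) :
  exists (r : nat) (Q : 'M[R]_(r, m)), Q *m Q^T = 1%:M /\ (Q :=: A)%MS.
Proof.
elim: k A => [|k IH] A.
  exists 0%N, 0; split; first by rewrite mul0mx; apply/matrixP => -[].
  by apply/eqmxP; rewrite sub0mx (flatmx0 A) sub0mx.
have [r [Q [QQ QA]]] := IH (dsubmx (A : 'M[R]_(1 + k, m))).
set a := usubmx (A : 'M[R]_(1 + k, m)).
have AE : (A :=: col_mx a Q)%MS by exact: (eqmx_usubmx_col (A := (A : 'M[R]_(1 + k, m)))).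
pose a' := a - a *m Q^T *m Q.
have a'Q : a' *m Q^T = 0 by rewrite mulmxBl -(mulmxA _ Q Q^T) QQ mulmx1 subrr.
have [a0|a0] := eqVneq a' 0.
  exists r, Q; split => //; apply/eqmxP; rewrite !AE -!addsmxE addsmxSr addsmx_sub submx_refl andbT.
  by move/eqP: a0; rewrite subr_eq0 => /eqP {1}->; rewrite submxMl.
pose nu := norm2 a'^T.
have nu0 : nu != 0 by rewrite norm2_eq0 -trmx0 (inj_eq (can_inj (@trmxK _ _ _))).
exists (1 + r)%N, (col_mx (nu^-1 *: a') Q); split.
  have Qa' : Q *m a'^T = 0 by rewrite -[Q]trmxK -trmx_mul a'Q trmx0.
  have aa : a' *m a'^T = (nu ^+ 2)%:M.
    by rewrite [LHS]mx11_scalar norm2_sqr /dotcv trmxK.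
  rewrite tr_col_mx mul_col_row QQ linearZ /= -!scalemxAr -!scalemxAl a'Q Qa' aa !scaler0.
  by rewrite -!mul_scalar_mx -!scalar_mxM mulrA -expr2 -exprMn mulVf// expr1n -scalar_mx_block.
apply/eqmxP; rewrite !AE -!addsmxE; apply/andP; split; rewrite addsmx_sub addsmxSr andbT.
  rewrite scalemx_sub// addmx_sub ?addsmxSl// eqmx_opp.
  by apply: submx_trans (addsmxSr _ _); rewrite submxMl.
have -> : a = a' + a *m Q^T *m Q by rewrite subrK.
rewrite addmx_sub//; last by apply: submx_trans (addsmxSr _ _); rewrite submxMl.
apply: submx_trans (addsmxSl _ _).
have -> : a' = nu *: (nu^-1 *: a') by rewrite scalerA mulfV// scale1r.
by rewrite scalemx_sub// scalerA mulVf// scale1r.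
Qed.

Lemma seminorm_gram (R : realType) (m n : nat) (B : 'M[R]_(m, n)) (z : 'cV[R]_n) :
  seminorm_mx (B^T *m B) z = norm2 (B *m z).
Proof. by rewrite norm2E /seminorm_mx /dotcv trmx_mul !mulmxA. Qed.

Lemma mpinv_normal_eq (R : realType) (m n : nat) (C : 'M[R]_(m, n)) (b : 'cV[R]_m) :
  C^T *m C *m (mpinv C *m b) = C^T *m b.
Proof.
have [CXC _ sCX _] := mpinvP C.
by rewrite mulmxA -(mulmxA C^T C) -sCX -trmx_mul CXC.
Qed.

(** Both sides are orthogonal projections, and the two factorizations say that their ranges agree;
    transposing one absorption identity gives the other order. *)
Lemma mpinv_range_proj (R : realType) (m n p : nat) (A : 'M[R]_(m, n)) (C : 'M[R]_(m, p))
    (N : 'M[R]_(n, p)) (Z : 'M[R]_(p, n)) :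
  C = A *m N -> A = C *m Z -> C *m mpinv C = A *m mpinv A.
Proof.
move=> CE AE; have [CXC _ sC _] := mpinvP C; have [AXA _ sA _] := mpinvP A.
have h1 : C *m mpinv C *m (A *m mpinv A) = A *m mpinv A.
  by rewrite mulmxA {1}AE !mulmxA CXC -AE.
have h2 : A *m mpinv A *m (C *m mpinv C) = C *m mpinv C.
  by rewrite mulmxA {1}CE !mulmxA AXA -CE.
by have := congr1 trmx h1; rewrite trmx_mul sA sC h2.
Qed.

Section preconditioned.
Context {R : realType} {m n s : nat}.
Variables (A : 'M[R]_(m, n)) (G : 'M[R]_(s, m)) (D : econ_svd (G *m A)).
Local Notation N := (svd_precond D).

Lemma diag_sigma_unit : diag_mx (svd_sigma D) \in unitmx.
Proof.
rewrite unitmxE det_diag unitfE; apply/prodf_neq0 => i _.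
by rewrite gt_eqF// svd_sigma_gt0.
Qed.

Lemma sketch_precond : G *m (A *m N) = svd_U D.
Proof.
rewrite mulmxA.
transitivity (svd_U D *m diag_mx (svd_sigma D) *m (svd_V D)^T *m N).
  by congr (_ *m _); exact: svd_eq.
rewrite /svd_precond !mulmxA -(mulmxA _ (svd_V D)^T) svd_V_orth mulmx1.
by rewrite -mulmxA mulmxV ?diag_sigma_unit// mulmx1.
Qed.

Lemma norm2_sketch_precond y : norm2 (G *m (A *m N *m y)) = norm2 y.
Proof.
rewrite !norm2E mulmxA sketch_precond; congr Num.sqrt.
by rewrite dotcv_mull mulmxA svd_U_orth mul1mx.
Qed.

(** The product N Sigma V^T is the projection V V^T, which G A does not see; injectivity of the
    sketch on the range lifts this to A (1 - V V^T) = 0. *)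
Lemma precond_factor : (forall u : 'cV[R]_n, G *m (A *m u) = 0 -> A *m u = 0) ->
  A = A *m N *m (diag_mx (svd_sigma D) *m (svd_V D)^T).
Proof.
move=> inj.
have NE : N *m (diag_mx (svd_sigma D) *m (svd_V D)^T) = svd_V D *m (svd_V D)^T.
  by rewrite /svd_precond !mulmxA -(mulmxA (svd_V D)) mulVmx ?diag_sigma_unit// mulmx1.
rewrite -mulmxA NE; set W := svd_V D *m _.
have GW : G *m A *m W = G *m A.
  transitivity (svd_U D *m diag_mx (svd_sigma D) *m (svd_V D)^T *m W).
    by congr (_ *m _); exact: svd_eq.
  rewrite /W mulmxA -(mulmxA _ (svd_V D)^T (svd_V D)) svd_V_orth mulmx1.
  exact/esym/svd_eq.
apply/eqP; rewrite -subr_eq0 -{1}[A]mulmx1 -mulmxBr; apply/eqP/matrixP => i j.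
have := inj ((1%:M - W) *m delta_mx j (0 : 'I_1)); rewrite !mulmxA => h.
have z0 : G *m A *m (1%:M - W) *m delta_mx j (0 : 'I_1) = 0.
  by rewrite mulmxBr mulmx1 GW subrr mul0mx.
have /matrixP/(_ i 0) := h z0; rewrite -colE => {}z0.
by move: z0; rewrite mxE [RHS]mxE => ->; rewrite mxE.
Qed.

Lemma precond_solution (b : 'cV[R]_m) : (forall u : 'cV[R]_n, G *m (A *m u) = 0 -> A *m u = 0) ->
  A *m N *m (mpinv (A *m N) *m b) = A *m (mpinv A *m b).
Proof.
by move=> inj; rewrite !(mulmxA _ (mpinv _)) (mpinv_range_proj (erefl _) (precond_factor inj)).
Qed.

End preconditioned.

(** As G C is an isometry, the two-sided bound for G on the range of C inverts into a two-sided
    bound for C, that is, for the quadratic form of C^T C. *)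
Lemma cg_least_squares_bound (R : realType) (m n s : nat) (C : 'M[R]_(m, n)) (G : 'M[R]_(s, m))
    (b : 'cV[R]_m) (sig th eps : R) (k : nat) :
  (forall y, norm2 (G *m (C *m y)) = norm2 y) -> 0 < th < 1 -> 0 < sig ->
  (forall y, sig * (1 - th) * norm2 (C *m y) <= norm2 (G *m (C *m y)) <=
     sig * (1 + th) * norm2 (C *m y)) ->
  2 * th ^+ k <= eps ->
  norm2 (C *m (cg_iter (C^T *m C) (C^T *m b) 0 k - mpinv C *m b)) <=
  eps * norm2 (C *m (mpinv C *m b)).
Proof.
(* Polynomials in a matrix need positive dimension; in dimension 0 both sides vanish. *)
move=> iso th01 sig0 bnd ke; case: n C iso bnd => [|n] C iso bnd.
  have z0 (z : 'cV[R]_0) : norm2 (C *m z) = 0.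
    by rewrite (flatmx0 z) mulmx0 norm2E dotcv0r sqrtr0.
  by rewrite !z0 mulr0.
set e0 := mpinv C *m b; have /andP[th0 th1] := th01.
have lo0 : 0 < sig * (1 - th) by rewrite mulr_gt0// subr_gt0.
have hi0 : 0 < sig * (1 + th) by rewrite mulr_gt0// addr_gt0.
pose a := (sig * (1 + th))^-1 ^+ 2; pose bb := (sig * (1 - th))^-1 ^+ 2.
have dE (x : 'cV[R]_n.+1) : dotcv x (C^T *m C *m x) = norm2 (C *m x) ^+ 2.
  by rewrite norm2_sqr dotcv_mull mulmxA.
have ab : a < bb.
  rewrite ltrXn2r// ?nnegrE ?invr_ge0 ?(ltW lo0) ?(ltW hi0)//.
  by rewrite ltf_pV2 ?posrE// ltr_pM2l//; lra.
have Mge (x : 'cV[R]_n.+1) : a * dotcv x x <= dotcv x (C^T *m C *m x).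
  rewrite dE -norm2_sqr -exprMn lerXn2r ?nnegrE ?mulr_ge0 ?invr_ge0 ?(ltW hi0) ?norm2_ge0//.
  by rewrite ler_pdivrMl// -(iso x); case/andP: (bnd x).
have Mle (x : 'cV[R]_n.+1) : dotcv x (C^T *m C *m x) <= bb * dotcv x x.
  rewrite dE -norm2_sqr -exprMn lerXn2r ?nnegrE ?mulr_ge0 ?invr_ge0 ?(ltW lo0) ?norm2_ge0//.
  by rewrite ler_pdivlMl// -(iso x); case/andP: (bnd x).
have sym : (C^T *m C)^T = C^T *m C by rewrite trmx_mul trmxK.
have a0 : 0 < a by rewrite exprn_gt0// invr_gt0.
have bE : bb = a * ((1 + th) / (1 - th)) ^+ 2.
  rewrite /a /bb -exprMn; congr (_ ^+ 2); field.
  by rewrite !gt_eqF ?subr_gt0// addr_gt0.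
have := cg_error_bound sym a0 ab Mge Mle e0 k th01 bE.
rewrite !dE -exprMn {1}/e0 mpinv_normal_eq => h.
have ke' : 0 <= 2 * th ^+ k by rewrite mulr_ge0// exprn_ge0// ltW.
have {}h : norm2 (C *m (cg_iter (C^T *m C) (C^T *m b) 0 k - e0)) <= 2 * th ^+ k * norm2 (C *m e0).
  by rewrite -(@ler_pXn2r _ 2)// ?nnegrE ?(mulr_ge0 ke') ?norm2_ge0.
by apply: (le_trans h); rewrite ler_wpM2r ?norm2_ge0.
Qed.

(** For eps > 2 the quotient of logarithms is negative; the maximum with 0 then means no iteration,
    and 2 <= eps is enough. *)
Lemma geometric_iterations (R : realType) (th eps : R) : 0 < th < 1 -> 0 < eps ->
  2 * th ^+ (absz (Num.max 0 (Num.ceil ((ln eps - ln 2) / ln th)))) <= eps.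
Proof.
move=> /andP[th0 th1] eps0; set x := _ / _; set k := absz _.
have ln0 : ln th < 0 by rewrite ln_lt0// th0.
have kx : x <= k%:R.
  have -> : k%:R = (Num.max 0 (Num.ceil x))%:~R :> R.
    by rewrite -[RHS]/((_ : int)%:~R) -(@gez0_abs (Num.max _ _)) ?le_max ?lexx// .
  by apply: (le_trans (ceil_ge x)); rewrite ler_int le_max lexx orbT.
rewrite -ler_pdivlMl// -ler_ln ?posrE ?exprn_gt0 ?mulr_gt0 ?invr_gt0//.
rewrite lnXn// lnM ?posrE ?invr_gt0// lnV ?posrE// addrC -[ln th *+ k]mulr_natr.
by move: kx; rewrite /x ler_ndivrMr// mulrC.
Qed.

Lemma reach_ebases (R : realType) (I : finType) (l : seq I) (y z : I -> R) : uniq l ->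
  (forall i, i \notin l -> y i = z i) -> reach [seq ebase i | i <- l] z y.
Proof.
elim: l z => [|i l IH] z /=; first by move=> _ yz; apply/funext => i; exact: yz.
move=> /andP[il ul] yz; exists (y i - z i); apply: IH => // j jl.
rewrite /vshift /ebase; have [->|ji] := eqVneq j i; first by rewrite mulr1 addrC subrK.
by rewrite mulr0 addr0 yz// inE negb_or ji.
Qed.

(** * Almost sure injectivity of the sketch *)

Section almost_sure_injectivity.
Context {R : realType} {d : measure_display} {T : measurableType d}.
Variables (P : probability T R) (r s m : nat) (rs : (r <= s)%N).
Variables (G : 'I_s -> 'I_m -> {RV P >-> R}) (Q : 'M[R]_(r, m)).
Hypotheses (hG : gaussian_matrix G) (QQ : Q *m Q^T = 1%:M).

(** Keeping only the first r rows of the sketch gives a square matrix, so injectivity follows from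
    one nonzero determinant. *)
Definition sketch_block (y : 'I_s * 'I_m -> R) : 'M[R]_r :=
  \matrix_(i, l) (y (widen_ord rs i, l)) *m Q^T.

Let F (y : 'I_s * 'I_m -> R) : R := \det (sketch_block y).

Let F_poly y a : exists p : {poly R}, forall x, F (vshift y a x) = p.[x].
Proof.
exists (\det (map_mx polyC (sketch_block y) + 'X *: map_mx polyC (sketch_block a))) => x.
rewrite -[RHS]/(horner_eval x _) -det_map_mx; congr (\det _); apply/matrixP => i j.
rewrite [RHS]mxE /= /horner_eval [X in X.[x]]mxE [X in (_ + X).[x]]mxE !mxE !hornerE /= mulr_sumr -big_split /=; apply: eq_bigr => l _.
by rewrite !mxE /vshift; ring.
Qed.

Let measurable_F (d' : measure_display) (T' : measurableType d') (c : T' -> 'I_s * 'I_m -> R) :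
  (forall i, measurable_fun setT (fun t => c t i)) ->
  measurable_fun setT (fun t => F (c t)).
Proof.
move=> mc; rewrite /F /determinant; apply: measurable_sum => g.
apply: measurable_funM => //; apply: measurable_prod => i _.
under eq_fun do rewrite mxE; apply: measurable_sum => l; apply: measurable_funM => //.
by under eq_fun do rewrite mxE; exact: mc.
Qed.

Let F_meas : coord_meas (fun y => ((F y == 0)%R%:R)%:E).
Proof.
apply: coord_meas_EFin => [y|d' T' c mc]; first by rewrite ler0n.
have mb : measurable_fun setT (fun t => F (c t) == 0).
  by apply: measurable_fun_eqr => //; exact: measurable_F.
exact: (measurableT_comp (f := fun b : bool => b%:R : R) _ mb).
Qed.

Lemma sketch_injective_ae :
  {ae P, forall w, forall u : 'cV[R]_r, sample_mx G w *m (Q^T *m u) = 0 -> u = 0}.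
Proof.
pose X w : 'I_s * 'I_m -> R := fun kl => G kl.1 kl.2 w.
have mX i : measurable_fun setT (fun w => X w i) by exact: measurable_funPT.
pose Z := [set w | F (X w) = 0].
have mZ : measurable Z.
  have := measurable_F mX => mFX; rewrite -[Z]setTI.
  by have := mFX measurableT [set 0] (measurable_set1 _); congr measurable; apply/seteqP; split.
exists Z; split => //.
  have -> : P Z = (\int[P]_w ((F (X w) == 0)%R%:R)%:E)%E.
    transitivity (\int[P]_w (\1_Z w)%:E)%E; first by rewrite integral_indic// setIT.
    apply: eq_integral => w _; rewrite indicE; congr (_%:R%:E); congr nat_of_bool.
    by apply/idP/idP; [rewrite inE => /eqP|move=> /eqP; rewrite inE].
  have := expect_indep_normal (X := fun kl : 'I_s * 'I_m => G kl.1 kl.2)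
    (fun kl => ebase kl) (fun=> 0) (fun kl => hG.1 kl.1 kl.2) hG.2 F_meas.
  under eq_integral => w _.
    rewrite (_ : (fun i => _) = X w); last first.
      by apply/funext => kl; rewrite add0r (sum_ebase kl (fun kl => G kl.1 kl.2 w)).
    over.
  move=> ->; apply: gauss_ex_poly_zero => //.
  (* Putting [Q] in the first r rows makes the block Q Q^T = 1, so the determinant is not the zero
     polynomial. *)
  pose y0 (kl : 'I_s * 'I_m) : R := if insub (kl.1 : nat) is Some i then Q i kl.2 else 0.
  exists y0.
    by apply: reach_ebases => [|i]; rewrite ?enum_uniq// mem_enum.
  rewrite /F (_ : sketch_block y0 = 1%:M) ?det1 ?oner_eq0//.
  rewrite /sketch_block -QQ; congr (_ *m _); apply/matrixP => i l; rewrite mxE /y0 /=.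
  by rewrite valK.
move=> w /= hw; apply: contrapT => /eqP FX; apply: hw => u Gu.
have uF : sketch_block (X w) \in unitmx by rewrite unitmxE unitfE.
have : sketch_block (X w) *m u = 0.
  apply/matrixP => i j; move/matrixP: Gu => /(_ (widen_ord rs i) j) Gu.
  rewrite [RHS]mxE; rewrite [RHS]mxE in Gu; rewrite -[RHS]Gu.
  rewrite /sketch_block -mulmxA !mxE; apply: eq_bigr => l _; by rewrite !mxE.
by move=> /(congr1 (mulmx (invmx (sketch_block (X w))))); rewrite mulmxA mulVmx// mul1mx mulmx0.
Qed.

End almost_sure_injectivity.

(** For t <= 23/20 the value exp (- t^2 / 2) is at least about 0.516. It is the 16th power of exp (-
    t^2 / 32) >= 1 - t^2 / 32 >= 0.9586, and four squarings stay above 1/2. *)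
Lemma exp_half_small (R : realType) (t : R) : 0 <= t -> 2 * expR (- (t ^+ 2 / 2)) < 1 ->
  23 / 20 < t.
Proof.
move=> t0 h; rewrite ltNge; apply/negP => t1; move: h; apply/negP; rewrite -leNgt.
have h1 : 9586 / 10000 <= expR (- (t ^+ 2 / 2) / 16).
  apply: le_trans (expR_ge1Dx _); nra.
move: h1; set a := expR _ => h1.
have -> : expR (- (t ^+ 2 / 2)) = (((a ^+ 2) ^+ 2) ^+ 2) ^+ 2.
  by rewrite /a -!expRM_natr; congr expR; field.
have sq (x y z : R) : 0 <= x -> x <= y -> z <= x * x -> z <= y ^+ 2.
  by move=> x0 xy /le_trans; apply; rewrite expr2 ler_pM.
have {h1} : 9189 / 10000 <= a ^+ 2 by apply: (sq _ _ _ _ h1); lra.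
move: (a ^+ 2) => x2 h2.
have {h2} : 8443 / 10000 <= x2 ^+ 2 by apply: (sq _ _ _ _ h2); lra.
move: (x2 ^+ 2) => x4 h4.
have {h4} : 7128 / 10000 <= x4 ^+ 2 by apply: (sq _ _ _ _ h4); lra.
move: (x4 ^+ 2) => x8 h8.
have h16 : 1 / 2 <= x8 ^+ 2 by apply: (sq _ _ _ _ h8); lra.
by rewrite -ler_pdivrMl// mulr1 -div1r.
Qed.

Theorem theorem4p5 (R : realType) (m n s : nat)
    (A : 'M[R]_(m, n)) (b : 'cV[R]_m) (gamma eps alpha : R)
    (d : measure_display) (T : measurableType d) (P : probability T R)
    (G : 'I_s -> 'I_m -> {RV P >-> R})
    (svd : forall w : T, econ_svd (sample_mx G w *m A))
    (meth : ls_method R)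
    (hr : (1 <= \rank A)%N)
    (hgamma : 1 < gamma)
    (hs : s%:Z = Num.ceil (gamma * n%:R))
    (hG : gaussian_matrix G)
    (heps : 0 < eps)
    (halpha0 : 0 < alpha)
    (halpha1 : alpha < 1 - Num.sqrt ((\rank A)%:R / s%:R))
    (hmeth : cg_like meth) :
  let rho : R := Num.sqrt ((\rank A)%:R / s%:R) in
  let k : nat :=
    absz (Num.max 0 (Num.ceil ((ln eps - ln 2) / ln (alpha + rho)))) in
  let N w := svd_precond (svd w) in
  let yCG w := meth _ _ (A *m N w) b 0 k in
  let ystar w := mpinv (A *m N w) *m b in
  let xCG w := N w *m yCG w in
  let xstar := mpinv A *m b in
  let rCG w := b - A *m xCG w in
  let rstar := b - A *m xstar in
  let normAN w := seminorm_mx ((A *m N w)^T *m (A *m N w)) in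
  let normA := seminorm_mx (A^T *m A) in
  let y_bound w := normAN w (yCG w - ystar w) <= eps * normAN w (ystar w) in
  let x_bound w := normA (xCG w - xstar) <= eps * normA xstar in
  let r_bound w := norm2 (rCG w - rstar) <= eps * norm2 (b - rstar) in
  with_prob_at_least P (1 - 2 * expR (- (alpha ^+ 2 * s%:R / 2))) y_bound
  /\ {ae P, forall w, (y_bound w <-> x_bound w) /\ (y_bound w <-> r_bound w)}.
Proof.
move=> rho k N yCG ystar xCG xstar rCG rstar normAN normA y_bound x_bound r_bound.
have [r [Q [QQ QA]]] := gram_schmidt A^T.
have rA : \rank A = r.
  rewrite -mxrank_tr -QA; apply/eqP; rewrite -/(row_free Q); apply/row_freeP.
  by exists Q^T.
have [X AX] : exists X, A = Q^T *m X.
  have /submxP[X XE] : (A^T <= Q)%MS by rewrite QA.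
  by exists X^T; rewrite -[LHS]trmxK XE trmx_mul.
have nsR : n%:R <= s%:R :> R.
  have /(congr1 (fun z : int => z%:~R : R)) := hs; rewrite -[LHS]/(s%:R) => ->.
  by apply: (le_trans _ (ceil_ge _)); rewrite ler_peMl ?ler0n// ltW.
have rs : (r <= s)%N.
  by rewrite -rA (leq_trans (rank_leq_col A))// -(ler_nat R).
rewrite rA in hr halpha1; have r0 := hr.
have s0 : (0 < s)%N := leq_trans r0 rs.
have sR0 : 0 < s%:R :> R by rewrite ltr0n.
pose sq := Num.sqrt s%:R : R.
have sq0 : 0 < sq by rewrite sqrtr_gt0.
have sq2 : sq ^+ 2 = s%:R by rewrite sqr_sqrtr// ltW.
have rhoE : Num.sqrt r%:R = rho * sq :> R.
  by rewrite /rho rA -sqrtrM ?divr_ge0// divfK// gt_eqF.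
have rho0 : 0 < rho by rewrite /rho rA sqrtr_gt0 divr_gt0// ltr0n.
rewrite -rA -/rho in halpha1.
have th01 : 0 < alpha + rho < 1 by apply/andP; split; lra.
split.
- have [e2|e2] := lerP 1 (2 * expR (- (alpha ^+ 2 * s%:R / 2))).
    exists set0; split => //; rewrite measure0 lee_fin; lra.
  pose t := alpha * sq.
  have tE : t ^+ 2 / 2 = alpha ^+ 2 * s%:R / 2 by rewrite exprMn sq2.
  have t0 : 0 <= t by rewrite mulr_ge0 ?ltW.
  have t1 : 23 / 20 < t by apply: exp_half_small => //; rewrite tE.
  have sr1 : 1 <= Num.sqrt r%:R :> R by rewrite -[X in X <= _]sqrtr1 ler_wsqrtr// ler1n.
  have tsq : t < sq - Num.sqrt r%:R.
    by rewrite rhoE /t -{2}(mul1r sq) -mulrBl ltr_pM2r.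
  (* From sqrt s > sqrt r + t > 1 + 23/20, whose square exceeds 4. *)
  have s4 : (4 < s)%N by rewrite -(ltr_nat R) -sq2; nra.
  have s4R : 4 < s%:R :> R by rewrite ltr_nat.
  (* Since sqrt r >= 1, t < sqrt s - 1 <= sqrt (s - 1). *)
  have ts : t <= 2 * Num.sqrt (s%:R - 1).
    have v0 : 0 <= Num.sqrt (s%:R - 1) :> R by exact: sqrtr_ge0.
    have v2 : Num.sqrt (s%:R - 1) ^+ 2 = s%:R - 1 :> R by rewrite sqr_sqrtr//; lra.
    have : sq <= Num.sqrt (s%:R - 1) + 1.
      rewrite -(@ler_pXn2r _ 2)// ?nnegrE ?addr_ge0// ?(ltW sq0)//.
      by rewrite sq2 sqrrD v2; lra.
    lra.
  have [E [mE hE PE]] := gaussian_singular_values hG QQ r0 s4 t1 ts.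
  exists E; split => //; last by rewrite -tE.
  move=> w Ew; rewrite /y_bound /normAN !seminorm_gram /yCG hmeth.
  apply: (@cg_least_squares_bound R m _ s _ (sample_mx G w) b sq (alpha + rho)) => //.
  - exact: norm2_sketch_precond.
  (* The vector A N y lies in the column space of A, so it is Q^T v with the same norm as v, and the
     singular value bounds for G Q^T apply. *)
  - move=> y; pose v := X *m (N w *m y).
    have vE : A *m N w *m y = Q^T *m v.
      by rewrite /v mulmxA -AX mulmxA.
    have -> : norm2 (A *m N w *m y) = norm2 v.
      by rewrite vE !norm2E dotcv_mull trmxK mulmxA QQ mul1mx.
    have := hE w Ew v; rewrite vE rhoE -/sq /t.
    have -> : sq - rho * sq - alpha * sq = sq * (1 - (alpha + rho)) by ring.
    by have -> : sq + rho * sq + alpha * sq = sq * (1 + (alpha + rho)) by ring.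
  - exact: geometric_iterations.
have := sketch_injective_ae rs hG QQ; apply: filterS => w inj.
have inj' (u : 'cV[R]_n) : sample_mx G w *m (A *m u) = 0 -> A *m u = 0.
  by rewrite AX -mulmxA => /inj ->; rewrite mulmx0.
have sol : A *m N w *m ystar w = A *m xstar by exact: precond_solution.
have yE : y_bound w = (norm2 (A *m N w *m yCG w - A *m xstar) <= eps * norm2 (A *m xstar)).
  by rewrite /y_bound /normAN !seminorm_gram mulmxBr sol.
have xE : x_bound w = y_bound w.
  by rewrite yE /x_bound /normA !seminorm_gram mulmxBr mulmxA.
have rE : r_bound w = y_bound w.
  rewrite yE /r_bound /rCG /rstar /xCG mulmxA.
  have -> : b - A *m N w *m yCG w - (b - A *m xstar) = - (A *m N w *m yCG w - A *m xstar).
    by rewrite !opprB [LHS]addrC addrA subrK.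
  by rewrite norm2N (opprB b) (addrC b) subrK.
by rewrite xE rE.
Qed.
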